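(* Let $(\mathcal{P}_t)_{t\in\mathbb{Z}_+}$ be the transition kernels of the preconditioned Crank–Nicolson (pCN) Metropolis–Hastings process on the separable Hilbert space $\mathcal{H}$ with target measure $\Pi$, $d\Pi/d\gamma\propto\exp(-g)$. Assume $g:\mathcal{H}\to\mathbb{R}$ is $\beta$-Hölder continuous for some $\beta\in(0,1]$ and $\inf_{x\in\mathcal{H}}g(x)>-\infty$. Then for any $p>1$ there exist constants $C,c>0$ such that $$\chi^2(\nu\mathcal{P}_t\mid\Pi)\le C\exp\big(-c\,\log(2t)^{2/\beta}\big)\Big\|\frac{d\nu}{d\Pi}\Big\|_{\mathrm{Lip}(\|\cdot\|^\beta)}^2$$ holds for all integers $t\ge1$ and all probability measures $\nu$ on $\mathcal{H}$ with $\beta$-Hölder continuous density $d\nu/d\Pi$.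
   Context: $\mathcal{H}$ is a separable Hilbert space with norm $\|\cdot\|$, and $\gamma$ is a Gaussian measure on $\mathcal{H}$ with mean $0$ and covariance operator $C_\gamma$ with $\mathrm{tr}(C_\gamma)<\infty$. For $g:\mathcal{H}\to\mathbb{R}$, the target probability measure $\Pi$ is defined by $d\Pi/d\gamma\propto\exp(-g)$. For a fixed $\rho\in[0,1)$, the pCN Metropolis–Hastings process is $$X_t=\begin{cases}p_t,&U_t\le\exp(g(X_{t-1})-g(p_t)),\\ X_{t-1},&U_t>\exp(g(X_{t-1})-g(p_t)),\end{cases}\qquad p_t=\rho X_{t-1}+\sqrt{1-\rho^2}\,Z_t,$$ with independent uniform random variables $(U_t)$ on $[0,1]$ and independent $\gamma$-distributed random variables $(Z_t)$ (all independent of each other and of $X_0$). $\mathcal{P}_t(x,\cdot)=\mathbb{P}(X_t\in\cdot\mid X_0=x)$ and $\nu\mathcal{P}_t=\int\mathcal{P}_t(x,\cdot)\,\nu(dx)$. A function is $\beta$-Hölder continuous if it is Lipschitz with respect to the metric $\|x-y\|^\beta$, and $\|f\|_{\mathrm{Lip}(\|\cdot\|^\beta)}=\sup_{x\ne y}|f(x)-f(y)|/\|x-y\|^\beta$. The kernels are reversible with respect to $\Pi$, and $\chi^2(\nu\mathcal{P}_t\mid\Pi)=\|\mathcal{P}_t(d\nu/d\Pi)-1\|_{L_2(\Pi)}^2$, where $\mathcal{P}_tf(x)=\int f(y)\,\mathcal{P}_t(x,dy)$. *)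

(* Defs.v *)
From HB Require Import structures.
From mathcomp Require Import all_boot all_order all_algebra finmap.
From mathcomp Require Import all_classical all_reals all_analysis.

Set Implicit Arguments.
Unset Strict Implicit.
Unset Printing Implicit Defensive.

Import Order.TTheory GRing.Theory Num.Theory.
Import numFieldNormedType.Exports.

Local Open Scope classical_set_scope.
Local Open Scope ring_scope.

Notation borel T := (g_sigma_algebraType (@open T)).

Section Hilbert.
Context {R : realType} {H : completeNormedModType R}.

Definition separable := exists2 D : set H, countable D & dense D.

Variable dot : {dot H for idfun}.

(* Together with the completeness of H, this makes (H, dot) a real Hilbert
   space whose norm is the one H comes with. *)
Definition norm_from_dot := forall x : H, `|x| ^+ 2 = dot x x.

Definition orthonormal_basis (E : set H) :=
  (forall e e', E e -> E e' -> dot e e' = (e == e')%:R) /\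
  (forall x, (forall e, E e -> dot x e = 0) -> x = 0).

(* Meant for positive C, whose trace is the same in all orthonormal bases and
   is a sum of nonnegative terms, as esum expects. *)
Definition finite_trace (C : H -> H) :=
  exists2 E : set H, orthonormal_basis E &
    (\esum_(e in E) (dot (C e) e)%:E < +oo)%E.

(* normal_prob m 0 is not the point mass at m, so the degenerate case is
   treated apart. *)
Definition normal_law (m s : R) : set R -> \bar R :=
  if s == 0 then \d_m else normal_prob m s.

Definition gaussian_measure (gamma : probability (borel H) R) :=
  forall h : H, exists m s : R, forall A : set R, measurable A ->
    pushforward gamma (dot h : borel H -> R) A = normal_law m s A.

Definition centered (gamma : probability (borel H) R) :=
  forall h : H, ('E_gamma[dot h] = 0)%E.

Definition covariance_operator (gamma : probability (borel H) R)
    (C : {linear H -> H}) :=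
  continuous C /\
  forall h k : H, covariance gamma (dot h) (dot k) = (dot (C h) k)%:E.

End Hilbert.
Arguments separable {R} H.

Section Hoelder.
Context {R : realType} {H : completeNormedModType R}.
Variable beta : R.

Definition hoelder_continuous (f : H -> R) :=
  exists L : R, forall x y : H, `|f x - f y| <= L * `|x - y| `^ beta.

(* The maximum with 0 only matters when H = {0}: ereal_sup set0 is -oo. *)
Definition hoelder_seminorm (f : H -> R) : \bar R :=
  maxe 0%E (ereal_sup
    [set ((`|f xy.1 - f xy.2| / `|xy.1 - xy.2| `^ beta)%:E)
      | xy in [set xy : H * H | xy.1 != xy.2]]).

End Hoelder.

Section Density.
Context {d : measure_display} {T : measurableType d} {R : realType}.

(* f is a version of the Radon-Nikodym derivative of mu with respect to nu. *)
Definition is_density (mu nu : set T -> \bar R) (f : T -> R) :=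
  measurable_fun setT f /\
  forall A, measurable A -> mu A = (\int[nu]_(x in A) (f x)%:E)%E.

(* Densities being unique almost everywhere, the set below has at most one
   element; it is empty, and the divergence is +oo, when there is none. *)
Definition chi2 (mu nu : set T -> \bar R) : \bar R :=
  ereal_inf [set (\int[nu]_x ((f x - 1) ^+ 2)%:E)%E | f in is_density mu nu].

End Density.

Section Independence.
Context {d : measure_display} {Omega : measurableType d} {R : realType}.
Variable P : probability Omega R.

Definition mutually_independent (I : choiceType)
    (F : I -> set (set Omega)) :=
  forall (J : {fset I}) (A : I -> set Omega),
    (forall i, i \in J -> F i (A i)) ->
    P (\bigcap_(i in [set` J]) A i) = (\prod_(i <- J) P (A i))%E.

End Independence.

Section PCN.
Context {R : realType} {H : completeNormedModType R}.
Context {d : measure_display} {Omega : measurableType d}.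
Variable P : probability Omega R.
Variables (U : nat -> {RV P >-> R}) (Z : nat -> {RV P >-> borel H}).

(* U t and Z t drive the transition from time t to time t+1.  The index type
   nat + nat merges the two sequences into a single independent family. *)
Definition pcn_noise (gamma : probability (borel H) R) :=
  [/\ forall t (A : set R), measurable A ->
        distribution P (U t) A = uniform_prob (@ltr01 R) A,
      forall t (A : set (borel H)), measurable A ->
        distribution P (Z t) A = gamma A
    & mutually_independent P (fun i : nat + nat =>
        match i with
        | inl t => g_sigma_algebra_preimage (U t)
        | inr t => g_sigma_algebra_preimage (Z t)
        end)].

Variables (rho : R) (g : H -> R).

Definition pcn_proposal (x z : H) : H :=
  rho *: x + Num.sqrt (1 - rho ^+ 2) *: z.

Definition pcn_step (x z : H) (u : R) : H :=
  let p := pcn_proposal x z in if u <= expR (g x - g p) then p else x.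

Fixpoint pcn (x : H) (t : nat) (w : Omega) : H :=
  if t is s.+1 then pcn_step (pcn x s w) (Z s w) (U s w) else x.

(* The noise being independent of the initial state, the law of X_t given
   X_0 = x is the law of the process started at the constant x. *)
Definition pcn_kernel (t : nat) (x : H) : set (borel H) -> \bar R :=
  pushforward P (pcn x t : Omega -> borel H).

Definition pcn_law (nu : probability (borel H) R) (t : nat) :
    set (borel H) -> \bar R :=
  fun A => (\int[nu]_x pcn_kernel t x A)%E.

End PCN.

(* Main.v *)
Require Import Defs.
From HB Require Import structures.
From mathcomp Require Import all_boot all_order all_algebra finmap.
From mathcomp Require Import all_classical all_reals all_analysis.
From mathcomp Require Import measurable_realfun ring lra.

Set Implicit Arguments.
Unset Strict Implicit.
Unset Printing Implicit Defensive.

Import Order.TTheory GRing.Theory Num.Theory.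
Import numFieldNormedType.Exports.

Local Open Scope classical_set_scope.
Local Open Scope ring_scope.

(* The Markov operator K of the pCN chain is reversible for Pi because gamma^2
   is invariant under rotations of H * H, the proposal being the first component
   of a rotation; that invariance is proved on cosines of linear functionals,
   whose integrals depend only on the covariance. Gaussian proposals have a
   spectral gap: squaring the correlation multiplies mean square increments by at
   most 4, and finitely many squarings nearly decorrelate. On the ball of radius r,
   the density of Pi and the acceptance probabilities are bounded below so that,
   for v = K^n (dnu/dPi) - 1 truncated to this ball, one step contracts the
   variance by 1 - const * exp(- 5 L r^beta), up to an error of order
   exp(- kappa r^2 / 2) which comes from Fernique's bound on the tails of gamma and
   from the fourth moment of v, nonincreasing in n. With
   exp(5 L r^beta) = (2 t)^(1/2) both terms are small enough after t steps. *)

(** * Integration *)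

(** The acceptance probability need not be bounded below over the whole space, so no uniform
    contraction is at hand; this forces the truncation, and the radius trades the contraction rate
    against the mass left outside. In [5 L r^beta], one unit comes from the density of [Pi] and two
    from each of the two acceptances that appear when a variance is written with an independent copy
    of the step. With [y = log (2 t)], the choice of [r] makes [t] steps contract by
    [exp (- c1 exp (y / 2))], which is below any [exp (- c y^s)] up to a factor. The rate is
    therefore fixed by the truncation error: [r^2] is a multiple of [y^(2 / beta)], whence the
    exponent of the theorem. That error is divided by the contraction rate, which costs
    [exp (y / 2)]; this is absorbed because [2 / beta >= 2]. The fourth moment converts mass outside
    the ball into a bound on squares through [2 a^2 <= e a^4 + 1 / e], with [e] of the order of the
    square root of that mass: hence the halved exponent [kappa r^2 / 2]. Uniformity in [nu] comes
    from [dnu/dPi] having mean 1 under [Pi]: its deviation from 1 is controlled by its Hölder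
    constant alone. *)

Section density_integral.
Local Open Scope ereal_scope.
Context d (T : measurableType d) (R : realType).
Variables (mu nu : {measure set T -> \bar R}) (f : T -> R).
Hypotheses (mf : measurable_fun setT f) (f0 : forall x, (0 <= f x)%R).
Hypothesis nuE : forall A, measurable A -> nu A = \int[mu]_(x in A) (f x)%:E.

Import HBNNSimple.

(** Monotone convergence along simple approximations of [u] reduces the claim to level sets, where
    it is [nuE]. *)
Lemma ge0_integral_density (u : T -> \bar R) :
  measurable_fun setT u -> (forall x, 0 <= u x) ->
  \int[nu]_x u x = \int[mu]_x (u x * (f x)%:E).
Proof.
move=> mu_ u0; pose u_ := nnsfun_approx measurableT mu_.
transitivity (limn (fun n => \int[nu]_x (u_ n x)%:E)).
  rewrite -monotone_convergence//.
  - apply: eq_integral => y _; apply/esym/cvg_lim => //.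
    exact: cvg_nnsfun_approx.
  - by move=> n; exact/measurable_EFinP/measurable_funP.
  - by move=> n y _; rewrite lee_fin.
  - by move=> y _ m n mn; rewrite lee_fin; exact/lefP/nd_nnsfun_approx.
rewrite [X in limn X](_ : _ =
    (fun n => \int[mu]_x ((u_ n x)%:E * (f x)%:E))).
  rewrite -monotone_convergence//; last 3 first.
    - move=> n; apply: emeasurable_funM; first exact/measurable_EFinP/measurable_funP.
      exact/measurable_EFinP.
    - by move=> n x _; rewrite mule_ge0// lee_fin.
    - move=> x _ m n mn; rewrite lee_wpmul2r ?lee_fin//.
      exact/lefP/nd_nnsfun_approx.
  apply: eq_integral => x _; apply/cvg_lim => //.
  apply: cvgeZr => //; exact: cvg_nnsfun_approx.
apply/funext => n.
transitivity (\sum_(k \in range (u_ n))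
    \int[nu]_x (k * \1_(u_ n @^-1` [set k]) x)%:E).
  under eq_integral do rewrite fimfunE -fsumEFin//.
  rewrite ge0_integral_fsum//; last 2 first.
  - by move=> y; exact/measurable_EFinP/measurable_funM.
  - by move=> y x _; rewrite nnfun_muleindic_ge0.
transitivity (\sum_(k \in range (u_ n))
    \int[mu]_x ((k * \1_(u_ n @^-1` [set k]) x)%:E * (f x)%:E)).
  apply: eq_fsbigr => r /set_mem[x0 _ u0r].
  have r0 : (0 <= r)%R by rewrite -u0r.
  have mr : measurable (u_ n @^-1` [set r]).
    by rewrite -(setTI (_ @^-1` _)); exact: (measurable_funP (u_ n)).
  rewrite (integralZl_indic_nnsfun _)// integral_indic// setIT nuE//.
  under [RHS]eq_integral do rewrite EFinM -muleA.
  rewrite ge0_integralZl//; last 2 first.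
  - apply: emeasurable_funM; last exact/measurable_EFinP.
    exact/measurable_EFinP/measurable_indic.
  - by move=> x _; rewrite mule_ge0 ?lee_fin.
  congr (_ * _); rewrite [LHS]integral_mkcond; apply: eq_integral => x _.
  by rewrite patchE indicE; case: ifPn => _; rewrite ?mul1e ?mul0e.
rewrite -ge0_integral_fsum//.
- apply: eq_integral => x _; rewrite -ge0_mule_fsuml.
    by congr (_ * _); rewrite fsumEFin// -fimfunE.
  by move=> i; rewrite EFinM nnfun_muleindic_ge0.
- move=> y; apply: emeasurable_funM; last exact/measurable_EFinP.
  by apply/measurable_EFinP/measurable_funM => //; exact: measurable_indic.
- by move=> y x _; rewrite mule_ge0// ?lee_fin// -lee_fin EFinM nnfun_muleindic_ge0.
Qed.

End density_integral.

Definition image_measure d d' (T1 : measurableType d) (T2 : measurableType d')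
    (R : realType) (m : {measure set T1 -> \bar R}) (f : T1 -> T2)
    (mf : measurable_fun setT f) : {measure set T2 -> \bar R}.
Proof. refine (pushforward m f : {measure set T2 -> \bar R}); exact: mf. Defined.

Definition product_prob d1 d2 (T1 : measurableType d1) (T2 : measurableType d2)
    (R : realType) (P1 : probability T1 R) (P2 : probability T2 R) :
  probability (T1 * T2)%type R := (P1 \x P2)%E.

Section bounded_functions.
Context d (T : measurableType d) (R : realType).

Definition bounded_mfun (F : T -> R) :=
  measurable_fun setT F /\ exists M, forall x, `|F x| <= M.

Lemma bounded_mfun_integrable (mu : probability T R) F :
  bounded_mfun F -> mu.-integrable setT (EFin \o F).
Proof.
move=> [mF [M FM]]; apply: (le_integrable measurableT _ _
  (finite_measure_integrable_cst mu M measurableT)).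
- exact/measurable_EFinP.
- move=> x _ /=; rewrite lee_fin (le_trans (FM x))//.
  by rewrite ler_norm.
Qed.

Lemma bounded_mfun_cst r : bounded_mfun (cst r).
Proof. by split; [exact: measurable_cst|exists `|r|]. Qed.

Lemma bounded_mfunD F G : bounded_mfun F -> bounded_mfun G ->
  bounded_mfun (fun x => F x + G x).
Proof.
move=> [mF [M FM]] [mG [N GN]]; split; first exact: measurable_funD.
by exists (M + N) => x; rewrite (le_trans (ler_normD _ _))// lerD.
Qed.

Lemma bounded_mfunM F G : bounded_mfun F -> bounded_mfun G ->
  bounded_mfun (fun x => F x * G x).
Proof.
move=> [mF [M FM]] [mG [N GN]]; split; first exact: measurable_funM.
by exists (M * N) => x; rewrite normrM ler_pM.
Qed.

Lemma bounded_mfun_cos l : measurable_fun setT l ->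
  bounded_mfun (fun x => cos (l x)).
Proof.
move=> ml; split.
  apply: (measurableT_comp _ ml); apply: continuous_measurable_fun.
  exact: continuous_cos.
exists 1 => x; rewrite ler_norml cos_geN1 cos_le1//.
Qed.

(** Dominated convergence under both measures; this carries equality of integrals from polynomials
    in cosines to indicators. *)
Lemma bounded_Rintegral_lim_eq (mu nu : probability T R) (F_ : (T -> R)^nat) (F : T -> R) (M : R) :
  (forall n, measurable_fun setT (F_ n)) -> (forall n x, `|F_ n x| <= M) ->
  measurable_fun setT F -> (forall x, F_ n x @[n --> \oo] --> F x) ->
  (forall n, \int[mu]_x F_ n x = \int[nu]_x F_ n x) ->
  \int[mu]_x F x = \int[nu]_x F x.
Proof.
move=> mF_ F_M mF F_F munu.
have cv (m : probability T R) :
    (\int[m]_x (F_ n x)%:E @[n --> \oo] --> \int[m]_x (F x)%:E)%E.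
  have [] // := @dominated_convergence _ _ _ m _ measurableT
    (fun n x => (F_ n x)%:E) (fun x => (F x)%:E) (cst M%:E).
  - by move=> n; exact/measurable_EFinP.
  - exact/measurable_EFinP.
  - by apply: aeW => x _; apply: cvg_EFin; [exact: nearW|exact: F_F].
  - exact: finite_measure_integrable_cst.
  - by apply: aeW => x n _; rewrite /= lee_fin.
have e n : (\int[mu]_x (F_ n x)%:E = \int[nu]_x (F_ n x)%:E)%E.
  have bF : bounded_mfun (F_ n) by split => //; exists M.
  have := congr1 EFin (munu n); rewrite /Rintegral.
  by rewrite !fineK//; apply: integrable_fin_num => //;
    exact: bounded_mfun_integrable.
congr fine; apply: cvg_unique (cv mu) _; first exact: ereal_hausdorff.
by rewrite (funext e); exact: cv.
Qed.

End bounded_functions.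

(** * An indicator as a limit of polynomials *)

Section indicator_limit.
Context {R : realType}.
Implicit Types v : R.

(* [m q ^ m -> 0] for [0 <= q < 1], through [q = s ^ 2] and Bernoulli's
   inequality. *)
Lemma cvg_mul_exprn q : 0 <= q -> q < 1 -> n%:R * q ^+ n @[n --> \oo] --> (0 : R).
Proof.
move=> q0 q1.
have [->|qN0] := eqVneq q 0.
  rewrite -(cvg_shiftn 1); under eq_fun do rewrite addn1 expr0n /= mulr0.
  exact: cvg_cst.
have {}q0 : 0 < q by rewrite lt_neqAle eq_sym qN0.
pose s := Num.sqrt q.
have s0 : 0 < s by rewrite sqrtr_gt0.
have s1 : s < 1 by rewrite -sqrtr1 ltr_sqrt.
have qs : q = s ^+ 2 by rewrite sqr_sqrtr// ltW.
pose h := s^-1 - 1.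
have h0 : 0 < h by rewrite subr_gt0 invf_gt1.
have bern n : n%:R * s ^+ n <= h^-1.
  suff: n%:R * h <= s^-1 ^+ n.
    rewrite exprVn => nh; rewrite -ler_pdivlMr ?exprn_gt0// mulrC.
    by rewrite ler_pdivlMr.
  have : n%:R * h <= (1 + h) ^+ n.
    elim: n => [|n IHn]; first by rewrite mul0r expr0.
    rewrite exprS mulrDl mul1r -natr1 mulrDl mul1r lerD//.
    apply: ler_peMr; first exact: ltW.
    by rewrite exprn_ege1// lerDl ltW.
  have -> : 1 + h = s^-1 by rewrite /h addrC subrK.
  by [].
have cs : s ^+ n * h^-1 @[n --> \oo] --> (0 : R).
  rewrite -[0](mul0r h^-1); apply: cvgMr_tmp; apply: cvg_expr.
  by rewrite gtr0_norm.
apply: squeeze_cvgr (cvg_cst 0) cs; apply: nearW => n.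
apply/andP; split; first by apply: mulr_ge0 => //; rewrite exprn_ge0// ltW.
by rewrite qs -exprM mul2n -addnn exprD mulrCA ler_pM2l ?exprn_gt0.
Qed.

(** The power [(1 - v^n)^(n 2^n)] behaves like [exp (- n (2 v)^n)]: it is bounded above by this
    exponential when [2 v >= 1], and Bernoulli's inequality bounds its distance to 1 by [n (2 v)^n]
    when [2 v < 1]. The extra factor [n] in the exponent puts the threshold [v = 1/2] on the side of
    the limit 1. *)
Lemma cvg_indic_half v : 0 <= v <= 1 ->
  1 - (1 - v ^+ n) ^+ (n * 2 ^ n) @[n --> \oo] --> ((2^-1 <= v)%R%:R : R).
Proof.
move=> /andP[v0 v1].
have w01 n : 0 <= 1 - v ^+ n <= 1.
  by rewrite subr_ge0 exprn_ile1//= lerBlDr lerDl exprn_ge0.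
have mE n : (n * 2 ^ n)%:R * v ^+ n = n%:R * (2 * v) ^+ n :> R.
  by rewrite natrM natrX exprMn mulrA.
have [vh|vh] := leP 2^-1 v.
  rewrite -[X in _ --> X]subr0; apply: cvgB; first exact: cvg_cst.
  apply: squeeze_cvgr (cvg_cst 0) (cvg_expr (_ : `|expR (-1)| < 1)); last first.
    by rewrite ger0_norm ?expR_ge0// expR_lt1 ltrN10.
  apply: nearW => n; rewrite exprn_ge0 /=; last by case/andP: (w01 n).
  apply: (@le_trans _ _ (expR (- v ^+ n) ^+ (n * 2 ^ n))).
    apply: lerXn2r; rewrite ?nnegrE ?expR_ge0//; first by case/andP: (w01 n).
    exact: expR_ge1Dx.
  rewrite -!expRM_natl ler_expR !mulrN lerN2 mulr1 mE.
  by apply: ler_peMr => //; apply: exprn_ege1; lra.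
rewrite -[X in _ --> X](_ : 0 = _ :> R)//.
apply: squeeze_cvgr (cvg_cst 0) (cvg_mul_exprn (_ : 0 <= 2 * v) _); last 2 first.
- lra.
- lra.
apply: nearW => n; rewrite subr_ge0 exprn_ile1/=; [|by case/andP: (w01 n)..].
rewrite lerBlDr -mE.
have bern (w : R) k : 0 <= w <= 1 -> 1 <= k%:R * w + (1 - w) ^+ k.
  move=> /andP[w0 w1]; elim: k => [|k IHk]; first by rewrite mul0r add0r expr0.
  have p0 : 0 <= (1 - w) ^+ k by rewrite exprn_ge0// subr_ge0.
  have p1 : (1 - w) ^+ k <= 1 by rewrite exprn_ile1// ?subr_ge0// lerBlDr lerDl.
  rewrite exprS mulrDl mul1r -natr1 mulrDl mul1r.
  have : w * (1 - w) ^+ k <= w by rewrite ler_piMr.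
  rewrite mulNr; lra.
by apply: bern; rewrite exprn_ge0//= exprn_ile1.
Qed.

End indicator_limit.

(** * Uniqueness of measures through cosines *)

Section cosine_uniqueness.
Context d (T : measurableType d) (R : realType).
Variables (mu nu : probability T R) (V : set (T -> R)).
Hypothesis mV : forall l, V l -> measurable_fun setT l.
Hypothesis Vcst : forall b, V (cst b).
Hypothesis VL : forall r l m, V l -> V m -> V (fun x => r * l x + m x).
Hypothesis Vcos : forall l, V l ->
  \int[mu]_x cos (l x) = \int[nu]_x cos (l x).

Definition cos_agree (F : T -> R) := bounded_mfun F /\
  forall l, V l -> \int[mu]_x (F x * cos (l x)) = \int[nu]_x (F x * cos (l x)).

(** Unlike [cos_agree], this property passes to products. It singles out an algebra of bounded
    functions, closed under bounded pointwise limits, whose indicators form a pi-system. *)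
Definition cos_multiplier (G : T -> R) := bounded_mfun G /\
  forall F, cos_agree F -> cos_agree (fun x => F x * G x).

Let bcos l : V l -> bounded_mfun (fun x => cos (l x)).
Proof. by move=> /mV; exact: bounded_mfun_cos. Qed.

Lemma cos_agree1 : cos_agree (cst 1).
Proof.
split=> [|l Vl]; first exact: bounded_mfun_cst.
rewrite (@eq_Rintegral _ _ _ _ _ (fun x => cos (l x)))//; last by move=> x _; rewrite mul1r.
by rewrite [RHS](@eq_Rintegral _ _ _ _ _ (fun x => cos (l x)))//; [exact: Vcos|move=> x _; rewrite mul1r].
Qed.

Lemma cos_agreeL r F G : cos_agree F -> cos_agree G ->
  cos_agree (fun x => r * F x + G x).
Proof.
move=> [bF FE] [bG GE].
have brF : bounded_mfun (fun x => r * F x).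
  by apply: bounded_mfunM => //; exact: bounded_mfun_cst.
split=> [|l Vl]; first exact: bounded_mfunD.
have e (m : probability T R) : \int[m]_x ((r * F x + G x) * cos (l x)) =
    r * \int[m]_x (F x * cos (l x)) + \int[m]_x (G x * cos (l x)).
  under eq_Rintegral do rewrite mulrDl -mulrA.
  rewrite RintegralD//; last 2 first.
  - apply: (@bounded_mfun_integrable _ _ _ m (fun x => r * (F x * cos (l x)))).
    apply: bounded_mfunM; first exact: bounded_mfun_cst.
    by apply: bounded_mfunM => //; exact: bcos.
  - apply: (@bounded_mfun_integrable _ _ _ m (fun x => G x * cos (l x))).
    by apply: bounded_mfunM => //; exact: bcos.
  rewrite RintegralZl//.
  apply: (@bounded_mfun_integrable _ _ _ m (fun x => F x * cos (l x))).
  by apply: bounded_mfunM => //; exact: bcos.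
by rewrite !e FE// GE.
Qed.

Lemma eq_cos_multiplier F G : F =1 G -> cos_multiplier F -> cos_multiplier G.
Proof. by move=> /funext ->. Qed.

Lemma cos_multiplier_cst r : cos_multiplier (cst r).
Proof.
split=> [|F aF]; first exact: bounded_mfun_cst.
have a0 : cos_agree (cst 0).
  split=> [|l Vl]; first exact: bounded_mfun_cst.
  rewrite (@eq_Rintegral _ _ _ _ _ (cst 0))//; last by move=> x _; rewrite /= mul0r.
  rewrite [RHS](@eq_Rintegral _ _ _ _ _ (cst 0))//; last by move=> x _; rewrite /= mul0r.
  by rewrite !Rintegral_cst// !mul0r.
rewrite (_ : (fun x => F x * cst r x) = (fun x => r * F x + cst 0 x)).
  exact: cos_agreeL.
by apply/funext => x /=; rewrite addr0 mulrC.
Qed.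

Lemma cos_multiplierD F G : cos_multiplier F -> cos_multiplier G ->
  cos_multiplier (fun x => F x + G x).
Proof.
move=> [bF mF] [bG mG]; split=> [|H aH]; first exact: bounded_mfunD.
rewrite (_ : (fun x => H x * (F x + G x)) = (fun x => 1 * (H x * F x) + H x * G x)).
  by apply: cos_agreeL; [exact: mF|exact: mG].
by apply/funext => x; rewrite mul1r mulrDr.
Qed.

Lemma cos_multiplierM F G : cos_multiplier F -> cos_multiplier G ->
  cos_multiplier (fun x => F x * G x).
Proof.
move=> [bF mF] [bG mG]; split=> [|H aH]; first exact: bounded_mfunM.
under eq_fun do rewrite mulrA.
by apply: mG; exact: mF.
Qed.

Lemma cos_multiplierX F n : cos_multiplier F ->
  cos_multiplier (fun x => F x ^+ n).
Proof.
move=> mF; elim: n => [|n IHn].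
  by apply: eq_cos_multiplier (cos_multiplier_cst 1) => x; rewrite expr0.
by apply: eq_cos_multiplier (cos_multiplierM mF IHn) => x; rewrite exprS.
Qed.

Lemma cos_multiplier_onem F : cos_multiplier F ->
  cos_multiplier (fun x => 1 - F x).
Proof.
move=> mF; apply: eq_cos_multiplier (cos_multiplierD (cos_multiplier_cst 1)
  (cos_multiplierM (cos_multiplier_cst (-1)) mF)) => x.
by rewrite /= mulN1r.
Qed.

(** A product of two cosines is half the sum of the cosines of the sum and of the difference of the
    arguments, and [V] contains both. *)
Lemma cos_multiplier_cos l : V l -> cos_multiplier (fun x => cos (l x)).
Proof.
move=> Vl; split=> [|F [bF FE]]; first exact: bcos.
split=> [|m Vm]; first by apply: bounded_mfunM => //; exact: bcos.
have V1 : V (fun x => 1 * l x + m x) by exact: VL.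
have V2 : V (fun x => (-1) * l x + m x) by exact: VL.
have prod x : F x * cos (l x) * cos (m x) =
    2^-1 * (F x * cos (1 * l x + m x) + F x * cos ((-1) * l x + m x)).
  by rewrite mul1r mulN1r !cosD cosN sinN; field.
have e (n : probability T R) : \int[n]_x (F x * cos (l x) * cos (m x)) =
    2^-1 * (\int[n]_x (F x * cos (1 * l x + m x)) +
            \int[n]_x (F x * cos ((-1) * l x + m x))).
  have i1 := bounded_mfun_integrable n (bounded_mfunM bF (bcos V1)).
  have i2 := bounded_mfun_integrable n (bounded_mfunM bF (bcos V2)).
  rewrite -RintegralD// -RintegralZl//; last exact: (bounded_mfun_integrable n
    (bounded_mfunD (bounded_mfunM bF (bcos V1)) (bounded_mfunM bF (bcos V2)))).
  by apply: eq_Rintegral => y _; exact: prod.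
by rewrite !e !FE.
Qed.

Lemma cos_multiplier_lim (G_ : (T -> R)^nat) (G : T -> R) (M : R) :
  (forall n, cos_multiplier (G_ n)) -> (forall n x, `|G_ n x| <= M) ->
  (forall x, G_ n x @[n --> \oo] --> G x) -> cos_multiplier G.
Proof.
move=> mG_ G_M G_G.
have mG : measurable_fun setT G.
  apply: (@measurable_fun_cvg _ _ _ setT G_); last by move=> x _; exact: G_G.
  by move=> n; case: (mG_ n) => -[].
have GM x : `|G x| <= M.
  rewrite -(cvg_lim (@Rhausdorff R) (cvg_norm (G_G x))).
  by apply: limr_le; [apply: is_cvg_norm; apply/cvg_ex; exists (G x); exact: G_G|
    exact: nearW].
split=> [|F aF]; first by split=> //; exists M.
have [bF _] := aF.
split=> [|l Vl]; first by apply: bounded_mfunM => //; split=> //; exists M.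
case: (bF) => mF [N FN].
apply: (@bounded_Rintegral_lim_eq _ _ _ mu nu
  (fun n x => F x * G_ n x * cos (l x)) _ (N * M * 1)).
- move=> n; apply: measurable_funM; last by case: (bcos Vl).
  by apply: measurable_funM => //; case: (mG_ n) => -[].
- move=> n x; rewrite !normrM ler_pM ?mulr_ge0// ?ler_pM//.
  by rewrite ler_norml cos_geN1 cos_le1.
- apply: measurable_funM; last by case: (bcos Vl).
  exact: measurable_funM.
- move=> x; apply: cvgMr_tmp; apply: cvgMl_tmp; exact: G_G.
- by move=> n; case: (mG_ n) => _ /(_ F aF)[_]; exact.
Qed.

Definition multiplier_set : set (set T) := [set A | measurable A /\ cos_multiplier (\1_A)].

(** The set is [v >= 1/2] for [v = (1 + cos l) / 2], which takes its values in [[0, 1]], and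
    [cvg_indic_half] writes its indicator as a limit of polynomials in [v]. *)
Lemma multiplier_set_halfcos l : V l -> multiplier_set [set x | 0 <= cos (l x)].
Proof.
move=> Vl; split.
  rewrite -[X in measurable X]setTI.
  apply: (@measurable_fun_ler _ _ _ setT (cst 0) (fun x => cos (l x))) => //.
  by case: (bcos Vl).
pose v x := 2^-1 * (1 + cos (l x)).
have v01 x : 0 <= v x <= 1.
  have := cos_geN1 (l x); have := cos_le1 (l x); rewrite /v; lra.
have mv : cos_multiplier v.
  apply: cos_multiplierM; first exact: cos_multiplier_cst.
  by apply: cos_multiplierD; [exact: cos_multiplier_cst|exact: cos_multiplier_cos].
pose w n x := 1 - v x ^+ n.
have w01 n x : 0 <= w n x <= 1.
  have /andP[v0 v1] := v01 x.
  by rewrite subr_ge0 exprn_ile1//= lerBlDr lerDl exprn_ge0.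
apply: (@cos_multiplier_lim (fun n x => 1 - w n x ^+ (n * 2 ^ n)) _ 1).
- move=> n; apply: cos_multiplier_onem; apply: cos_multiplierX.
  by apply: cos_multiplier_onem; exact: cos_multiplierX.
- move=> n x; have /andP[w0 w1] := w01 n x.
  rewrite ger0_norm ?subr_ge0 ?exprn_ile1//.
  by rewrite lerBlDr lerDl exprn_ge0.
- move=> x; rewrite indicE.
  rewrite (_ : x \in _ = (2^-1 <= v x)); first exact: cvg_indic_half.
  apply/idP/idP => [|h]; first by rewrite inE/= /v; lra.
  by rewrite inE/=; move: h; rewrite /v; lra.
Qed.

(** The multiplier property is tested on the constant function 1 and on the cosine of the zero
    functional. *)
Lemma multiplier_set_measure A : multiplier_set A -> mu A = nu A.
Proof.
move=> [mA [_ tA]]; have [_ /(_ _ (Vcst 0)) munu] := tA _ cos_agree1.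
have e (m : probability T R) : \int[m]_x (cst 1 x * \1_A x * cos (cst 0 x)) = fine (m A).
  under eq_Rintegral do rewrite /= cos0 mulr1 mul1r.
  by rewrite /Rintegral integral_indic// setIT.
by have := congr1 EFin munu; rewrite !e !fineK//; exact: fin_num_measure.
Qed.

Lemma multiplier_setI A B : multiplier_set A -> multiplier_set B ->
  multiplier_set (A `&` B).
Proof.
move=> [mA tA] [mB tB]; split; first exact: measurableI.
by apply: eq_cos_multiplier (cos_multiplierM tA tB) => x; rewrite indicI.
Qed.

(** After the phase shift by [pi / 2], the set [S n] is where [- sin (l x / (n + 1))] is
    nonnegative. Once [pi (n + 1)] exceeds the absolute value of [l x], this says that [l x <= 0],
    so that the half-space is the lower limit of the sets [S n]. *)
Lemma multiplier_set_halfspace l : V l ->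
  <<s multiplier_set >> [set x | l x <= 0].
Proof.
move=> Vl.
pose S n := [set x | 0 <= cos (n.+1%:R^-1 * l x + pi / 2)].
have SV n : multiplier_set (S n).
  apply: (@multiplier_set_halfcos (fun x => n.+1%:R^-1 * l x + cst (pi / 2) x)).
  exact: VL.
rewrite (_ : [set x | _] = \bigcup_m \bigcap_(n in [set n | (m <= n)%N]) S n); last first.
  have SE x n : `|l x| < pi * n.+1%:R -> (S n x <-> l x <= 0).
    move=> lxn; have n0 : 0 < n.+1%:R :> R by [].
    have {}lxn : `|n.+1%:R^-1 * l x| < pi.
      by rewrite normrM gtr0_norm ?invr_gt0// mulrC ltr_pdivrMr.
    rewrite /S/= cosDpihalf oppr_ge0 -[l x <= 0](pmulr_rle0 _ (_ : 0 < n.+1%:R^-1)) ?invr_gt0//.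
    move: lxn; set y := _ * l x; rewrite ltr_norml => /andP[y1 y2].
    split=> [|y0].
      apply: contraTT; rewrite -!ltNge => y0; apply: sin_gt0_pi.
      by rewrite y0.
    have [->|yN0] := eqVneq y 0; first by rewrite sin0.
    rewrite -oppr_ge0 -sinN ltW// sin_gt0_pi// oppr_gt0 lt_neqAle yN0 y0/=.
    by rewrite ltrNl.
  have big x : exists m, forall n, (m <= n)%N -> `|l x| < pi * n.+1%:R.
    exists (Num.truncn (`|l x| / pi)) => n mn.
    rewrite mulrC -ltr_pdivrMr ?pi_gt0//.
    apply: (@lt_le_trans _ _ (Num.truncn (`|l x| / pi)).+1%:R).
      by rewrite truncnS_gt.
    by rewrite ler_nat.
  apply/seteqP; split=> x /=.
    by move=> lx0; have [m mP] := big x; exists m => // n /= mn; apply/SE => //; exact: mP.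
  move=> [m _ mS]; have [m' mP'] := big x.
  apply/(SE x (maxn m m')); first by apply: mP'; exact: leq_maxr.
  by apply: mS; exact: leq_maxl.
have sm : sigma_algebra setT <<s multiplier_set >> by exact: smallest_sigma_algebra.
apply: sigma_algebra_bigcup => m.
pose TT := g_sigma_algebraType multiplier_set.
apply: (@bigcap_measurable _ TT); first by exists m => /=.
by move=> n _; apply: sub_sigma_algebra.
Qed.

(** The multiplier sets form a pi-system on which the two measures coincide, and the sigma-algebra
    that they generate contains the half-spaces. *)
Lemma cosine_uniqueness (A : set T) :
  <<s [set [set x | l x <= 0] | l in V]>> A -> mu A = nu A.
Proof.
move=> sA.
have {}sA : <<s multiplier_set >> A.
  apply: smallest_sub sA; first exact: smallest_sigma_algebra.
  by move=> _ [l Vl <-]; exact: multiplier_set_halfspace.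
apply: (g_sigma_algebra_measure_unique multiplier_set _ (fun=> setT)) => //.
- by move=> B [].
- move=> _; split=> //; apply: eq_cos_multiplier (cos_multiplier_cst 1) => x.
  by rewrite indicT.
- exact: bigcup_const.
- exact: multiplier_setI.
- exact: multiplier_set_measure.
- by move=> _; exact: (le_lt_trans (probability_le1 mu measurableT) (ltry _)).
Qed.

End cosine_uniqueness.

(** * Real Gaussian laws *)

Section lebesgue_affine.
Context {R : realType}.
Local Open Scope ereal_scope.
Local Notation leb := (@lebesgue_measure R).

(** Lebesgue measure equals [a] times its image under the affine map, because the two agree on
    bounded intervals. *)
Lemma ge0_integral_lebesgue_affine (a b : R) (F : R -> \bar R) : (0 < a)%R ->
  measurable_fun setT F -> (forall x, 0 <= F x) ->
  \int[leb]_x F x = \int[leb]_x (a%:E * F (a * x + b)%R).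
Proof.
move=> a0 mF F0.
pose phi (x : R) : measurableTypeR R := (a * x + b)%R.
have mphi : measurable_fun setT phi.
  by apply: measurable_funD => //; exact: measurable_funM.
pose m' : {measure set (measurableTypeR R) -> \bar R} :=
  mscale (NngNum (ltW a0)) (image_measure leb mphi).
have mE A : measurable A -> leb A = m' A.
  move=> mA; apply: lebesgue_measure_unique => //= _ [[u v]] _ <-.
  rewrite /mscale/= /pushforward.
  rewrite (_ : _ @^-1` _ = `](u - b) / a, (v - b) / a]%classic)%R; last first.
    apply/seteqP; split=> x /=; rewrite !in_itv/= /phi => /andP[h1 h2];
    by apply/andP; move: h1 h2; rewrite ltr_pdivrMr// ler_pdivlMr// ltrBlDr lerBrDr mulrC.
  rewrite !lebesgue_measure_itv/= !lte_fin ltr_pM2r ?invr_gt0// ltrD2r.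
  case: ifPn => _; last by rewrite mule0.
  rewrite -!EFinD -EFinM; congr EFin.
  by field; rewrite gt_eqF.
rewrite (eq_measure_integral m'); last by move=> A mA _; exact: mE.
rewrite ge0_integral_mscale//= ge0_integral_pushforward//.
rewrite preimage_setT -ge0_integralZl//.
- exact: measurableT_comp.
- by move=> x _; exact: F0.
- by rewrite lee_fin ltW.
Qed.

Lemma ge0_integral_lebesgueN (F : R -> \bar R) :
  measurable_fun setT F -> (forall x, 0 <= F x) ->
  \int[leb]_x F x = \int[leb]_x F (- x)%R.
Proof.
move=> mF F0.
pose phi (x : R) : measurableTypeR R := (- x)%R.
have mphi : measurable_fun setT phi by exact: oppr_measurable.
pose m' : {measure set (measurableTypeR R) -> \bar R} := image_measure leb mphi.
rewrite (eq_measure_integral m'); last first.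
  by move=> A mA _; exact/esym/lebesgue_measureN.
by rewrite ge0_integral_pushforward// preimage_setT.
Qed.

Lemma ge0_integral_lebesgue_reflect (m : R) (F : R -> \bar R) :
  measurable_fun setT F -> (forall x, 0 <= F x) ->
  \int[leb]_x F x = \int[leb]_x F (2 * m - x)%R.
Proof.
move=> mF F0; rewrite (ge0_integral_lebesgue_affine (2 * m) ltr01)//.
rewrite ge0_integral_lebesgueN//; last first.
- by move=> x; rewrite mule_ge0.
- apply: emeasurable_funM => //; apply: measurableT_comp => //.
  by apply: measurable_funD => //; exact: measurable_funM.
by apply: eq_integral => x _; rewrite mul1e mul1r addrC.
Qed.

End lebesgue_affine.

Section density_convolution.
Context {R : realType}.
Local Open Scope ereal_scope.
Local Notation leb := (@lebesgue_measure R).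

(* Bayes' rule: [q y] is the conditional density of the first summand given
   that the sum is [y]. *)
Lemma ge0_integral_density_conv (F : R -> \bar R) (p1 p2 p : R -> R)
    (q : R -> R -> R) :
  measurable_fun setT F -> (forall x, 0 <= F x) ->
  measurable_fun setT p1 -> (forall x, 0 <= p1 x)%R ->
  measurable_fun setT p2 -> (forall x, 0 <= p2 x)%R ->
  (forall x, 0 <= p x)%R ->
  (forall y, measurable_fun setT (q y)) -> (forall y x, 0 <= q y x)%R ->
  (forall x y, p1 x * p2 (y - x) = p y * q y x)%R ->
  (forall y, \int[leb]_x (q y x)%:E = 1) ->
  \int[leb]_x ((\int[leb]_y (F (x + y)%R * (p2 y)%:E)) * (p1 x)%:E) =
  \int[leb]_y (F y * (p y)%:E).
Proof.
move=> mF F0 mp1 p10 mp2 p20 p0 mq q0 pq q1.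
have mp1' : measurable_fun setT (fun x => (p1 x)%:E) by exact/measurable_EFinP.
have mp2' : measurable_fun setT (fun x => (p2 x)%:E) by exact/measurable_EFinP.
transitivity (\int[leb]_x \int[leb]_y
    (F y * (p2 (y - x))%:E * (p1 x)%:E)).
  apply: eq_integral => x _; rewrite -ge0_integralZr//; last 3 first.
  - apply: emeasurable_funM => //; apply: measurableT_comp => //.
    exact: measurable_funD.
  - by move=> y _; rewrite mule_ge0// lee_fin.
  - by rewrite lee_fin.
  have mf : measurable_fun setT (fun y => F y * (p2 (y - x))%:E * (p1 x)%:E).
    apply: emeasurable_funM => //; apply: emeasurable_funM => //.
    by apply: (measurableT_comp mp2'); exact: measurable_funD.
  rewrite [RHS](ge0_integral_lebesgue_affine x ltr01)//; last first.
    by move=> y; rewrite !mule_ge0 ?lee_fin.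
  by apply: eq_integral => y _; rewrite mul1e mul1r addrK [(y + x)%R]addrC.
pose f (xy : R * R) := F xy.2 * (p2 (xy.2 - xy.1))%:E * (p1 xy.1)%:E.
have mf : measurable_fun setT f.
  apply: emeasurable_funM; last exact: (measurableT_comp mp1').
  apply: emeasurable_funM; first exact: measurableT_comp.
  by apply: (measurableT_comp mp2'); exact: measurable_funB.
have f0 x : 0 <= f x by rewrite /f !mule_ge0 ?lee_fin.
rewrite (fubini_tonelli (m1 := leb) (m2 := leb) f)//.
apply: eq_integral => y _.
transitivity (\int[leb]_x (F y * (p y)%:E * (q y x)%:E)).
  apply: eq_integral => x _; rewrite /f/= -!muleA -!EFinM.
  by rewrite [(p2 _ * _)%R]mulrC pq.
rewrite ge0_integralZl//; first by rewrite q1 mule1.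
- by apply/measurable_EFinP; exact: mq.
- by move=> x _; rewrite lee_fin.
- by rewrite mule_ge0 ?lee_fin.
Qed.

End density_convolution.

Section normal_integral.
Context {R : realType}.
Local Open Scope ereal_scope.
Local Notation leb := (@lebesgue_measure R).
Implicit Types (F : R -> \bar R) (m s t r : R).

(** Integration against [normal_law m s], in the form of a functional: evaluation at [m] in the
    degenerate case. *)
Definition normal_int m s F : \bar R :=
  if s == 0%R then F m else \int[leb]_x (F x * (normal_pdf m s x)%:E).

Let mpdf m s : measurable_fun setT (fun x => (normal_pdf m s x)%:E).
Proof. by apply/measurable_EFinP; exact: measurable_normal_pdf. Qed.

Let pdf0 m s x : 0 <= (normal_pdf m s x)%:E.
Proof. by rewrite lee_fin normal_pdf_ge0. Qed.

Lemma eq_normal_int m s F G : F =1 G -> normal_int m s F = normal_int m s G.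
Proof. by move=> /funext ->. Qed.

(** Variances determine deviations only up to sign, and no sign is ever fixed for [s]. *)
Lemma normal_int_sqr m s t F : (s ^+ 2 = t ^+ 2)%R -> normal_int m s F = normal_int m t F.
Proof.
move=> st; have st0 : (s == 0)%R = (t == 0)%R by rewrite -(@sqrf_eq0 _ s) st sqrf_eq0.
rewrite /normal_int; have [t0|t0] := boolP (t == 0%R).
  by rewrite st0 t0.
have s0 : s != 0%R by rewrite st0.
rewrite (negbTE s0).
apply: eq_integral => x _; congr (_ * _%:E).
rewrite (normal_pdfE _ s0) (normal_pdfE _ t0).
by rewrite /normal_peak /normal_fun st.
Qed.

Lemma normal_int_reflect m s F :
  measurable_fun setT F -> (forall x, 0 <= F x) ->
  normal_int m s F = normal_int m s (fun x => F (2 * m - x)%R).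
Proof.
move=> mF F0; rewrite /normal_int; case: ifPn => s0.
  by congr F; ring.
have mp := emeasurable_funM mF (mpdf m s).
rewrite (ge0_integral_lebesgue_reflect m mp); last first.
  by move=> x; rewrite mule_ge0.
apply: eq_integral => x _; congr (_ * _%:E).
rewrite !(normal_pdfE _ s0) /normal_fun.
have -> : (2 * m - x - m = - (x - m))%R by ring.
by rewrite sqrrN.
Qed.

Lemma normal_int_conv s t r F :
  measurable_fun setT F -> (forall x, 0 <= F x) -> (r ^+ 2 = s ^+ 2 + t ^+ 2)%R ->
  normal_int 0 s (fun x => normal_int 0 t (fun y => F (x + y)%R)) = normal_int 0 r F.
Proof.
move=> mF F0 rst.
have [s0|s0] := eqVneq s 0%R.
  rewrite {1}/normal_int s0 eqxx.
  rewrite (@eq_normal_int _ _ _ F); last by move=> y; rewrite add0r.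
  by apply: normal_int_sqr; rewrite rst s0 expr0n add0r.
have [t0|t0] := eqVneq t 0%R.
  rewrite (@eq_normal_int _ _ _ F).
    by apply: normal_int_sqr; rewrite rst t0 expr0n addr0.
  by move=> x; rewrite /normal_int t0 eqxx addr0.
have s2 : (0 < s ^+ 2)%R by rewrite exprn_even_gt0.
have t2 : (0 < t ^+ 2)%R by rewrite exprn_even_gt0.
have r0 : r != 0%R by rewrite -sqrf_eq0 rst gt_eqF// addr_gt0.
rewrite /normal_int (negbTE s0) (negbTE t0) (negbTE r0).
(* Given that the sum is [y], the first summand is normal with mean [s^2 y / r^2] and deviation
   [s t / r]; the identity of densities below amounts to completing the square. *)
pose q := (s * t / r)%R.
have q0 : q != 0%R by rewrite /q !mulf_neq0 ?invr_eq0.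
apply: (@ge0_integral_density_conv _ F _ _ _
  (fun y => normal_pdf (s ^+ 2 * y / r ^+ 2) q) mF F0).
- exact: measurable_normal_pdf.
- exact: normal_pdf_ge0.
- exact: measurable_normal_pdf.
- exact: normal_pdf_ge0.
- exact: normal_pdf_ge0.
- by move=> y; exact: measurable_normal_pdf.
- by move=> y; exact: normal_pdf_ge0.
- move=> x y; rewrite (normal_pdfE _ s0) (normal_pdfE _ t0) (normal_pdfE _ r0) (normal_pdfE _ q0).
  rewrite mulrACA [RHS]mulrACA.
  have -> : (normal_peak s * normal_peak t = normal_peak r * normal_peak q)%R.
    rewrite /normal_peak -!invfM; congr (_^-1)%R.
    have pk (z : R) : (0 <= z ^+ 2 * pi *+ 2)%R.
      by rewrite mulrn_wge0// mulr_ge0 ?sqr_ge0 ?pi_ge0.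
    rewrite -(sqrtrM _ (pk s)) -(sqrtrM _ (pk r)).
    have E (w : R) : (s ^+ 2 * w * (t ^+ 2 * w) = r ^+ 2 * w * (q ^+ 2 * w))%R.
      by rewrite /q; field.
    by rewrite -!mulrnAr E.
  rewrite /normal_fun -!expRD; congr (_ * expR _)%R.
  have st0 : (s ^+ 2 + t ^+ 2 != 0)%R by rewrite -rst sqrf_eq0.
  rewrite !subr0 /q !exprMn exprVn rst.
  by field; rewrite s0 t0 st0.
- by move=> y; exact: integral_normal_pdf.
Qed.

(** The second moment of the standard law stays an unevaluated constant: this scaling and its
    positivity are enough to read [s^2] off the covariance operator, up to a common factor. *)
Lemma normal_int_moment2 s :
  normal_int 0 s (fun x => (x ^+ 2)%:E) =
  (s ^+ 2)%:E * normal_int 0 1 (fun x => (x ^+ 2)%:E).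
Proof.
have [s0|s0] := eqVneq s 0%R.
  by rewrite {1}/normal_int s0 eqxx expr0n mul0e.
have sn : (0 < `|s|)%R by rewrite normr_gt0.
rewrite (@normal_int_sqr _ _ `|s|%R); last by rewrite real_normK// num_real.
have n1 : (1 != 0 :> R)%R by rewrite oner_eq0.
have ns : `|s|%R != 0%R by rewrite gt_eqF.
rewrite /normal_int (negbTE n1) (negbTE ns).
have mx : measurable_fun setT (fun x : R => (x ^+ 2)%:E).
  by apply/measurable_EFinP; exact: exprn_measurable.
have mp t := emeasurable_funM mx (mpdf 0 t).
have p0 t (x : R) : 0 <= (x ^+ 2)%:E * (normal_pdf 0 t x)%:E.
  by rewrite mule_ge0// lee_fin sqr_ge0.
rewrite (ge0_integral_lebesgue_affine 0 sn (mp _) (p0 _)).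
rewrite -(ge0_integralZl leb measurableT (mp _)); last 2 first.
- by move=> x _; exact: p0.
- by rewrite lee_fin sqr_ge0.
apply: eq_integral => x _; rewrite addr0 -!EFinM; congr EFin.
rewrite (normal_pdfE _ n1) (normal_pdfE _ ns) /normal_peak /normal_fun.
rewrite expr1n mul1r -mulrnAr sqrtrM ?sqr_ge0// sqrtr_sqr normr_id invfM.
rewrite !subr0 real_normK ?num_real//.
have -> : (- (`|s| * x) ^+ 2 / (s ^+ 2 *+ 2) = - x ^+ 2 / (1 *+ 2))%R.
  by rewrite exprMn real_normK ?num_real//; field.
rewrite exprMn real_normK ?num_real//; field; rewrite ns gt_eqF// sqrtr_gt0 pmulrn_lgt0// pi_gt0//.
Qed.

Lemma normal_int_moment2_gt0 : 0 < normal_int 0 1 (fun x => (x ^+ 2)%:E).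
Proof.
have n1 : (1 != 0 :> R)%R by rewrite oner_eq0.
rewrite /normal_int (negbTE n1).
have mx : measurable_fun setT (fun x : R => (x ^+ 2)%:E).
  by apply/measurable_EFinP; exact: exprn_measurable.
have mp := emeasurable_funM mx (mpdf 0 1).
have p0 (x : R) : 0 <= (x ^+ 2)%:E * (normal_pdf 0 1 x)%:E.
  by rewrite mule_ge0// lee_fin sqr_ge0.
(* The value of the standard density at 2: a lower bound for the integrand on [[1, 2]], where [x^2]
   is at least 1. *)
pose c : R := (normal_peak 1 * expR (- 4 / (1 ^+ 2 *+ 2)))%R.
have c0 : (0 < c)%R by rewrite mulr_gt0 ?expR_gt0 ?normal_peak_gt0.
have m12 : measurable (`[1%R, 2%R]%classic : set R) by [].
apply: (@lt_le_trans _ _ (\int[leb]_(x in `[1%R, 2%R]) c%:E)).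
  rewrite integral_cst//= lebesgue_measure_itv/= lte_fin ltr1n -EFinB -EFinM lte_fin.
  by rewrite mulr_gt0//; lra.
apply: (@le_trans _ _ (\int[leb]_(x in `[1%R, 2%R]) ((x ^+ 2)%:E * (normal_pdf 0 1 x)%:E))).
  apply: ge0_le_integral => //.
  - by move=> *; rewrite lee_fin ltW.
  - exact: measurable_funTS.
  - move=> x /=; rewrite in_itv/= => /andP[x1 x2].
    rewrite -EFinM lee_fin (normal_pdfE _ n1).
    have -> : c = (1 * c)%R by rewrite mul1r.
    apply: ler_pM => //; [exact: ltW|by rewrite exprn_ege1|].
    rewrite /c ler_wpM2l ?normal_peak_ge0// /normal_fun ler_expR subr0.
    rewrite ler_wpM2r//; nra.
exact: ge0_subset_integral.
Qed.

End normal_integral.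

(** * Rotation invariance of Gaussian measures *)

Section hilbert_geometry.
Context (R : realType) (H : completeNormedModType R).
Variable dot : {dot H for idfun}.

Lemma dotDl x y z : dot (x + y) z = dot x z + dot y z.
Proof. exact: linearDl. Qed.

Lemma dotDr x y z : dot x (y + z) = dot x y + dot x z.
Proof. by rewrite linearDr. Qed.

Lemma dotZl a x y : dot (a *: x) y = a * dot x y.
Proof. by rewrite linearZl_LR. Qed.

Lemma dot0l x : dot 0 x = 0.
Proof. by rewrite -(scale0r (0 : H)) dotZl mul0r. Qed.

Lemma dotZr a x y : dot x (a *: y) = a * dot x y.
Proof. by rewrite linearZr. Qed.

Lemma dotC x y : dot x y = dot y x.
Proof. by rewrite hermC expr0 mul1r. Qed.

Hypothesis hdot : norm_from_dot dot.

Lemma dot_cauchy_schwarz x y : `|dot x y| <= `|x| * `|y|.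
Proof.
have [->|y0] := eqVneq y 0.
  by rewrite -(scale0r (0 : H)) dotZr mul0r normr0 mulr_ge0.
have ny : 0 < `|y| by rewrite normr_gt0.
rewrite -(@ler_pXn2r _ 2%N)// ?nnegrE ?mulr_ge0// real_normK ?num_real// exprMn.
(* This vector is [|y|^2] times the component of [x] orthogonal to [y]. *)
have := sqr_ge0 (`|(`|y| ^+ 2) *: x - dot x y *: y|).
rewrite hdot -!scaleNr !(dotDl, dotDr, dotZl, dotZr) -!hdot [dot y x]dotC.
set a := `|x|; set b := `|y|; set c := dot x y => h.
have {}h : 0 <= b ^+ 2 * (a ^+ 2 * b ^+ 2 - c ^+ 2).
  by move: h; rewrite /b; congr (_ <= _); ring.
by rewrite -subr_ge0; rewrite pmulr_rge0 ?exprn_gt0 in h.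
Qed.

Lemma dotBr x y z : dot x (y - z) = dot x y - dot x z.
Proof. by rewrite -scaleN1r dotDr dotZr mulN1r. Qed.

(** Testing against [h = w] would give [|w|^2 <= r |w|]. A point [h] of [D] within [e'] of [w] gives
    the same up to [e' (r + |w|)], and [e'] is chosen to make this [e |w|]. *)
Lemma norm_le_dense (D : set H) (w : H) (r : R) : 0 <= r -> dense D ->
  (forall h, D h -> dot h w <= r * `|h|) -> `|w| <= r.
Proof.
move=> r0 dD Dw; apply/ler_addgt0Pr => e e0.
have [->|w0] := eqVneq w 0; first by rewrite normr0 addr_ge0// ltW.
have nw : 0 < `|w| by rewrite normr_gt0.
pose e' := e * `|w| / (r + `|w|).
have rw : 0 < r + `|w| by rewrite ltr_wpDl.
have e'0 : 0 < e' by rewrite divr_gt0// mulr_gt0.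
have [h []] := dD (ball w e') (ex_intro _ w (ballxx w e'0)) (ball_open w e').
rewrite -ball_normE /= => hw /Dw {}Dw.
have nh : `|h| <= `|w| + e'.
  by rewrite -lerBlDl (le_trans (lerB_dist _ _))// distrC ltW.
have wh : dot w w - dot h w <= e' * `|w|.
  have -> : dot w w - dot h w = dot (w - h) w.
    by rewrite [dot (w - h) w]dotC dotBr [dot w h]dotC.
  rewrite (le_trans (ler_norm _))// (le_trans (dot_cauchy_schwarz _ _))//.
  by rewrite ler_wpM2r// ltW.
have : `|w| ^+ 2 <= r * (`|w| + e') + e' * `|w|.
  rewrite hdot -lerBlDr (le_trans _ (le_trans Dw _))//; first by lra.
  by rewrite ler_wpM2l.
have e'E : e' * (r + `|w|) = e * `|w| by rewrite /e' divfK// gt_eqF.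
rewrite expr2 => h1; rewrite -(ler_pM2r nw); lra.
Qed.

Lemma continuous_measurable_borel (f : H -> R) : continuous f ->
  measurable_fun setT (f : borel H -> R).
Proof.
move=> cf; apply: (measurability _ (RGenOpens.measurableE R)).
move=> _ [_ [x [y ->]] <-]; rewrite setTI; apply: sub_sigma_algebra.
by apply: open_comp => //; exact: interval_open.
Qed.

Lemma measurable_norm_borel :
  measurable_fun setT (fun x : borel H => `|(x : H)|).
Proof. exact: continuous_measurable_borel (@norm_continuous _ _). Qed.

Lemma dot_continuous h : continuous (dot h).
Proof.
move=> x; apply/cvgrPdist_lt => e e0; near=> y.
rewrite -dotBr (le_lt_trans (dot_cauchy_schwarz _ _))//.
have h1 : 0 < `|h| + 1 by rewrite ltr_wpDl.
rewrite (@le_lt_trans _ _ ((`|h| + 1) * `|x - y|))//.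
  by rewrite ler_wpM2r// lerDl.
rewrite mulrC -ltr_pdivlMr//.
near: y; apply: (@cvgr_dist_lt _ _ _ _ _ id x cvg_id).
by rewrite divr_gt0.
Unshelve. all: by end_near. Qed.

Lemma measurable_dot h : measurable_fun setT (dot h : borel H -> R).
Proof. apply: (@continuous_measurable_borel (dot h)); exact: dot_continuous. Qed.

Hypothesis hsep : separable H.

Lemma dense_sequence : exists e : nat -> H, dense (range e).
Proof.
have [D /pfcard_geP[D0|/surjfunPex[e De]] dD] := hsep; last by exists e; rewrite -De.
have [x [_]] := dD setT (ex_intro _ 0 I) openT.
by rewrite D0.
Qed.

(** Weak measurability implies Borel measurability in a separable space. A closed ball is a
    countable intersection of half-spaces whose normals run through a dense sequence, and an open
    set [U] is the union of the closed balls contained in it that have a center in the sequence and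
    a radius [1 / (j + 1)]; [B i j] is the preimage of such a ball. *)
Lemma measurable_dot_borel d (T : measurableType d) (F : T -> H) :
  (forall h, measurable_fun setT (fun x => dot h (F x))) ->
  measurable_fun setT (F : T -> borel H).
Proof.
move=> mF; have [e de] := dense_sequence.
have mball c r : measurable [set x | `|F x - c| <= r].
  have [r0|r0] := ltP r 0.
    rewrite (_ : [set x | _] = set0)//; apply/seteqP; split=> x //=.
    by move=> /(le_lt_trans) /(_ r0); rewrite normr_lt0.
  rewrite (_ : [set x | _] = \bigcap_n [set x | dot (e n) (F x) <= dot (e n) c + r * `|e n|]).
    apply: bigcapT_measurable => n; rewrite -[X in measurable X]setTI.
    exact: (measurable_fun_ler (mF _) (measurable_cst _)).
  apply/seteqP; split=> x /= Fx.
    move=> n _ /=; rewrite -lerBlDl -dotBr (le_trans (ler_norm _))//.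
    by rewrite (le_trans (dot_cauchy_schwarz _ _))// mulrC ler_wpM2r.
  apply: (norm_le_dense r0 de) => _ [n _ <-].
  by rewrite dotBr lerBlDl; exact: Fx.
apply: (@measurability _ _ _ (borel H) _ _ (@open H)) => //.
move=> _ [U oU <-]; rewrite setTI.
pose B i j := if `[< forall y, `|y - e i| <= j.+1%:R^-1 -> U y >]
  then [set x | `|F x - e i| <= j.+1%:R^-1] else set0.
rewrite (_ : _ @^-1` _ = \bigcup_i \bigcup_j B i j).
  by do 2 apply: bigcupT_measurable => ?; rewrite /B; case: ifP.
apply/seteqP; split=> x /=; last first.
  by move=> [i _ [j _]]; rewrite /B; case: asboolP => // H' /H'.
move=> Ux; move: oU; rewrite openE => /(_ _ Ux) /nbhs_ballP[r /= r0 rU].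
have [j jr] : exists j : nat, j.+1%:R^-1 < r / 2.
  exists (Num.truncn (r / 2)^-1).
  by rewrite invf_plt ?posrE ?divr_gt0// truncnS_gt.
have j0 : 0 < j.+1%:R^-1 :> R by rewrite invr_gt0.
have [z [+ [i _ zi]]] := de (ball (F x) j.+1%:R^-1) (ex_intro _ (F x) (ballxx _ j0)) (ball_open _ _).
rewrite -zi -ball_normE/= => xi; exists i => //; exists j => //.
rewrite /B; case: asboolP => /= [_|]; first exact: ltW.
move=> nU; apply: nU => y yi; apply: rU; rewrite -ball_normE/=.
rewrite -(subrK (e i) (F x)) -addrA (le_lt_trans (ler_normD _ _))//.
rewrite [ltRHS]splitr ltr_leD//; first exact: lt_trans jr.
by rewrite distrC (le_trans yi)// ltW.
Qed.

(** Scalar functionals are used rather than the continuity of addition, because [H * H] carries the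
    product sigma-algebra and not, by definition, the Borel sets of the product. *)
Lemma measurable_affine2 d (T : measurableType d) (F G : T -> borel H) a b :
  measurable_fun setT F -> measurable_fun setT G ->
  measurable_fun setT (fun x => a *: (F x : H) + b *: (G x : H) : borel H).
Proof.
move=> mF mG; apply: measurable_dot_borel => h.
under eq_fun do rewrite dotDr !dotZr.
by apply: measurable_funD; apply: measurable_funM => //;
  exact: (measurableT_comp (measurable_dot h)).
Qed.

End hilbert_geometry.

Section gaussian_rotation.
Context (R : realType) (H : completeNormedModType R).
Variable dot : {dot H for idfun}.
Hypotheses (hdot : norm_from_dot dot) (hsep : separable H).
Variable gamma : probability (borel H) R.
Variable C : {linear H -> H}.
Hypotheses (hgauss : gaussian_measure dot gamma) (hmean : centered dot gamma).
Hypothesis hcov : covariance_operator dot gamma C.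

Local Notation mdot := (measurable_dot hdot).

Section one_dimensional.
Local Open Scope ereal_scope.
Variable h : H.

Let normal_int_law (m s : R) :
  (forall A : set R, measurable A ->
    pushforward gamma (dot h : borel H -> R) A = normal_law m s A) ->
  forall F : R -> \bar R, measurable_fun setT F -> (forall x, 0 <= F x) ->
  \int[gamma]_x F (dot h x) = normal_int m s F.
Proof.
move=> law F mF F0.
pose X : borel H -> measurableTypeR R := dot h.
have mX : measurable_fun setT X by exact: mdot.
have <- : \int[image_measure gamma mX]_y F y = \int[gamma]_x F (dot h x).
  by rewrite ge0_integral_pushforward.
rewrite /normal_int; move: law; rewrite /normal_law.
have [s0|s0] := eqVneq s 0%R; move=> law.
  rewrite (@eq_measure_integral _ _ _ _ (dirac (m : measurableTypeR R))).
    by rewrite integral_dirac// diracT mul1e.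
  by move=> A mA _; exact: law.
rewrite [LHS](@eq_measure_integral _ _ _ _ (normal_prob m s)); last first.
  by move=> A mA _; exact: law.
apply: ge0_integral_density => //.
- exact: measurable_normal_pdf.
- by move=> x; exact: normal_pdf_ge0.
Qed.

Let moment2 : \int[gamma]_x ((dot h x) ^+ 2)%:E = (dot (C h) h)%:E.
Proof.
have [_ /(_ h h)] := hcov; rewrite unlock hmean /= => <-.
rewrite unlock; apply: eq_integral => x _; congr EFin.
by rewrite expr2; congr (_ * _)%R; rewrite /= subr0.
Qed.

Let integrable_dot : gamma.-integrable setT (EFin \o (dot h : borel H -> R)).
Proof.
have i1 : gamma.-integrable setT (fun x => (1 + (dot h x) ^+ 2)%:E).
  apply/integrableP; split.
    apply/measurable_EFinP; apply: measurable_funD => //.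
    by apply: measurable_funX; exact: mdot.
  under eq_integral do rewrite gee0_abs ?lee_fin ?addr_ge0 ?sqr_ge0// EFinD.
  rewrite ge0_integralD//; last 2 first.
  - by move=> x _; rewrite lee_fin sqr_ge0.
  - by apply/measurable_EFinP; apply: measurable_funX; exact: mdot.
  by rewrite moment2 integral_cst//= probability_setT mule1 -EFinD ltry.
apply: le_integrable i1 => //; first by apply/measurable_EFinP; exact: mdot.
move=> x _; rewrite /= lee_fin [leRHS]ger0_norm ?addr_ge0 ?sqr_ge0//.
rewrite -(real_normK (num_real (dot h x))); set t := `|dot h x|%R.
have : (0 <= t)%R by exact: normr_ge0.
by have := sqr_ge0 (t - 1)%R; nra.
Qed.

(* [X - m] and [m - X] have the same law, so that [m] is the mean. *)
Let mean0 (m s : R) :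
  (forall A : set R, measurable A ->
    pushforward gamma (dot h : borel H -> R) A = normal_law m s A) -> m = 0%R.
Proof.
move=> /normal_int_law law.
have iX : gamma.-integrable setT (fun x => (dot h x - m)%:E).
  rewrite (_ : (fun x => _) = (EFin \o (dot h : borel H -> R)) \- cst m%:E) //.
  by apply: integrableB => //; exact: finite_measure_integrable_cst.
have e0 : \int[gamma]_x (dot h x - m)%:E = 0.
  rewrite integralE.
  have sym : \int[gamma]_x ((fun x => (dot h x - m)%:E)^\+ x) =
             \int[gamma]_x ((fun x => (dot h x - m)%:E)^\- x).
    pose F (y : R) := maxe (y - m)%:E 0.
    have mF : measurable_fun setT F.
      apply: measurable_maxe => //.
      by apply/measurable_EFinP; exact: measurable_funD.
    have F0 y : 0 <= F y by rewrite /F le_max lexx orbT.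
    transitivity (\int[gamma]_x F (dot h x)); first by apply: eq_integral => x _; rewrite funeposE.
    rewrite (law _ mF F0) (normal_int_reflect _ _ mF F0) -law; last 2 first.
    - by apply: (measurableT_comp mF); exact: measurable_funB.
    - by move=> x; exact: F0.
    apply: eq_integral => x _; rewrite /F funenegE -EFinN; congr (maxe _%:E _).
    ring.
  rewrite sym subee//; rewrite -sym; exact: integrable_pos_fin_num.
have : \int[gamma]_x (dot h x)%:E = 0.
  by have := hmean h; rewrite unlock.
move: e0; under eq_integral do rewrite EFinB.
rewrite integralB//=; last exact: finite_measure_integrable_cst.
move=> e0 e1; move: e0; rewrite [X in X - _](_ : _ = 0)// integral_cst//= probability_setT mule1 sub0e => /eqP.
by rewrite eqe_oppLR oppe0 => /eqP[].
Qed.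

Lemma gaussian_law1 : exists s : R,
  (forall F : R -> \bar R, measurable_fun setT F -> (forall x, 0 <= F x) ->
    \int[gamma]_x F (dot h x) = normal_int 0 s F) /\
  (dot (C h) h)%:E = (s ^+ 2)%:E * normal_int 0 1 (fun x => (x ^+ 2)%:E).
Proof.
have [m [s law]] := hgauss h; have m0 := mean0 law.
move: law; rewrite m0 => /normal_int_law law; exists s; split=> //.
rewrite -normal_int_moment2 -law; first by rewrite -moment2.
- by apply/measurable_EFinP; exact: exprn_measurable.
- by move=> x; rewrite lee_fin sqr_ge0.
Qed.
End one_dimensional.

Local Notation q h := (dot (C h) h).

(* The constant [c] is the variance of [normal_prob 0 1], unless all the
   functionals [dot h] vanish almost surely. *)
Lemma gaussian_law : exists2 c : R, 0 < c & forall h, exists s : R,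
  (forall F : R -> \bar R, measurable_fun setT F -> (forall x, 0 <= F x)%E ->
    \int[gamma]_x F (dot h x) = normal_int 0 s F)%E /\ q h = c * s ^+ 2.
Proof.
have := @normal_int_moment2_gt0 R.
case E : (normal_int 0 1 (fun x => (x ^+ 2)%:E)) => [c| |]// c0.
  exists c => // h; have [s [law]] := gaussian_law1 h.
  by rewrite E -EFinM => -[qs]; exists s; split=> //; rewrite qs mulrC.
exists 1 => // h; have [s [law]] := gaussian_law1 h.
have [s0|s0] := eqVneq s 0.
  move=> qs; exists s; split=> //; move: qs.
  by rewrite s0 expr0n/= mul0e mulr0 => -[].
by rewrite E mulry gtr0_sg ?exprn_even_gt0// mul1e.
Qed.

Lemma covarianceC_sym h k : dot (C h) k = dot (C k) h.
Proof.
have [_ cov] := hcov; have := cov h k; rewrite covarianceC cov => -[->//].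
Qed.

(** The cross terms cancel by the symmetry of the covariance: the quadratic form of the pair is
    invariant under orthogonal maps mixing the two copies. *)
Lemma covariance_rotation a b h k : a ^+ 2 + b ^+ 2 = 1 ->
  q (a *: h + b *: k) + q (b *: h - a *: k) = q h + q k.
Proof.
move=> ab; rewrite -scaleNr !linearD !linearZ/=.
rewrite !(dotDl, dotDr, dotZl, dotZr) [dot (C k) h]covarianceC_sym.
by rewrite -[RHS]mul1r -ab; ring.
Qed.

Let gg := (gamma \x gamma)%E.

(** For [a^2 + b^2 = 1] the matrix has determinant -1: this is a reflection, hence an involution.
    Detailed balance rests on that, since it exchanges the current state and the proposal. *)
Definition rotation (a b : R) (w : borel H * borel H) : borel H * borel H :=
  (a *: (w.1 : H) + b *: (w.2 : H), b *: (w.1 : H) - a *: (w.2 : H)).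

Lemma measurable_rotation a b : measurable_fun setT (rotation a b).
Proof.
apply: measurable_fun_pair; first exact: measurable_affine2.
rewrite /rotation; under eq_fun do rewrite -scaleNr.
exact: measurable_affine2.
Qed.

(** By Fubini and convolution of normal laws, the law of a functional of an independent pair depends
    on [h] and [k] only through the sum of their variances, which rotations preserve. *)
Lemma gaussian_law2 : exists2 c : R, 0 < c & forall h k (r : R),
  q h + q k = c * r ^+ 2 ->
  forall F : R -> \bar R, measurable_fun setT F -> (forall x, 0 <= F x)%E ->
    (\int[gg]_w F (dot h w.1 + dot k w.2)%R = normal_int 0 r F)%E.
Proof.
have [c c0 law] := gaussian_law; exists c => // h k r qr F mF F0.
have [s [hs qs]] := law h; have [t [kt qt]] := law k.
have mhk : measurable_fun setT (fun w : borel H * borel H => F (dot h w.1 + dot k w.2)).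
  apply: (measurableT_comp mF); apply: measurable_funD.
    exact: (measurableT_comp (mdot h)).
  exact: (measurableT_comp (mdot k)).
rewrite fubini_tonelli1// /fubini_F/=.
transitivity (\int[gamma]_x normal_int 0 t (fun y => F (dot h x + y)%R))%E.
  apply: eq_integral => x _; rewrite -kt//.
  by apply: (measurableT_comp mF); exact: measurable_funD.
rewrite (hs (fun x => normal_int 0 t (fun y => F (x + y)))).
- apply: normal_int_conv => //.
  by apply: (mulfI (lt0r_neq0 c0)); rewrite -qr qs qt; ring.
- rewrite /normal_int; have [t0|t0] := eqVneq t 0.
    by under eq_fun do rewrite addr0.
  pose f (w : R * R) := (F (w.1 + w.2)%R * (normal_pdf 0 t w.2)%:E)%E.
  have mf : measurable_fun setT f.
    apply: emeasurable_funM.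
      by apply: (measurableT_comp mF); exact: measurable_funD.
    apply/measurable_EFinP; apply: (measurableT_comp (measurable_normal_pdf 0 t)).
    exact: measurable_snd.
  apply: (measurable_fun_fubini_tonelli_F (m2 := lebesgue_measure) f mf).
  by move=> w; rewrite /f mule_ge0 ?lee_fin ?normal_pdf_ge0.
- move=> x; rewrite /normal_int; case: ifPn => // t0.
  by apply: integral_ge0 => y _; rewrite mule_ge0 ?lee_fin ?normal_pdf_ge0.
Qed.

Local Notation HH := (borel H * borel H)%type.
Local Notation gg := (product_prob gamma gamma).

(** The Gaussian laws are known through integrals of nonnegative functions, so that the cosine is
    raised by 1. *)
Lemma Rintegral_cosE d (T : measurableType d) (m : probability T R) (l : T -> R) :
  measurable_fun setT l ->
  \int[m]_x cos (l x) = fine (\int[m]_x (1 + cos (l x))%:E)%E - 1.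
Proof.
move=> ml; have bc := bounded_mfun_integrable m (bounded_mfun_cos ml).
have b1 := bounded_mfun_integrable m (@bounded_mfun_cst _ T R 1).
have -> : fine (\int[m]_x (1 + cos (l x))%:E)%E = \int[m]_x (cst 1 x + cos (l x)) by [].
by rewrite RintegralD// Rintegral_cst//= probability_setT mulr1 addrAC subrr add0r.
Qed.

(** The constant [b] provides the phase shifts and the arbitrary thresholds of half-spaces. *)
Definition affine_functional : set (HH -> R) :=
  [set l | exists h k b, l = (fun w => dot h w.1 + dot k w.2 + b)].

Lemma measurable_pair_dot h k :
  measurable_fun setT (fun w : HH => dot h w.1 + dot k w.2).
Proof.
by apply: measurable_funD; [apply: (measurableT_comp (measurable_dot hdot h))|
  apply: (measurableT_comp (measurable_dot hdot k))].
Qed.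

Lemma measurable_affine_functional l :
  affine_functional l -> measurable_fun setT l.
Proof.
by move=> [h [k [b ->]]]; apply: measurable_funD => //; exact: measurable_pair_dot.
Qed.

(** The identity is measurable from the sigma-algebra of half-spaces to the product one, because
    both of its components are weakly measurable. *)
Lemma affine_functional_sigma (A : set HH) : measurable A ->
  <<s [set [set w | l w <= 0] | l in affine_functional]>> A.
Proof.
move=> mA; pose G := [set [set w | l w <= 0] | l in affine_functional].
have mdotG h k : measurable_fun setT
    ((fun w => dot h w.1 + dot k w.2) : g_sigma_algebraType G -> R).
  apply: (measurability _ (RGenOInfty.measurableE R)).
  move=> _ [_ [x ->] <-]; rewrite setTI.
  rewrite (_ : _ @^-1` _ = ~` [set w | dot h w.1 + dot k w.2 + (- x) <= 0]).
    apply: measurableC; apply: sub_sigma_algebra.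
    by exists (fun w => dot h w.1 + dot k w.2 + (- x)) => //; exists h, k, (- x).
  apply/seteqP; split=> w /=; rewrite in_itv/= andbT.
    by move=> xw; apply/negP; rewrite -ltNge subr_gt0.
  by move/negP; rewrite -ltNge subr_gt0.
have mid : measurable_fun setT ((fun w => (w.1, w.2)) : g_sigma_algebraType G -> HH).
  apply: (@measurable_fun_pair _ _ _ (g_sigma_algebraType G)).
    apply: (measurable_dot_borel hdot hsep) => h.
    have := mdotG h 0; under eq_fun do rewrite dot0l addr0.
    by [].
  apply: (measurable_dot_borel hdot hsep) => h.
  have := mdotG 0 h; under eq_fun do rewrite dot0l add0r.
  by [].
have := mid measurableT _ mA; rewrite setTI.
by rewrite (_ : _ @^-1` _ = A)//; apply/seteqP; split=> -[].
Qed.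

Variables a b : R.
Hypothesis ab : a ^+ 2 + b ^+ 2 = 1.

Lemma rotation_invariant (A : set HH) : measurable A ->
  gg (rotation a b @^-1` A) = gg A.
Proof.
move=> mA.
have mrot := measurable_rotation a b.
(* [nu] is the image of the product measure under the rotation, kept abstract behind these two
   properties. *)
have [nu [nuE nuI]] : exists nu : probability HH R,
    nu A = gg (rotation a b @^-1` A) /\
    forall F : HH -> \bar R, measurable_fun setT F -> (forall w, 0 <= F w)%E ->
      (\int[nu]_w F w = \int[gg]_w F (rotation a b w))%E.
  pose rotm : {mfun HH >-> HH} :=
    HB.pack (rotation a b) (isMeasurableFun.Build _ _ _ _ _ mrot).
  exists (distribution gg rotm); split; first by rewrite /distribution /pushforward.
  move=> F mF F0.
  exact: (ge0_integral_distribution rotm mF F0).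
rewrite -nuE.
apply: (@cosine_uniqueness _ _ _ nu gg affine_functional
  measurable_affine_functional); last exact: affine_functional_sigma.
- by move=> c; exists 0, 0, c; apply/funext => w;
    rewrite /cst !dot0l !add0r.
- move=> r _ _ [h [k [c ->]]] [h' [k' [c' ->]]].
  exists (r *: h + h'), (r *: k + k'), (r * c + c'); apply/funext => w.
  by rewrite !dotDl !dotZl; ring.
- move=> _ [h [k [c ->]]].
  have ml : measurable_fun setT (fun w : HH => dot h w.1 + dot k w.2 + c).
    by apply: measurable_affine_functional; exists h, k, c.
  rewrite [LHS](Rintegral_cosE nu ml) [RHS](Rintegral_cosE gg ml); congr (fine _ - 1).
  pose F (y : R) : \bar R := (1 + cos (y + c))%:E.
  have mF : measurable_fun setT F.
    apply/measurable_EFinP; apply: measurable_funD => //.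
    apply: measurableT_comp; last exact: measurable_funD.
    by apply: continuous_measurable_fun; exact: continuous_cos.
  have F0 y : (0 <= F y)%E by rewrite lee_fin -lerBlDl sub0r cos_geN1.
  have mFl : measurable_fun setT (fun w : HH => F (dot h w.1 + dot k w.2)).
    by apply: (measurableT_comp mF); exact: measurable_pair_dot.
  have -> : (\int[nu]_w (1 + cos (dot h w.1 + dot k w.2 + c))%:E =
      \int[gg]_w F (dot h (rotation a b w).1 + dot k (rotation a b w).2)%R)%E.
    exact: (nuI (fun w => F (dot h w.1 + dot k w.2)) mFl).
  have [e e0 law] := gaussian_law2.
  have [s qs] : exists s, dot (C h) h + dot (C k) k = e * s ^+ 2.
    have pos x : 0 <= dot (C x) x.
      have [e' e'0 /(_ x)[t [_ ->]]] := gaussian_law.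
      by rewrite mulr_ge0 ?sqr_ge0// ltW.
    exists (Num.sqrt ((dot (C h) h + dot (C k) k) / e)).
    rewrite sqr_sqrtr ?divr_ge0 ?addr_ge0 ?pos//; last exact: ltW.
    by rewrite mulrC divfK// gt_eqF.
  transitivity (normal_int 0 s F).
    rewrite -(law (a *: h + b *: k) (b *: h - a *: k) s) //; last by rewrite covariance_rotation.
    apply: eq_integral => w _; rewrite /F /= /rotation/=; congr (1 + cos (_ + c))%:E.
    rewrite -!scaleNr !(dotDl, dotDr, dotZl, dotZr); ring.
  exact/esym/(law h k s qs F mF F0).
Qed.

End gaussian_rotation.

(** * Spectral gap of Gaussian proposals *)

Section rotation_consequences.
Context (R : realType) (H : completeNormedModType R).
Variable dot : {dot H for idfun}.
Hypotheses (hdot : norm_from_dot dot) (hsep : separable H).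
Variable gamma : probability (borel H) R.
Local Notation HH := (borel H * borel H)%type.
Local Notation gg := (product_prob gamma gamma).
Hypothesis grot : forall (a b : R) (A : set HH), a ^+ 2 + b ^+ 2 = 1 ->
  measurable A -> gg (rotation a b @^-1` A) = gg A.

Local Notation maff := (measurable_affine2 hdot hsep).

Local Open Scope ereal_scope.

Lemma ge0_integral_rotation (a b : R) (F : HH -> \bar R) : (a ^+ 2 + b ^+ 2 = 1)%R ->
  measurable_fun setT F -> (forall w, 0 <= F w) ->
  \int[gamma]_x \int[gamma]_z F (x, z) =
  \int[gamma]_x \int[gamma]_z F (rotation a b (x, z)).
Proof.
move=> ab mF F0.
have mrot := measurable_rotation hdot hsep a b.
rewrite -(fubini_tonelli1 (m1 := gamma) (m2 := gamma) F)//.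
have -> : \int[gg]_z F z = \int[image_measure gg mrot]_z F z.
  by apply: eq_measure_integral => A mA _; exact/esym/grot.
rewrite ge0_integral_pushforward// preimage_setT fubini_tonelli1//.
  exact: measurableT_comp.
by move=> w; exact: F0.
Qed.

Lemma integral_cst_prob (c : \bar R) : \int[gamma]_z c = c.
Proof. by rewrite integral_cst//= probability_setT mule1. Qed.

(** The rotation with coefficients [a / s] and [b / s] has first component [(a x + b z) / s], so
    that its invariance is applied to [F (s x)]. *)
Lemma ge0_integral_stable (a b s : R) (F : borel H -> \bar R) :
  (a ^+ 2 + b ^+ 2 = s ^+ 2)%R ->
  measurable_fun setT F -> (forall x, 0 <= F x) ->
  \int[gamma]_x \int[gamma]_z F (a *: (x : H) + b *: (z : H))%R =
  \int[gamma]_x F (s *: (x : H))%R.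
Proof.
move=> abs mF F0.
have [s0|s0] := eqVneq s 0%R.
  have /andP[/eqP a0 /eqP b0] : (a == 0)%R && (b == 0)%R.
    by rewrite -(@sqrf_eq0 _ a) -(@sqrf_eq0 _ b) -paddr_eq0 ?sqr_ge0// abs s0 expr0n.
  apply: eq_integral => x _; rewrite -[RHS](integral_cst_prob _).
  by apply: eq_integral => z _; rewrite a0 b0 s0 !scale0r addr0.
have ab1 : ((a / s) ^+ 2 + (b / s) ^+ 2 = 1)%R.
  by rewrite !expr_div_n -mulrDl abs divff// sqrf_eq0.
have ms : measurable_fun setT (fun x : borel H => s *: (x : H) : borel H).
  have := maff s 0 (@measurable_id _ (borel H) setT) (@measurable_id _ (borel H) setT).
  by under eq_fun do rewrite scale0r addr0.
rewrite [RHS](_ : _ = \int[gamma]_x \int[gamma]_z F (s *: ((x, z).1 : H))%R); last first.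
  by apply: eq_integral => x _; rewrite /= integral_cst_prob.
pose F' (w : HH) := F (s *: (w.1 : H))%R.
have mF' : measurable_fun setT F'.
  by apply: (measurableT_comp mF); apply: (measurableT_comp ms).
rewrite [RHS](ge0_integral_rotation ab1 mF' (fun w => F0 _)).
apply: eq_integral => x _; apply: eq_integral => z _.
by rewrite /F' /rotation/= scalerDr !scalerA ![(s * _)%R]mulrC !divfK.
Qed.

Section spectral_gap.
Variable h : borel H -> R.
Hypothesis mh : measurable_fun setT h.

Local Notation ggg := (product_prob gg gamma).
Local Notation HHH := (HH * borel H)%type.

Definition sqdist (x y : borel H) : \bar R := ((h x - h y) ^+ 2)%:E.

Lemma sqdist_ge0 x y : 0 <= sqdist x y.
Proof. by rewrite lee_fin sqr_ge0. Qed.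

Lemma sqdistC x y : sqdist x y = sqdist y x.
Proof. by rewrite /sqdist -sqrrN opprB. Qed.

Lemma sqdist_triangle x y z : sqdist x z <= 2%:E * (sqdist x y + sqdist y z).
Proof.
rewrite /sqdist -EFinD -EFinM lee_fin.
set a := h x; set b := h y; set c := h z.
by rewrite -subr_ge0 (_ : _ - _ = (a - b - (b - c)) ^+ 2)%R ?sqr_ge0//; ring.
Qed.

Lemma measurable_sqdist d (T : measurableType d) (F G : T -> borel H) :
  measurable_fun setT F -> measurable_fun setT G ->
  measurable_fun setT (fun x => sqdist (F x) (G x)).
Proof.
move=> mF mG; apply/measurable_EFinP; apply: measurable_funX.
by apply: measurable_funB; exact: (measurableT_comp mh).
Qed.

(* Mean square increment of [h] along a stationary Gaussian pair with
   correlation [c]. *)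
Definition corr_energy (c : R) : \bar R :=
  \int[gamma]_x \int[gamma]_z
    sqdist x (c *: (x : H) + Num.sqrt (1 - c ^+ 2) *: (z : H))%R.

Lemma integral3E (F : HHH -> \bar R) :
  measurable_fun setT F -> (forall w, 0 <= F w) ->
  \int[ggg]_w F w = \int[gamma]_x \int[gamma]_z \int[gamma]_y F ((x, z), y).
Proof.
move=> mF F0; rewrite (fubini_tonelli1 (m1 := gg) (m2 := gamma) F mF F0).
apply: (fubini_tonelli1 (m1 := gamma) (m2 := gamma)
  (fun w => \int[gamma]_y F (w, y))).
- exact: (measurable_fun_fubini_tonelli_F (m2 := gamma) F).
- by move=> w; apply: integral_ge0.
Qed.

Let m1 : measurable_fun setT (fun w : HHH => w.1.1).
Proof. exact: (measurableT_comp measurable_fst). Qed.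
Let m2 : measurable_fun setT (fun w : HHH => w.1.2).
Proof. exact: (measurableT_comp measurable_snd). Qed.
Let m3 : measurable_fun setT (fun w : HHH => w.2).
Proof. exact: measurable_snd. Qed.

Definition lin3 (a b c : R) (w : HHH) : borel H :=
  (a *: (w.1.1 : H) + b *: (w.1.2 : H) + c *: (w.2 : H))%R.

Lemma measurable_lin3 a b c : measurable_fun setT (lin3 a b c).
Proof.
have := maff 1 c (maff a b m1 m2) m3.
by under eq_fun do rewrite scale1r.
Qed.

(** The part [b z + c y] is independent of [x] and has the law of [sqrt (1 - a^2) z], so that the
    pair is a stationary one with correlation [a]. *)
Lemma corr_energy_lin3 a b c : (a ^+ 2 + b ^+ 2 + c ^+ 2 = 1)%R ->
  \int[ggg]_w sqdist w.1.1 (lin3 a b c w) = corr_energy a.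
Proof.
move=> abc; rewrite (integral3E (measurable_sqdist m1 (measurable_lin3 a b c))); last first.
  by move=> w; exact: sqdist_ge0.
apply: eq_integral => x _ /=.
rewrite -(@ge0_integral_stable b c _ (fun y => sqdist x (a *: (x : H) + (y : H)))%R).
- by apply: eq_integral => z _; apply: eq_integral => y _; rewrite /lin3/= addrA.
- by rewrite sqr_sqrtr; lra || nra.
- apply: measurable_sqdist => //.
  have := maff a 1 (@measurable_cst _ _ (borel H) (borel H) setT x) (@measurable_id _ (borel H) setT).
  by under eq_fun do rewrite scale1r.
- by move=> y; exact: sqdist_ge0.
Qed.

Lemma integral_sqdist_triangle (x y z : HHH -> borel H) :
  measurable_fun setT x -> measurable_fun setT y -> measurable_fun setT z ->
  \int[ggg]_w sqdist (x w) (z w) <=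
  2%:E * (\int[ggg]_w sqdist (x w) (y w) + \int[ggg]_w sqdist (y w) (z w)).
Proof.
move=> mx my mz.
rewrite -ge0_integralD//; try by [move=> w _; exact: sqdist_ge0|exact: measurable_sqdist].
rewrite -ge0_integralZl//; last 2 first.
- by apply: emeasurable_funD; exact: measurable_sqdist.
- by move=> w _; rewrite adde_ge0 ?sqdist_ge0.
apply: ge0_le_integral => //.
- by move=> w _; exact: sqdist_ge0.
- exact: measurable_sqdist.
- by apply: measurable_funeM; apply: emeasurable_funD; exact: measurable_sqdist.
- by move=> w _; exact: sqdist_triangle.
Qed.

(** Between [x] and [c^2 x + c q z + q y] the point [c x + q z] is inserted: each consecutive pair
    has correlation [c]. The squared triangle inequality costs a factor 2 on the sum of two equal
    energies. *)
Lemma corr_energy_sqr (c : R) : (0 <= c <= 1)%R ->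
  corr_energy (c ^+ 2) <= 4%:E * corr_energy c.
Proof.
move=> c01; pose q := Num.sqrt (1 - c ^+ 2).
have q2 : (q ^+ 2 = 1 - c ^+ 2)%R by rewrite sqr_sqrtr//; nra.
have e1 : (c ^+ 2 + q ^+ 2 + 0 ^+ 2 = 1)%R by rewrite q2; ring.
have e2 : ((c ^+ 2) ^+ 2 + (c * q) ^+ 2 + q ^+ 2 = 1)%R by rewrite [((c * q) ^+ 2)%R]exprMn q2; ring.
rewrite -(corr_energy_lin3 e2).
apply: (le_trans (integral_sqdist_triangle m1 (measurable_lin3 c q 0) (measurable_lin3 _ _ _))).
rewrite (corr_energy_lin3 e1).
suff -> : \int[ggg]_w sqdist (lin3 c q 0 w) (lin3 (c ^+ 2) (c * q) q w) = corr_energy c.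
  rewrite [X in _ <= X * _](_ : _ = 2%:E * 2%:E); last by rewrite -EFinM; congr EFin; ring.
  rewrite -muleA lee_pmul2l//.
  by rewrite (_ : 2%:E = 1%:E + 1%:E)// ge0_muleDl// !mul1e.
rewrite (integral3E (measurable_sqdist (measurable_lin3 _ _ _) (measurable_lin3 _ _ _))); last first.
  by move=> w; exact: sqdist_ge0.
pose G (y : borel H) := \int[gamma]_z sqdist y (c *: (y : H) + q *: (z : H))%R.
transitivity (\int[gamma]_x \int[gamma]_z G (c *: (x : H) + q *: (z : H))%R).
  apply: eq_integral => x _; apply: eq_integral => z _; apply: eq_integral => y _.
  rewrite /lin3/= scale0r addr0; congr sqdist.
  by rewrite scalerDr !scalerA -expr2.
have mG : measurable_fun setT G.
  apply: (measurable_fun_fubini_tonelli_F (m2 := gamma)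
    (fun w : HH => sqdist w.1 (c *: (w.1 : H) + q *: (w.2 : H))%R)).
    by apply: measurable_sqdist => //; exact: maff.
  by move=> w; exact: sqdist_ge0.
have cq1 : (c ^+ 2 + q ^+ 2 = 1 ^+ 2)%R by rewrite q2; ring.
rewrite (ge0_integral_stable cq1 mG).
  by apply: eq_integral => x _; rewrite scale1r.
by move=> x; apply: integral_ge0 => z _; exact: sqdist_ge0.
Qed.

Lemma corr_energy_iter (c : R) k : (0 <= c <= 1)%R ->
  corr_energy (c ^+ (2 ^ k)) <= (4 ^+ k)%:E * corr_energy c.
Proof.
move=> c01; elim: k => [|k IHk]; first by rewrite expn0 expr1 expr0 mul1e.
have ck : (0 <= c ^+ (2 ^ k) <= 1)%R.
  by case/andP: c01 => c0 c1; rewrite exprn_ge0//= exprn_ile1.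
rewrite expnSr exprM; apply: (le_trans (corr_energy_sqr ck)).
rewrite exprS EFinM -muleA; apply: lee_wpmul2l IHk.
by rewrite lee_fin.
Qed.

Lemma swap_energy (c e : R) :
  \int[ggg]_w sqdist (lin3 c c e w) w.1.2 = \int[ggg]_w sqdist w.1.1 (lin3 c c e w).
Proof.
have mG : measurable_fun setT (fun w : HH =>
    \int[gamma]_z sqdist (lin3 c c e (w, z)) w.2).
  apply: (measurable_fun_fubini_tonelli_F (m2 := gamma)
    (fun w : HHH => sqdist (lin3 c c e w) w.1.2)); last by move=> w; exact: sqdist_ge0.
  by apply: measurable_sqdist => //; exact: measurable_lin3.
rewrite (integral3E (measurable_sqdist (measurable_lin3 c c e) m2)); last first.
  by move=> w; exact: sqdist_ge0.
rewrite (integral3E (measurable_sqdist m1 (measurable_lin3 c c e))); last first.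
  by move=> w; exact: sqdist_ge0.
have G0 (w : HH) : 0 <= \int[gamma]_z sqdist (lin3 c c e (w, z)) w.2.
  by apply: integral_ge0 => z _; exact: sqdist_ge0.
rewrite [LHS](fubini_tonelli (m1 := gamma) (m2 := gamma) _ mG G0).
apply: eq_integral => x _; apply: eq_integral => y _; apply: eq_integral => z _.
by rewrite sqdistC /lin3/= [(c *: (y : H) + _)%R]addrC.
Qed.

(** The point [c x + c z + e y] has correlation [c] with both independent endpoints [x] and [z];
    such a standard Gaussian exists exactly when [2 c^2 <= 1]. *)
Lemma independent_energy_le (c : R) : (2 * c ^+ 2 <= 1)%R ->
  \int[gamma]_x \int[gamma]_z sqdist x z <= 4%:E * corr_energy c.
Proof.
move=> c1; pose e := Num.sqrt (1 - 2 * c ^+ 2).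
have e1 : (c ^+ 2 + c ^+ 2 + e ^+ 2 = 1)%R by rewrite sqr_sqrtr ?subr_ge0//; ring.
have <- : \int[ggg]_w sqdist w.1.1 w.1.2 = \int[gamma]_x \int[gamma]_z sqdist x z.
  rewrite (integral3E (measurable_sqdist m1 m2)); last by move=> w; exact: sqdist_ge0.
  by apply: eq_integral => x _; apply: eq_integral => z _; rewrite /= integral_cst_prob.
apply: (le_trans (integral_sqdist_triangle m1 (measurable_lin3 c c e) m2)).
rewrite swap_energy (corr_energy_lin3 e1).
rewrite [X in _ <= X * _](_ : _ = 2%:E * 2%:E); last by rewrite -EFinM; congr EFin; ring.
rewrite -muleA lee_pmul2l//.
by rewrite (_ : 2%:E = 1%:E + 1%:E)// ge0_muleDl// !mul1e.
Qed.

Definition fork_energy (rho : R) : \bar R :=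
  \int[gamma]_x \int[gamma]_z \int[gamma]_y
    sqdist (pcn_proposal rho x z) (pcn_proposal rho x y).

Lemma measurable_pcn_proposal d (T : measurableType d) (rho : R)
    (F G : T -> borel H) : measurable_fun setT F -> measurable_fun setT G ->
  measurable_fun setT (fun x => pcn_proposal rho (F x) (G x) : borel H).
Proof. exact: maff. Qed.

(** Seen from the first proposal, the common state is in turn one of its proposals, by the
    reflection of [(x, z)]. The second proposal is thus two transitions away, with correlation
    [rho^2]. *)
Lemma fork_energyE (rho : R) : (0 <= rho <= 1)%R ->
  fork_energy rho = corr_energy (rho ^+ 2).
Proof.
move=> rho01; pose q := Num.sqrt (1 - rho ^+ 2).
have q2 : (q ^+ 2 = 1 - rho ^+ 2)%R by rewrite sqr_sqrtr//; nra.
have e1 : ((rho ^+ 2) ^+ 2 + (rho * q) ^+ 2 + q ^+ 2 = 1)%R.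
  by rewrite [((rho * q) ^+ 2)%R]exprMn q2; ring.
have rq : (rho ^+ 2 + q ^+ 2 = 1)%R by rewrite q2; ring.
pose F (w : HHH) := sqdist w.1.1 (lin3 (rho ^+ 2) (rho * q) q w).
have mF : measurable_fun setT F by apply: measurable_sqdist => //; exact: measurable_lin3.
have F0 w : 0 <= F w by exact: sqdist_ge0.
rewrite -(corr_energy_lin3 e1) [RHS](fubini_tonelli2 (m1 := gg) (m2 := gamma) F mF F0).
pose K (w : HHH) := sqdist (pcn_proposal rho w.1.1 w.1.2) (pcn_proposal rho w.1.1 w.2).
have mK : measurable_fun setT K.
  by apply: measurable_sqdist; exact: measurable_pcn_proposal.
have K0 w : 0 <= K w by exact: sqdist_ge0.
have -> : fork_energy rho = \int[ggg]_w K w by rewrite (integral3E mK K0).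
rewrite (fubini_tonelli2 (m1 := gg) (m2 := gamma) K mK K0).
apply: eq_integral => y _; rewrite /fubini_G.
have mFy : measurable_fun setT (fun w : HH => F (w, y)).
  exact: (measurableT_comp mF (pair2_measurable y)).
have mKy : measurable_fun setT (fun w : HH => K (w, y)).
  exact: (measurableT_comp mK (pair2_measurable y)).
rewrite [LHS](fubini_tonelli1 (m1 := gamma) (m2 := gamma) _ mKy (fun w => K0 _)).
rewrite [RHS](fubini_tonelli1 (m1 := gamma) (m2 := gamma) _ mFy (fun w => F0 _)).
rewrite /fubini_F [RHS](ge0_integral_rotation rq mFy (fun w => F0 _)).
apply: eq_integral => x _; apply: eq_integral => z _.
rewrite /K /F /= /rotation/= /lin3/=; congr sqdist; rewrite /pcn_proposal -/q.
congr (_ + _)%R.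
rewrite expr2 -!scalerA -scalerDr; congr (_ *: _)%R.
rewrite scalerDr scalerBr !scalerA addrACA -scalerDl -!expr2 rq scale1r.
by rewrite [(q * rho)%R]mulrC subrr addr0.
Qed.

End spectral_gap.

Lemma exists_small_pow (c : R) : (0 <= c < 1)%R -> exists k, (2 * (c ^+ (2 ^ k)) ^+ 2 <= 1)%R.
Proof.
move=> /andP[c0 c1].
have : (c ^+ n @[n --> \oo] --> (0 : R))%R by apply: cvg_expr; rewrite ger0_norm.
move=> /cvgrPdist_le /(_ 2^-1%R) [|k _ /(_ (2 ^ k)%N)]; first by rewrite invr_gt0.
rewrite /= sub0r normrN => /(_ (ltnW (ltn_expl _ _))) kc; exists k.
have {}kc := kc isT; rewrite ger0_norm ?exprn_ge0// in kc.
have : (0 <= c ^+ (2 ^ k))%R by rewrite exprn_ge0.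
move: kc; set u := (c ^+ _)%R; nra.
Qed.

(* Spectral gap of the proposal kernel: [fork_energy] is twice the mean
   conditional variance of [h] given the current state. *)
Lemma proposal_gap (rho : R) : (0 <= rho < 1)%R -> exists2 N : R, (0 < N)%R &
  forall h : borel H -> R, measurable_fun setT h ->
  \int[gamma]_x \int[gamma]_z sqdist h x z <= N%:E * fork_energy h rho.
Proof.
move=> /andP[r0 r1].
have r01 : (0 <= rho <= 1)%R by rewrite r0 ltW.
have rr : (0 <= rho ^+ 2 < 1)%R by rewrite sqr_ge0 expr_lt1.
have rr1 : (0 <= rho ^+ 2 <= 1)%R by case/andP: rr => -> /ltW.
have [k hk] := exists_small_pow rr.
exists (4 * 4 ^+ k)%R; first by rewrite mulr_gt0// exprn_gt0.
move=> h mh; apply: (le_trans (independent_energy_le mh hk)).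
rewrite EFinM -muleA lee_pmul2l// fork_energyE//.
exact: corr_energy_iter.
Qed.

End rotation_consequences.

(** * Fernique's theorem *)

Lemma product_probE d1 d2 (T1 : measurableType d1) (T2 : measurableType d2)
    (R : realType) (P1 : probability T1 R) (P2 : probability T2 R) A B :
  measurable A -> measurable B -> product_prob P1 P2 (A `*` B) = (P1 A * P2 B)%E.
Proof. exact: product_measure1E. Qed.

Section fernique.
Context (R : realType) (H : completeNormedModType R).
Variable dot : {dot H for idfun}.
Hypotheses (hdot : norm_from_dot dot) (hsep : separable H).
Variable gamma : probability (borel H) R.
Local Notation HH := (borel H * borel H)%type.
Local Notation gg := (product_prob gamma gamma).
Hypothesis grot : forall (a b : R) (A : set HH), a ^+ 2 + b ^+ 2 = 1 ->
  measurable A -> gg (rotation a b @^-1` A) = gg A.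

Let mnorm := @measurable_norm_borel R H.

Definition tail_set (t : R) : set (borel H) := [set x | t < `|(x : H)|].

Lemma measurable_tail_set t : measurable (tail_set t).
Proof.
rewrite -[X in measurable X]setTI.
exact: (measurable_fun_ltr (measurable_cst _) mnorm).
Qed.

Definition tail (t : R) : R := fine (gamma (tail_set t)).

Lemma tailE t : gamma (tail_set t) = (tail t)%:E.
Proof. by rewrite fineK//; apply: fin_num_measure; exact: measurable_tail_set. Qed.

Lemma tail_ge0 t : 0 <= tail t.
Proof. exact: fine_ge0. Qed.

Lemma tail_ni s t : s <= t -> tail t <= tail s.
Proof.
move=> st; rewrite -lee_fin -!tailE; apply: le_measure; rewrite ?inE;
  try exact: measurable_tail_set.
by move=> x; exact: le_lt_trans.
Qed.

(* The 45 degree rotation maps the pair [(x, z)] to [(x + z, x - z) / sqrt 2]. *)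
Lemma tail_quadratic (s t : R) :
  tail t * (1 - tail s) <= tail ((t - s) / Num.sqrt 2) ^+ 2.
Proof.
set u := (t - s) / Num.sqrt 2.
pose c : R := (Num.sqrt 2)^-1.
have c0 : 0 < c by rewrite invr_gt0 sqrtr_gt0.
have cc : c ^+ 2 + c ^+ 2 = 1.
  by rewrite exprVn sqr_sqrtr//; field.
have c2 : c * (c + c) = 1 by rewrite -[RHS]cc; ring.
pose A : set HH := tail_set t `*` ~` tail_set s.
have mA : measurable A.
  by apply: measurableX; [|apply: measurableC]; exact: measurable_tail_set.
have <- : fine (gg A) = tail t * (1 - tail s).
  rewrite product_probE; [|exact: measurable_tail_set|
    by apply: measurableC; exact: measurable_tail_set].
  rewrite probability_setC; last exact: measurable_tail_set.
  by rewrite !tailE -EFinB -EFinM.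
have <- : fine (gg (tail_set u `*` tail_set u)) = tail u ^+ 2.
  rewrite product_probE; try exact: measurable_tail_set.
  by rewrite tailE -EFinM.
have mU : measurable (tail_set u `*` tail_set u : set HH).
  by apply: measurableX; exact: measurable_tail_set.
apply: fine_le; [exact: fin_num_measure|exact: fin_num_measure|].
rewrite -(grot cc mA); apply: le_measure; rewrite ?inE//.
  have := @measurable_rotation R H dot hdot hsep c c measurableT _ mA.
  by rewrite setTI.
move=> [x z] [] /=; rewrite /tail_set/= => xt /negP; rewrite -leNgt => zs.
have xE : (x : H) = c *: ((c *: (x : H) + c *: (z : H)) + (c *: (x : H) - c *: (z : H))).
  by rewrite addrACA subrr addr0 -scalerDl scalerA c2 scale1r.
have zE : (z : H) = c *: ((c *: (x : H) + c *: (z : H)) - (c *: (x : H) - c *: (z : H))).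
  rewrite opprB [c *: (x : H) + _]addrC addrACA subrr addr0.
  by rewrite -scalerDl scalerA c2 scale1r.
have E (a b : H) : t < `|a| -> `|b| <= s -> u < `|c *: (a + b)|.
  move=> ta bs; rewrite normrZ gtr0_norm// /u mulrC ltr_pM2l//.
  have := lerB_normD a b; lra.
split; rewrite /=.
  by rewrite xE; exact: E.
by rewrite zE; apply: E; rewrite ?normrN.
Qed.

Lemma tail_small : exists2 s, 1 <= s & tail s <= 4^-1.
Proof.
have cv : (gamma \o (fun n : nat => tail_set n%:R)) @ \oo --> gamma (\bigcap_n tail_set n%:R).
  apply: nonincreasing_cvg_mu.
  - by rewrite /= tailE ltry.
  - by move=> n; exact: measurable_tail_set.
  - by apply: bigcapT_measurable => n; exact: measurable_tail_set.
  - move=> m n mn; apply/subsetPset => x; apply: le_lt_trans.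
    by rewrite ler_nat.
have c0 : gamma (\bigcap_n tail_set n%:R) = 0%E.
  rewrite (_ : \bigcap_n _ = set0) ?measure0//; apply/seteqP; split=> // x /=.
  move=> /(_ (Num.truncn `|(x : H)|).+1 I); rewrite /tail_set/=.
  by rewrite ltNge ltW// truncnS_gt.
rewrite c0 in cv.
have /fine_cvgP[_ /cvgrPdist_le /(_ 4^-1)[|n _ nP]] := cv.
  by rewrite invr_gt0.
(* The successor secures [1 <= s]. *)
exists n.+1%:R; first by rewrite ler1n.
have := nP n.+1 (leqnSn n); rewrite /= sub0r normrN ger0_norm//; exact: fine_ge0.
Qed.

(** The quantity [T n], a tail rescaled by [4 / 3], starts at most at [1 / 3] and satisfies
    [T (n + 1) <= T n ^ 2], because [1 - tail s] is at least [3 / 4]. The radii obey the recursion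
    of [tail_quadratic]: the shift by [s] is absorbed since [4 / sqrt 2 <= 3]. *)
Lemma tail_iter s n : 0 <= s -> tail s <= 4^-1 ->
  tail (4 * s * Num.sqrt 2 ^+ n - 3 * s) <= 3^-1 ^+ (2 ^ n).
Proof.
move=> s0 ts; set r2 := Num.sqrt 2.
have r22 : r2 ^+ 2 = 2 :> R by rewrite sqr_sqrtr.
have r20 : 0 < r2 by rewrite sqrtr_gt0.
have r2l : 4 / 3 <= r2.
  by rewrite -(@ler_pXn2r _ 2%N)// ?nnegrE ?ltW// ?r22//; lra.
pose T n := 4 / 3 * tail (4 * s * r2 ^+ n - 3 * s).
suff : T n <= 3^-1 ^+ (2 ^ n).
  apply: le_trans; rewrite /T; have := tail_ge0 (4 * s * r2 ^+ n - 3 * s); lra.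
elim: n => [|n IHn].
  rewrite /T expr0 mulr1 expn0 expr1 (_ : 4 * s - 3 * s = s); last by ring.
  lra.
have T0 : 0 <= T n by rewrite /T mulr_ge0 ?tail_ge0//; lra.
apply: (@le_trans _ _ (T n ^+ 2)); last first.
  by rewrite expnSr exprM lerXn2r// nnegrE exprn_ge0// invr_ge0.
set t := 4 * s * r2 ^+ n.+1 - 3 * s.
have q := tail_quadratic s t.
have le2 : tail ((t - s) / r2) <= tail (4 * s * r2 ^+ n - 3 * s).
  apply: tail_ni; rewrite ler_pdivlMr// /t exprSr; nra.
rewrite /T -/t.
move: q le2; rewrite -/r2.
have := tail_ge0 t; have := tail_ge0 ((t - s) / r2).
set a := tail t; set b := tail ((t - s) / r2).
set b' := tail (4 * s * r2 ^+ n - 3 * s) => b0 a0 q bb'.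
have h1 : b ^+ 2 <= b' ^+ 2 by rewrite !expr2 ler_pM.
have h2 : a * (3 / 4) <= a * (1 - tail s) by rewrite ler_wpM2l//; lra.
have : a * (3 / 4) <= b' ^+ 2 by lra.
rewrite exprMn; nra.
Qed.

(** On the shell between the radii [t n] and [t (n + 1)] the integrand is at most [(3 / 2)^(2^n)],
    while the shell has mass at most [3^(- 2^n)]. The product [2^(- 2^n)] is summable, being at most
    [2^(- (n + 1))]. *)
Lemma fernique : exists2 kappa : R, 0 < kappa &
  (\int[gamma]_x (expR (kappa * `|(x : H)| ^+ 2))%:E < +oo)%E.
Proof.
have [s s1 ts] := tail_small.
have s0 : 0 < s by exact: lt_le_trans s1.
set r2 : R := Num.sqrt 2.
have r22 : r2 ^+ 2 = 2 :> R by rewrite sqr_sqrtr.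
have r20 : 0 < r2 by rewrite sqrtr_gt0.
have r21 : 1 <= r2 by rewrite -(@ler_pXn2r _ 2%N)// ?nnegrE ?ltW// r22 expr1n; lra.
pose t n := 4 * s * r2 ^+ n - 3 * s.
(* The radius [t (n + 1)] is at most [4 s r2^(n + 1)], whose square is [32 s^2 2^n]. *)
pose kappa := ln (3 / 2) / (32 * s ^+ 2).
have l32 : 0 < ln (3 / 2 : R) by rewrite ln_gt0//; lra.
have k0 : 0 < kappa by rewrite divr_gt0// mulr_gt0// exprn_gt0.
have t0 n : s <= t n.
  have : 1 <= r2 ^+ n by rewrite exprn_ege1.
  rewrite /t; set w := r2 ^+ n; nra.
have tn n : expR (kappa * t n.+1 ^+ 2) <= (3 / 2) ^+ (2 ^ n).
  have -> : (3 / 2) ^+ (2 ^ n) = expR (kappa * (4 * s * r2 ^+ n.+1) ^+ 2).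
    rewrite [X in expR X](_ : _ = (2 ^ n)%:R * ln (3 / 2)).
      by rewrite expRM_natl lnK// posrE; lra.
    have E : (r2 ^+ n.+1) ^+ 2 = 2 * 2 ^+ n by rewrite -exprM mulnC exprM r22 exprS.
    rewrite /kappa exprMn E natrX; set w := _ ^+ n.
    by field; rewrite gt_eqF.
  rewrite ler_expR ler_pM2l// lerXn2r// ?nnegrE.
  - by rewrite (le_trans _ (t0 _))// ltW.
  - by rewrite mulr_ge0 ?exprn_ge0 ?ltW// mulr_gt0.
  - by rewrite /t; lra.
have big x : exists n, x <= t n.
  have cv : r2^-1 ^+ n @[n --> \oo] --> (0 : R).
    apply: cvg_expr; rewrite ger0_norm ?invr_ge0 ?ltW// invf_lt1//.
    by rewrite -(@ltr_pXn2r _ 2%N)// ?nnegrE ?ltW// r22 expr1n; lra.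
  pose e := (4 * s) / (`|x| + 3 * s).
  have xs : 0 < `|x| + 3 * s by rewrite ltr_wpDl// mulr_gt0.
  have e0 : 0 < e by rewrite divr_gt0// mulr_gt0.
  move/cvgrPdist_le : cv => /(_ e e0)[n _ /(_ n (leqnn n))].
  rewrite /= sub0r normrN => /(le_trans (ler_norm _)) h.
  exists n; rewrite /t lerBrDr (le_trans _ (_ : `|x| + 3 * s <= _))//.
    by rewrite lerD2r ler_norm.
  move: h; rewrite ?exprVn /e ler_pdivlMr// ler_pdivrMl ?exprn_gt0//.
  by rewrite [_ * (4 * s)]mulrC.
exists kappa => //.
pose f n (x : borel H) : \bar R :=
  ((expR (kappa * t n.+1 ^+ 2))%:E * (\1_(tail_set (t n)) x)%:E)%E.
have f0 n x : (0 <= f n x)%E by rewrite mule_ge0 ?lee_fin ?expR_ge0.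
have mf n : measurable_fun setT (f n).
  apply: measurable_funeM; apply/measurable_EFinP; apply: measurable_indic.
  exact: measurable_tail_set.
have mS : measurable_fun setT (fun x => (\sum_(n <oo) f n x)%E).
  by apply: ge0_emeasurable_sum.
apply: (@le_lt_trans _ _ (\int[gamma]_x ((expR (kappa * s ^+ 2))%:E + \sum_(n <oo) f n x))%E).
  apply: ge0_le_integral => //.
  - apply/measurable_EFinP; apply: measurableT_comp => //.
    by apply: measurable_funM => //; exact: measurable_funX.
  - exact: emeasurable_funD.
  - move=> x _; have [xs|sx] := leP `|(x : H)| s.
      apply: (@le_trans _ _ ((expR (kappa * s ^+ 2))%:E + 0)%E).
        by rewrite adde0 lee_fin ler_expR ler_pM2l// lerXn2r// nnegrE// ltW.
      by apply: leeD => //; apply: nneseries_ge0.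
    case: (ex_minnP (big `|(x : H)|)) => -[|n] xn nmin.
      by move: xn sx; rewrite /t expr0 mulr1 (_ : 4 * s - 3 * s = s); [case: ltgtP|ring].
    have nx : t n < `|(x : H)|.
      by rewrite ltNge; apply/negP => /nmin; rewrite ltnn.
    apply: (@le_trans _ _ (f n x)).
      rewrite /f indicE mem_set// mule1 lee_fin ler_expR ler_pM2l//.
      by rewrite lerXn2r// nnegrE// (le_trans _ xn).
    apply: (@le_trans _ _ (\sum_(n <oo) f n x)%E); last by rewrite leeDr// lee_fin expR_ge0.
    apply: le_trans (nneseries_lim_ge n.+1 _) => //.
    by rewrite big_nat_recr//= leeDr// sume_ge0.
rewrite ge0_integralD//; last by move=> x _; exact: nneseries_ge0.
rewrite integral_cst_prob integral_nneseries//.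
apply: (@le_lt_trans _ _ ((expR (kappa * s ^+ 2))%:E + 1%:E)%E); last by rewrite -EFinD ltry.
apply: leeD => //; apply: le_trans (epsilon_trick0 xpredT ler01).
apply: lee_nneseries; first by move=> n _ _; apply: integral_ge0.
move=> n _; have mi : measurable_fun setT (fun x : borel H => (\1_(tail_set (t n)) x)%:E : \bar R).
  by apply/measurable_EFinP; apply: measurable_indic; exact: measurable_tail_set.
rewrite /f (ge0_integralZl gamma measurableT mi); last 2 first.
- by move=> x _; rewrite lee_fin.
- by rewrite lee_fin expR_ge0.
rewrite integral_indic//; last exact: measurable_tail_set.
rewrite setIT [X in (_ * X)%E](_ : _ = (tail (t n))%:E); last exact: tailE.
rewrite -EFinM lee_fin.
apply: (@le_trans _ _ ((3 / 2) ^+ (2 ^ n) * 3^-1 ^+ (2 ^ n))).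
  apply: ler_pM; [exact: expR_ge0|exact: tail_ge0|exact: tn|].
  by apply: tail_iter => //; exact: ltW.
rewrite -exprMn (_ : 3 / 2 / 3 = 2^-1 :> R); last by field.
rewrite div1r natrX -exprVn.
by apply: ler_wiXn2l; rewrite ?invr_ge0 ?invf_le1// ?ler1n// ltn_expl.
Qed.

End fernique.

(** * Integral inequalities on a probability space *)

Section probability_integrals.
Context d (T : measurableType d) (R : realType) (mu : probability T R).

Lemma EFin_Rintegral (f : T -> R) : mu.-integrable setT (EFin \o f) ->
  (\int[mu]_x (f x)%:E = (\int[mu]_x f x)%:E)%E.
Proof. by move=> fi; rewrite fineK//; exact: integrable_fin_num. Qed.

Lemma integrable_cst_prob (c : R) : mu.-integrable setT (EFin \o (fun=> c)).
Proof. exact: finite_measure_integrable_cst. Qed.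

Lemma Rintegral_cst_prob (c : R) : \int[mu]_x c = c.
Proof. by rewrite Rintegral_cst//= probability_setT mulr1. Qed.

Lemma integrableZ_real (c : R) (f : T -> R) : mu.-integrable setT (EFin \o f) ->
  mu.-integrable setT (EFin \o (fun x => c * f x)).
Proof.
move=> fi; have := integrableZl measurableT c fi.
by apply: eq_integrable => // x _; rewrite /= EFinM.
Qed.

Lemma integrableD_real (f g : T -> R) : mu.-integrable setT (EFin \o f) ->
  mu.-integrable setT (EFin \o g) ->
  mu.-integrable setT (EFin \o (fun x => f x + g x)).
Proof.
move=> fi gi; have := integrableD measurableT fi gi.
by apply: eq_integrable => // x _; rewrite /= EFinD.
Qed.

Lemma integrableB_real (f g : T -> R) : mu.-integrable setT (EFin \o f) ->
  mu.-integrable setT (EFin \o g) ->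
  mu.-integrable setT (EFin \o (fun x => f x - g x)).
Proof.
move=> fi gi; have := integrableB measurableT fi gi.
by apply: eq_integrable => // x _; rewrite /= EFinB.
Qed.

Lemma le_integrable_real (f g : T -> R) : measurable_fun setT f ->
  (forall x, `|f x| <= g x) -> mu.-integrable setT (EFin \o g) ->
  mu.-integrable setT (EFin \o f).
Proof.
move=> mf fg gi; apply: le_integrable gi => //; first exact/measurable_EFinP.
by move=> x _; rewrite /= lee_fin (le_trans (fg x))// ler_norm.
Qed.

Lemma ge0_integrable_real (f : T -> R) (c : \bar R) : measurable_fun setT f ->
  (forall x, 0 <= f x) -> (\int[mu]_x (f x)%:E <= c)%E -> (c < +oo)%E ->
  mu.-integrable setT (EFin \o f).
Proof.
move=> mf f0 fc cy; apply/integrableP; split; first exact/measurable_EFinP.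
apply: le_lt_trans cy; apply: le_trans fc.
by under eq_integral do rewrite /= ger0_norm//.
Qed.

(** The variance formula with an independent copy: if [A] and [B] integrate to the second moment and
    to the mean of a random value, the bound is twice its variance, and [Phi] minorizes the squared
    difference of two copies. *)
Lemma double_integral_le (A B : T -> R) (Phi : T * T -> R) :
  mu.-integrable setT (EFin \o A) -> mu.-integrable setT (EFin \o B) ->
  measurable_fun setT Phi -> (forall w, 0 <= Phi w) ->
  (forall z y, Phi (z, y) <= A z + A y - 2 * B z * B y) ->
  (\int[mu]_z \int[mu]_y (Phi (z, y))%:E <=
    (2 * \int[mu]_z A z - 2 * (\int[mu]_z B z) ^+ 2)%:E)%E.
Proof.
move=> iA iB mP P0 PAB.
have mA : measurable_fun setT A by apply/measurable_EFinP; exact: measurable_int iA.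
have mB : measurable_fun setT B by apply/measurable_EFinP; exact: measurable_int iB.
pose IA := \int[mu]_z A z; pose IB := \int[mu]_z B z.
have inner z : (\int[mu]_y (Phi (z, y))%:E <= (A z + IA - 2 * IB * B z)%:E)%E.
  have i1 : mu.-integrable setT (EFin \o (fun y => A z + A y)).
    by apply: integrableD_real => //; exact: integrable_cst_prob.
  have i2 : mu.-integrable setT (EFin \o (fun y => 2 * B z * B y)).
    exact: integrableZ_real.
  apply: (@le_trans _ _ (\int[mu]_y (A z + A y - 2 * B z * B y)%:E)%E).
    apply: ge0_le_integral => //.
    - by move=> y _; rewrite lee_fin.
    - by apply/measurable_EFinP; apply: (measurableT_comp mP).
    - by have /measurable_int := integrableB_real i1 i2.
    - by move=> y _; rewrite lee_fin.
  rewrite (EFin_Rintegral (integrableB_real i1 i2)) lee_fin.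
  rewrite RintegralB// RintegralD//; last exact: integrable_cst_prob.
  rewrite Rintegral_cst_prob RintegralZl//.
  by rewrite -/IA -/IB; rewrite le_eqVlt; apply/orP; left; apply/eqP; ring.
have i1 : mu.-integrable setT (EFin \o (fun z => A z + IA)).
  by apply: integrableD_real => //; exact: integrable_cst_prob.
have i2 : mu.-integrable setT (EFin \o (fun z => 2 * IB * B z)).
  exact: integrableZ_real.
apply: (@le_trans _ _ (\int[mu]_z (A z + IA - 2 * IB * B z)%:E)%E).
  apply: ge0_le_integral => //.
  - by move=> z _; apply: integral_ge0 => y _; rewrite lee_fin.
  - apply: (measurable_fun_fubini_tonelli_F (m2 := mu) (fun w => (Phi w)%:E)).
      exact/measurable_EFinP.
    by move=> w; rewrite lee_fin.
  - by have /measurable_int := integrableB_real i1 i2.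
rewrite (EFin_Rintegral (integrableB_real i1 i2)) lee_fin.
rewrite RintegralB// RintegralD//; last exact: integrable_cst_prob.
rewrite Rintegral_cst_prob RintegralZl// -/IA -/IB.
by rewrite le_eqVlt; apply/orP; left; apply/eqP; ring.
Qed.

(** The graph of the fourth power lies above its tangent at the mean [m], namely [4 m^3 b - 3 m^4].
    If [A] is not integrable, the right-hand side is infinite. *)
Lemma jensen_pow4 (A B : T -> R) : mu.-integrable setT (EFin \o B) ->
  measurable_fun setT A -> (forall x, 0 <= A x) -> (forall x, B x ^+ 4 <= A x) ->
  (((\int[mu]_x B x) ^+ 4)%:E <= \int[mu]_x (A x)%:E)%E.
Proof.
move=> iB mA A0 BA; set m := \int[mu]_x B x.
have [iA|] := pselect (mu.-integrable setT (EFin \o A)); last first.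
  move=> niA; have [->|nyA] := eqVneq (\int[mu]_x (A x)%:E)%E +oo%E.
    exact: leey.
  exfalso; apply: niA; apply: (@ge0_integrable_real _ _ mA A0 (lexx _)).
  by rewrite ltey.
rewrite (EFin_Rintegral iA) lee_fin.
have i2 : mu.-integrable setT (EFin \o (fun x => 4 * m ^+ 3 * B x)).
  exact: integrableZ_real.
have i3 := integrable_cst_prob (3 * m ^+ 4).
apply: (@le_trans _ _ (\int[mu]_x (4 * m ^+ 3 * B x - 3 * m ^+ 4))).
  rewrite RintegralB// RintegralZl// Rintegral_cst_prob -/m.
  by rewrite le_eqVlt; apply/orP; left; apply/eqP; ring.
apply: le_Rintegral => //; first exact: integrableB_real.
move=> x _; apply: le_trans (BA x).
set b := B x; rewrite -subr_ge0.
rewrite (_ : _ - _ = (b - m) ^+ 2 * ((b + m) ^+ 2 + 2 * m ^+ 2)); last by ring.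
by rewrite mulr_ge0 ?sqr_ge0// addr_ge0 ?sqr_ge0// mulr_ge0 ?sqr_ge0.
Qed.

Lemma sqr_Rintegral_le (A B : T -> R) : mu.-integrable setT (EFin \o B) ->
  mu.-integrable setT (EFin \o A) -> (forall x, B x ^+ 2 <= A x) ->
  (\int[mu]_x B x) ^+ 2 <= \int[mu]_x A x.
Proof.
move=> iB iA BA; set m := \int[mu]_x B x.
have i2 : mu.-integrable setT (EFin \o (fun x => 2 * m * B x)).
  exact: integrableZ_real.
have i3 := integrable_cst_prob (m ^+ 2).
apply: (@le_trans _ _ (\int[mu]_x (2 * m * B x - m ^+ 2))).
  rewrite RintegralB// RintegralZl// Rintegral_cst_prob -/m.
  by rewrite le_eqVlt; apply/orP; left; apply/eqP; ring.
apply: le_Rintegral => //; first exact: integrableB_real.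
move=> x _; apply: le_trans (BA x).
by rewrite -subr_ge0 (_ : _ - _ = (B x - m) ^+ 2) ?sqr_ge0//; ring.
Qed.

End probability_integrals.

(** * The pCN Markov operator *)

Section pcn_operator.
Context (R : realType) (H : completeNormedModType R).
Variables (gamma : probability (borel H) R) (rho : R) (g : H -> R).

Definition pcn_acc (x z : H) : R :=
  Num.min 1 (expR (g x - g (pcn_proposal rho x z))).

(** The expectation of [u] at the next state given the state [x] and the Gaussian [z]: the uniform
    variable is already integrated out. *)
Definition pcn_mix (u : H -> R) (x z : H) : R :=
  pcn_acc x z * u (pcn_proposal rho x z) + (1 - pcn_acc x z) * u x.

Definition pcn_op (u : H -> R) (x : H) : R :=
  \int[gamma]_z pcn_mix u x (z : H).

(** This class contains the Hölder densities and the indicators and is stable under the Markov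
    operator; four moments of [gamma] then give every integrability that is required. *)
Definition linear_growth (u : H -> R) :=
  measurable_fun setT (u : borel H -> R) /\
  exists C : R, forall x, `|u x| <= C * (1 + `|x|).

End pcn_operator.

Section pcn_operator_theory.
Context (R : realType) (H : completeNormedModType R).
Variable dot : {dot H for idfun}.
Hypotheses (hdot : norm_from_dot dot) (hsep : separable H).
Variable gamma : probability (borel H) R.
Local Notation HH := (borel H * borel H)%type.
Local Notation gg := (product_prob gamma gamma).
Hypothesis grot : forall (a b : R) (A : set HH), a ^+ 2 + b ^+ 2 = 1 ->
  measurable A -> gg (rotation a b @^-1` A) = gg A.
Hypothesis moment4 : (\int[gamma]_x ((1 + `|(x : H)|) ^+ 4)%:E < +oo)%E.
Variables (rho : R) (g : H -> R).
Hypothesis rho01 : 0 <= rho < 1.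
Hypothesis mg : measurable_fun setT (g : borel H -> R).
Variables (k : R) (Pi : probability (borel H) R).
Hypothesis k0 : 0 < k.
Definition pcn_weight (k : R) (g : H -> R) (x : H) : R := k * expR (- g x).
Local Notation w := (pcn_weight k g).
Hypothesis hPi : forall A : set (borel H), measurable A ->
  (Pi A = \int[gamma]_(x in A) (w x)%:E)%E.

Local Notation prop := (pcn_proposal rho).
Local Notation acc := (pcn_acc rho g).
Local Notation mix := (pcn_mix rho g).
Local Notation K := (pcn_op gamma rho g).
Local Notation mprop := (measurable_pcn_proposal hdot hsep).

Lemma pcn_weight_gt0 x : 0 < w x.
Proof. by rewrite mulr_gt0 ?expR_gt0. Qed.

Lemma pcn_weight_ge0 x : 0 <= w x.
Proof. exact/ltW/pcn_weight_gt0. Qed.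

Lemma measurable_pcn_weight : measurable_fun setT (w : borel H -> R).
Proof.
apply: measurable_funM => //; apply: measurableT_comp => //.
exact: measurable_funN.
Qed.

Lemma ge0_integral_target (u : borel H -> \bar R) :
  measurable_fun setT u -> (forall x, 0 <= u x)%E ->
  (\int[Pi]_x u x = \int[gamma]_x (u x * (w x)%:E))%E.
Proof.
move=> mu u0; apply: (ge0_integral_density _ _ hPi) => //.
- exact: measurable_pcn_weight.
- exact: pcn_weight_ge0.
Qed.

Lemma pcn_acc_ge0 x z : 0 <= acc x z.
Proof. by rewrite /pcn_acc le_min ler01 expR_ge0. Qed.

Lemma pcn_acc_le1 x z : acc x z <= 1.
Proof. by rewrite /pcn_acc ge_min lexx. Qed.

Lemma measurable_pcn_acc d (T : measurableType d) (F G : T -> borel H) :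
  measurable_fun setT F -> measurable_fun setT G ->
  measurable_fun setT (fun t => acc (F t) (G t)).
Proof.
move=> mF mG; apply: measurable_minr => //.
apply: measurableT_comp => //; apply: measurable_funB.
  exact: (measurableT_comp mg).
apply: (measurableT_comp mg); exact: mprop.
Qed.

Lemma measurable_pcn_mix d (T : measurableType d) (F G : T -> borel H) u :
  measurable_fun setT (u : borel H -> R) ->
  measurable_fun setT F -> measurable_fun setT G ->
  measurable_fun setT (fun t => mix u (F t) (G t)).
Proof.
move=> mu mF mG; have ma := measurable_pcn_acc mF mG.
apply: measurable_funD; apply: measurable_funM => //.
- by apply: (measurableT_comp mu); exact: mprop.
- exact: measurable_funB.
- exact: (measurableT_comp mu).
Qed.

Lemma pcn_mix_ge0 u x z : (forall x, 0 <= u x) -> 0 <= mix u x z.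
Proof.
move=> u0; rewrite /pcn_mix addr_ge0// mulr_ge0 ?pcn_acc_ge0//.
by rewrite subr_ge0 pcn_acc_le1.
Qed.

(* Detailed balance: the right-hand side is symmetric in the two states. *)
Lemma pcn_weight_acc x z :
  w x * acc x z = Num.min (w x) (w (prop x z)).
Proof.
rewrite /pcn_acc minr_pMr ?pcn_weight_ge0// mulr1; congr Num.min.
by rewrite /pcn_weight -mulrA -expRD addrA addNr add0r.
Qed.

Lemma rhoq : rho ^+ 2 + Num.sqrt (1 - rho ^+ 2) ^+ 2 = 1.
Proof. by rewrite sqr_sqrtr; [ring|move: rho01; nra]. Qed.

Lemma pcn_proposal_rotation (x z : borel H) :
  let r := rotation rho (Num.sqrt (1 - rho ^+ 2)) (x, z) in
  r.1 = prop x z /\ prop r.1 r.2 = x.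
Proof.
set q := Num.sqrt (1 - rho ^+ 2); split=> //=.
rewrite /rotation/= /pcn_proposal -/q.
rewrite scalerDr scalerBr !scalerA addrACA -scalerDl -!expr2 rhoq scale1r.
by rewrite [q * rho]mulrC subrr addr0.
Qed.

(** State and proposal form an exchangeable pair, since the reflection that produces the proposal is
    an involution preserving the product measure. *)
Lemma ge0_integral_proposal_sym (F : HH -> \bar R) :
  measurable_fun setT F -> (forall x, 0 <= F x)%E ->
  (\int[gamma]_x \int[gamma]_z F (x, prop x z : borel H) =
   \int[gamma]_x \int[gamma]_z F (prop x z : borel H, x))%E.
Proof.
move=> mF F0; pose G (t : HH) := F (t.1, prop t.1 t.2 : borel H).
have mG : measurable_fun setT G.
  by apply: (measurableT_comp mF); apply: measurable_fun_pair => //; exact: mprop.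
rewrite (ge0_integral_rotation hdot hsep grot rhoq mG (fun t => F0 _)).
apply: eq_integral => x _; apply: eq_integral => z _.
by have [e1 e2] := pcn_proposal_rotation x z; rewrite /G e2 e1.
Qed.

Lemma measurable_pcn_opE u : measurable_fun setT (u : borel H -> R) ->
  (forall x, 0 <= u x) ->
  measurable_fun setT (fun x : borel H => \int[gamma]_z (mix u x z)%:E)%E.
Proof.
move=> mu u0.
apply: (measurable_fun_fubini_tonelli_F (m2 := gamma)
  (fun t : HH => (mix u t.1 t.2)%:E)).
  by apply/measurable_EFinP; exact: measurable_pcn_mix.
by move=> t; rewrite lee_fin pcn_mix_ge0.
Qed.

Lemma pcn_reversible (u v : H -> R) :
  measurable_fun setT (u : borel H -> R) -> measurable_fun setT (v : borel H -> R) ->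
  (forall x, 0 <= u x) -> (forall x, 0 <= v x) ->
  (\int[Pi]_x ((u x)%:E * \int[gamma]_z (mix v x z)%:E) =
   \int[Pi]_x ((v x)%:E * \int[gamma]_z (mix u x z)%:E))%E.
Proof.
move=> mu mv u0 v0.
(* [F] is the accepted flow between two states, whose weight is symmetric; [G] is the rejected part,
   where both functions are taken at the same state. *)
pose F u v (t : HH) : \bar R := (Num.min (w t.1) (w t.2) * u t.1 * v t.2)%:E.
pose G u v (t : HH) : \bar R := ((w t.1 - Num.min (w t.1) (w (prop t.1 t.2))) * (u t.1 * v t.1))%:E.
have mw1 : measurable_fun setT (fun t : HH => w t.1).
  exact: (measurableT_comp measurable_pcn_weight).
have mF a b : measurable_fun setT (a : borel H -> R) ->
    measurable_fun setT (b : borel H -> R) -> measurable_fun setT (F a b).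
  move=> ma mb; apply/measurable_EFinP; apply: measurable_funM.
    apply: measurable_funM; last exact: (measurableT_comp ma).
    apply: measurable_minr => //.
    exact: (measurableT_comp measurable_pcn_weight).
  exact: (measurableT_comp mb).
have mG a b : measurable_fun setT (a : borel H -> R) ->
    measurable_fun setT (b : borel H -> R) -> measurable_fun setT (G a b).
  move=> ma mb; apply/measurable_EFinP; apply: measurable_funM.
    apply: measurable_funB => //; apply: measurable_minr => //.
    by apply: (measurableT_comp measurable_pcn_weight); exact: mprop.
  by apply: measurable_funM; [exact: (measurableT_comp ma)|exact: (measurableT_comp mb)].
have F0 a b t : (forall x, 0 <= a x) -> (forall x, 0 <= b x) -> (0 <= F a b t)%E.
  by move=> a0 b0; rewrite lee_fin !mulr_ge0// le_min !pcn_weight_ge0.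
have G0 a b t : (forall x, 0 <= a x) -> (forall x, 0 <= b x) -> (0 <= G a b t)%E.
  by move=> a0 b0; rewrite lee_fin !mulr_ge0// subr_ge0 ge_min lexx.
have E a b : measurable_fun setT (a : borel H -> R) ->
    measurable_fun setT (b : borel H -> R) ->
    (forall x, 0 <= a x) -> (forall x, 0 <= b x) ->
    (\int[Pi]_x ((a x)%:E * \int[gamma]_z (mix b x z)%:E) =
     \int[gamma]_x \int[gamma]_z F a b (x, prop x z : borel H) +
     \int[gamma]_x \int[gamma]_z G a b (x, z))%E.
  move=> ma mb a0 b0.
  have mFp : measurable_fun setT (fun t : HH => F a b (t.1, prop t.1 t.2 : borel H)).
    apply: (measurableT_comp (mF _ _ ma mb)); apply: measurable_fun_pair => //.
    exact: mprop.
  rewrite ge0_integral_target; last 2 first.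
  - apply: emeasurable_funM; first exact/measurable_EFinP.
    exact: measurable_pcn_opE.
  - move=> x; rewrite mule_ge0 ?lee_fin//; apply: integral_ge0 => z _.
    by rewrite lee_fin pcn_mix_ge0.
  rewrite -ge0_integralD//; last 4 first.
  - by move=> x _; apply: integral_ge0 => z _; exact: F0.
  - apply: (measurable_fun_fubini_tonelli_F (m2 := gamma) _ mFp).
    by move=> t; exact: F0.
  - by move=> x _; apply: integral_ge0 => z _; exact: G0.
  - apply: (measurable_fun_fubini_tonelli_F (m2 := gamma) _ (mG _ _ ma mb)).
    by move=> t; exact: G0.
  apply: eq_integral => x _.
  rewrite -ge0_integralD//; last 4 first.
  - by move=> z _; exact: F0.
  - exact: (measurableT_comp mFp (pair1_measurable x)).
  - by move=> z _; exact: G0.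
  - exact: (measurableT_comp (mG _ _ ma mb) (pair1_measurable x)).
  rewrite muleAC -EFinM -ge0_integralZl//; last 3 first.
  - by apply/measurable_EFinP; exact: measurable_pcn_mix.
  - by move=> z _; rewrite lee_fin pcn_mix_ge0.
  - by rewrite lee_fin mulr_ge0// pcn_weight_ge0.
  apply: eq_integral => z _; rewrite /F /G /= -EFinM -EFinD -pcn_weight_acc.
  by congr EFin; rewrite /pcn_mix; ring.
have e1 := E u v mu mv u0 v0; have e2 := E v u mv mu v0 u0.
rewrite e1 e2; apply: (congr2 adde).
  rewrite (ge0_integral_proposal_sym (mF _ _ mu mv)); last by move=> t; exact: F0.
  apply: eq_integral => x _; apply: eq_integral => z _.
  by rewrite /F /= minC; congr EFin; ring.
apply: eq_integral => x _; apply: eq_integral => z _.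
by rewrite /G/= [u x * _]mulrC.
Qed.

(** Reversibility tested against the constant 1, which one step leaves unchanged. *)
Lemma pcn_invariant (v : H -> R) :
  measurable_fun setT (v : borel H -> R) -> (forall x, 0 <= v x) ->
  (\int[Pi]_x \int[gamma]_z (mix v x z)%:E = \int[Pi]_x (v x)%:E)%E.
Proof.
move=> mv v0; have := @pcn_reversible (cst 1) v (measurable_cst _) mv (fun=> ler01) v0.
under eq_integral do rewrite mul1e.
move=> ->; apply: eq_integral => x _.
under eq_integral do rewrite /pcn_mix /cst !mulr1 addrC subrK.
by rewrite integral_cst_prob mule1.
Qed.

(** The added 1 makes this weight submultiplicative along proposals: at [prop x z] it is at most
    [nrm x * nrm z], which separates the variables. It also makes its powers increasing. *)
Definition nrm (x : borel H) : R := 1 + `|(x : H)|.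

Lemma nrm_ge1 x : 1 <= nrm x.
Proof. by rewrite /nrm lerDl. Qed.

Lemma measurable_nrm : measurable_fun setT nrm.
Proof. by apply: measurable_funD => //; exact: measurable_norm_borel. Qed.

Lemma integrable_le_nrm4 (f : borel H -> R) (c : R) : measurable_fun setT f ->
  (forall x, `|f x| <= c * nrm x ^+ 4) -> gamma.-integrable setT (EFin \o f).
Proof.
move=> mf fc; apply: (le_integrable_real mf fc); apply: integrableZ_real.
apply: (ge0_integrable_real _ _ (lexx _)) => //.
- by apply: measurable_funX; exact: measurable_nrm.
- by move=> x; rewrite exprn_ge0// (le_trans _ (nrm_ge1 x)).
Qed.

Lemma nrm_pow_le (x : borel H) n : (n <= 4)%N -> nrm x ^+ n <= nrm x ^+ 4.
Proof. by move=> n4; apply: ler_weXn2l => //; exact: nrm_ge1. Qed.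

Lemma norm_pcn_proposal (x z : H) : `|prop x z| <= `|x| + `|z|.
Proof.
have /andP[r0 r1] := rho01.
rewrite /pcn_proposal (le_trans (ler_normD _ _))// !normrZ lerD//.
  by rewrite ler_piMl// ger0_norm// ltW.
rewrite ler_piMl// ger0_norm ?sqrtr_ge0// -[leRHS]sqrtr1 ler_wsqrtr//.
by rewrite lerBlDr lerDl sqr_ge0.
Qed.

Lemma linear_growthP (u : H -> R) : linear_growth u ->
  measurable_fun setT (u : borel H -> R) /\
  exists2 C : R, 0 <= C & forall x, `|u x| <= C * nrm x.
Proof.
move=> [mu [C uC]]; split=> //; exists `|C| => // x.
rewrite (le_trans (uC x))// ler_wpM2r ?ler_norm//.
Qed.

Lemma pcn_mix_le (u : H -> R) C : 0 <= C -> (forall x, `|u x| <= C * nrm x) ->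
  forall x z, `|mix u x z| <= C * nrm x * nrm z.
Proof.
move=> C0 uC x z; have a0 := pcn_acc_ge0 x z; have a1 := pcn_acc_le1 x z.
have nx := nrm_ge1 x; have nz := nrm_ge1 z.
have h1 : `|u (prop x z)| <= C * nrm x * nrm z.
  rewrite (le_trans (uC _))// -mulrA ler_wpM2l//.
  have := norm_pcn_proposal x z; have := normr_ge0 x; have := normr_ge0 z.
  by rewrite /nrm; nra.
have h2 : `|u x| <= C * nrm x * nrm z.
  rewrite (le_trans (uC _))// ler_peMr// mulr_ge0//.
  exact: le_trans nx.
rewrite /pcn_mix (le_trans (ler_normD _ _))// !normrM.
have b0 : 0 <= 1 - acc x z by rewrite subr_ge0.
rewrite (ger0_norm a0) (ger0_norm b0).
have -> : C * nrm x * nrm z = acc x z * (C * nrm x * nrm z) + (1 - acc x z) * (C * nrm x * nrm z).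
  by ring.
by rewrite lerD// ler_wpM2l.
Qed.

Lemma integrable_pcn_mix (u : H -> R) : linear_growth u -> forall x,
  gamma.-integrable setT (EFin \o (fun z : borel H => mix u x z)).
Proof.
move=> /linear_growthP[mu [C C0 uC]] x.
apply: (@integrable_le_nrm4 _ (C * nrm x)); first exact: measurable_pcn_mix.
move=> z; rewrite (le_trans (pcn_mix_le C0 uC x z))// ler_wpM2l//.
  by rewrite mulr_ge0// (le_trans _ (nrm_ge1 x)).
by rewrite -[leLHS]expr1 nrm_pow_le.
Qed.

Lemma EFin_pcn_op (u : H -> R) x : linear_growth u ->
  ((K u x)%:E = \int[gamma]_z (mix u x z)%:E)%E.
Proof.
by move=> ug; rewrite EFin_Rintegral//; exact: integrable_pcn_mix.
Qed.

Lemma pcn_op_growth (u : H -> R) : linear_growth u -> linear_growth (K u).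
Proof.
move=> ug; have [mu [C C0 uC]] := linear_growthP ug.
have in1 : gamma.-integrable setT (EFin \o nrm).
  apply: (@integrable_le_nrm4 _ 1); first exact: measurable_nrm.
  move=> x; rewrite mul1r ger0_norm ?(le_trans _ (nrm_ge1 x))//.
  by rewrite -[leLHS]expr1 nrm_pow_le.
pose M := \int[gamma]_z nrm z.
have bd x : `|K u x| <= C * M * nrm x.
  rewrite (le_trans (le_normr_Rintegral _ (integrable_pcn_mix ug x)))//.
  rewrite mulrAC -RintegralZl//; apply: le_Rintegral => //.
  - have /integrable_norm := integrable_pcn_mix ug x; exact.
  - exact: integrableZ_real.
  - by move=> z _; exact: pcn_mix_le.
split; last by exists (C * M).
have mN (x : borel H) : 0 <= C * nrm x by rewrite mulr_ge0// (le_trans _ (nrm_ge1 x)).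
(* Tonelli needs a nonnegative integrand, hence the added dominating function. *)
pose f (t : HH) := mix u t.1 t.2 + C * nrm t.1 * nrm t.2.
have mf : measurable_fun setT f.
  apply: measurable_funD; first exact: measurable_pcn_mix.
  apply: measurable_funM; last exact: (measurableT_comp measurable_nrm).
  by apply: measurable_funM => //; exact: (measurableT_comp measurable_nrm).
have f0 t : 0 <= f t.
  have := pcn_mix_le C0 uC t.1 t.2; rewrite ler_norml => /andP[h _].
  by rewrite /f addrC -lerBlDl sub0r.
have mF : measurable_fun setT (fun x : borel H => \int[gamma]_z (f (x, z))%:E)%E.
  apply: (measurable_fun_fubini_tonelli_F (m2 := gamma) (fun t => (f t)%:E)).
    exact/measurable_EFinP.
  by move=> t; rewrite lee_fin.
have KE x : K u x = fine (\int[gamma]_z (f (x, z))%:E)%E - C * M * nrm x.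
  rewrite -[fine _]/(\int[gamma]_z (mix u x z + C * nrm x * nrm z)).
  rewrite RintegralD//; [|exact: integrable_pcn_mix|exact: integrableZ_real].
  by rewrite RintegralZl// -/M -/(K u x); ring.
rewrite (_ : K u = (fun x => fine (\int[gamma]_z (f (x, z))%:E)%E - C * M * nrm x)).
  apply: measurable_funB; last by apply: measurable_funM => //; exact: measurable_nrm.
  exact: (measurableT_comp (fine_measurable measurableT)).
by apply/funext.
Qed.

Lemma pcn_opB (u : H -> R) (c : R) : linear_growth u -> K (fun x => u x - c) = (fun x => K u x - c).
Proof.
move=> ug; apply/funext => x; rewrite /pcn_op.
rewrite (@eq_Rintegral _ (borel H) _ _ _ (fun z : borel H => mix u x z - c)); last first.
  by move=> z _; rewrite /pcn_mix; ring.
rewrite RintegralB//; [|exact: integrable_pcn_mix|exact: integrable_cst_prob].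
by rewrite Rintegral_cst_prob.
Qed.

Lemma linear_growthB (u : H -> R) (c : R) : linear_growth u -> linear_growth (fun x => u x - c).
Proof.
move=> [mu [C uC]]; split; first by apply: measurable_funB.
exists (C + `|c|) => x; rewrite (le_trans (ler_normB _ _))// mulrDl lerD//.
by rewrite ler_peMr// lerDl.
Qed.

Lemma pcn_op_ge0 (u : H -> R) x : (forall x, 0 <= u x) -> 0 <= K u x.
Proof. by move=> u0; apply: Rintegral_ge0 => z _; exact: pcn_mix_ge0. Qed.

Lemma pcn_op_invariant (u : H -> R) : linear_growth u -> (forall x, 0 <= u x) ->
  (\int[Pi]_x (K u x)%:E = \int[Pi]_x (u x)%:E)%E.
Proof.
move=> ug u0; have [mu _] := ug.
rewrite -[RHS](pcn_invariant mu u0).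
by apply: eq_integral => x _; rewrite EFin_pcn_op.
Qed.

Lemma pcn_op_reversible (u v : H -> R) : linear_growth u -> linear_growth v ->
  (forall x, 0 <= u x) -> (forall x, 0 <= v x) ->
  (\int[Pi]_x (u x * K v x)%:E = \int[Pi]_x (K u x * v x)%:E)%E.
Proof.
move=> ug vg u0 v0.
have E a b x : linear_growth b -> ((a x * K b x)%:E = (a x)%:E * \int[gamma]_z (mix b x z)%:E)%E.
  by move=> bg; rewrite EFinM EFin_pcn_op.
under eq_integral do rewrite E//.
under [RHS]eq_integral do rewrite mulrC E//.
apply: pcn_reversible => //.
  by case: ug.
by case: vg.
Qed.

(** Jensen's inequality for the fourth power, over the acceptance and then over the Gaussian
    variable, followed by invariance. For the two-point mixture it is the inequality for squares
    applied twice. *)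
Lemma pcn_op_pow4 (v : H -> R) : linear_growth v ->
  (\int[Pi]_x ((K v x) ^+ 4)%:E <= \int[Pi]_x ((v x) ^+ 4)%:E)%E.
Proof.
move=> vg; have [mv _] := vg; have [mKv _] := pcn_op_growth vg.
have p0 (y : R) : 0 <= y ^+ 4 by rewrite exprn_even_ge0.
have mv4 : measurable_fun setT (fun x : borel H => v x ^+ 4) by exact: measurable_funX.
rewrite -(pcn_invariant mv4 (fun x => p0 (v x))).
apply: ge0_le_integral => //.
- by move=> x _; rewrite lee_fin.
- by apply/measurable_EFinP; exact: measurable_funX.
- exact: measurable_pcn_opE.
- move=> x _; apply: jensen_pow4.
  + exact: integrable_pcn_mix.
  + exact: measurable_pcn_mix.
  + by move=> z; exact: pcn_mix_ge0.
  + move=> z; rewrite /pcn_mix.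
    have a0 := pcn_acc_ge0 x z; have a1 := pcn_acc_le1 x z.
    move: a0 a1; set a := acc x z; set b := v _; set c := v x => a0 a1.
    have sq (s t : R) : (a * s + (1 - a) * t) ^+ 2 <= a * s ^+ 2 + (1 - a) * t ^+ 2.
      rewrite -subr_ge0 (_ : _ - _ = a * (1 - a) * (s - t) ^+ 2); last by ring.
      by rewrite mulr_ge0 ?sqr_ge0// mulr_ge0// subr_ge0.
    have p4 (y : R) : y ^+ 4 = (y ^+ 2) ^+ 2 by rewrite -exprM.
    rewrite !p4; apply: le_trans (sq (b ^+ 2) (c ^+ 2)).
    have := sq b c; have := sqr_ge0 (a * b + (1 - a) * c).
    move=> s0 st; rewrite lerXn2r// nnegrE; exact: le_trans st.
Qed.

(* The variance of [v] after one step from [x], bounded below by the part of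
   it that comes from two accepted moves. *)
Lemma pcn_op_variance (v : H -> R) : linear_growth v ->
  (\int[Pi]_x (2 * (K v x) ^+ 2)%:E +
   \int[Pi]_x \int[gamma]_z \int[gamma]_y
     (acc x z * acc x y * (v (prop x z) - v (prop x y)) ^+ 2)%:E <=
   \int[Pi]_x (2 * (v x) ^+ 2)%:E)%E.
Proof.
move=> vg; have [mv [C C0 vC]] := linear_growthP vg; have [mKv _] := pcn_op_growth vg.
have mv2 : measurable_fun setT (fun x : borel H => 2 * v x ^+ 2).
  by apply: measurable_funM => //; exact: measurable_funX.
have v20 x : 0 <= 2 * v x ^+ 2 by rewrite mulr_ge0// sqr_ge0.
pose Phi (t : borel H * borel H * borel H) : R :=
  acc t.1.1 t.1.2 * acc t.1.1 t.2 * (v (prop t.1.1 t.1.2) - v (prop t.1.1 t.2)) ^+ 2.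
have Phi0 t : 0 <= Phi t by rewrite /Phi mulr_ge0 ?sqr_ge0// mulr_ge0 ?pcn_acc_ge0.
have m11 : measurable_fun setT (fun t : borel H * borel H * borel H => t.1.1).
  exact: (measurableT_comp measurable_fst).
have m12 : measurable_fun setT (fun t : borel H * borel H * borel H => t.1.2).
  exact: (measurableT_comp measurable_snd).
have mPhi : measurable_fun setT Phi.
  apply: measurable_funM.
    by apply: measurable_funM; exact: measurable_pcn_acc.
  apply: measurable_funX; apply: measurable_funB;
    by apply: (measurableT_comp mv); exact: mprop.
have mPhiz : measurable_fun setT (fun t : HH => \int[gamma]_y (Phi (t, y))%:E)%E.
  apply: (measurable_fun_fubini_tonelli_F (m2 := gamma) (fun t => (Phi t)%:E)).
    exact/measurable_EFinP.
  by move=> t; rewrite lee_fin.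
have Phiz0 t : (0 <= \int[gamma]_y (Phi (t, y))%:E)%E.
  by apply: integral_ge0 => y _; rewrite lee_fin.
have mPhix : measurable_fun setT (fun x => \int[gamma]_z \int[gamma]_y (Phi ((x, z), y))%:E)%E.
  exact: (measurable_fun_fubini_tonelli_F (m2 := gamma)
    (fun t : HH => \int[gamma]_y (Phi (t, y))%:E)%E).
rewrite -(pcn_invariant mv2 v20).
rewrite -ge0_integralD//; last 3 first.
- by move=> x _; rewrite lee_fin mulr_ge0// sqr_ge0.
- by apply/measurable_EFinP; apply: measurable_funM => //; exact: measurable_funX.
- by move=> x _; apply: integral_ge0 => z _; exact: (Phiz0 (x, z)).
apply: ge0_le_integral => //.
- move=> x _; apply: adde_ge0; first by rewrite lee_fin mulr_ge0// sqr_ge0.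
  by apply: integral_ge0 => z _; exact: (Phiz0 (x, z)).
- apply: emeasurable_funD => //.
  by apply/measurable_EFinP; apply: measurable_funM => //; exact: measurable_funX.
- exact: measurable_pcn_opE.
move=> x _.
have mmx u : measurable_fun setT (u : borel H -> R) ->
    measurable_fun setT (fun z : borel H => mix u x z).
  by move=> mu; exact: measurable_pcn_mix.
have iA : gamma.-integrable setT (EFin \o (fun z : borel H => mix (fun x => v x ^+ 2) x z)).
  apply: (@integrable_le_nrm4 _ (C ^+ 2 * nrm x ^+ 2)).
    by apply: mmx; exact: measurable_funX.
  move=> z.
  have a0 := pcn_acc_ge0 x z; have a1 := pcn_acc_le1 x z.
  have nx := nrm_ge1 x; have nz := nrm_ge1 z.
  have pz : nrm (prop x z) <= nrm x * nrm z.
    have := norm_pcn_proposal x z; have := normr_ge0 (x : H); have := normr_ge0 (z : H).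
    by rewrite /nrm; nra.
  have h (y : H) : nrm y <= nrm x * nrm z -> v y ^+ 2 <= C ^+ 2 * nrm x ^+ 2 * nrm z ^+ 2.
    move=> ny; have le1 : `|v y| <= C * nrm x * nrm z.
      by rewrite (le_trans (vC y))// -mulrA ler_wpM2l.
    by rewrite -!exprMn -(real_normK (num_real (v y))) !expr2 ler_pM.
  have h1 := h _ pz.
  have h2 : v x ^+ 2 <= C ^+ 2 * nrm x ^+ 2 * nrm z ^+ 2.
    by apply: h; rewrite ler_peMr// (le_trans _ nx).
  apply: (@le_trans _ _ (C ^+ 2 * nrm x ^+ 2 * nrm z ^+ 2)); last first.
    apply: ler_wpM2l; last exact: nrm_pow_le.
    by rewrite -exprMn sqr_ge0.
  rewrite ger0_norm; last by apply: pcn_mix_ge0 => y; exact: sqr_ge0.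
  rewrite /pcn_mix; move: a0 a1 h1 h2; set a := acc x z.
  set b := v _ ^+ 2; set c := v x ^+ 2; set D := _ * _; nra.
have iB := integrable_pcn_mix vg x.
have main : (\int[gamma]_z \int[gamma]_y (Phi ((x, z), y))%:E <=
    (2 * \int[gamma]_z mix (fun x => v x ^+ 2) x (z : H) -
     2 * (\int[gamma]_z mix v x (z : H)) ^+ 2)%:E)%E.
  apply: (@double_integral_le _ _ _ gamma _ _ (fun t => Phi ((x, t.1), t.2))) => //.
    apply: (measurableT_comp mPhi); apply: measurable_fun_pair => //.
    exact: measurable_fun_pair.
  move=> z y; rewrite /Phi/= /pcn_mix.
  have a0 := pcn_acc_ge0 x z; have a1 := pcn_acc_le1 x z.
  have b0 := pcn_acc_ge0 x y; have b1 := pcn_acc_le1 x y.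
  move: a0 a1 b0 b1; set a := acc x z; set b := acc x y.
  set p := v (prop x z); set q := v (prop x y); set c := v x => a0 a1 b0 b1.
  (* The discarded terms come from pairs with exactly one accepted move; two rejections leave equal
     values and contribute nothing. *)
  rewrite -subr_ge0 (_ : _ - _ = a * (1 - b) * (p - c) ^+ 2 + (1 - a) * b * (q - c) ^+ 2); last by ring.
  by rewrite addr_ge0// mulr_ge0 ?sqr_ge0// mulr_ge0// subr_ge0.
have -> : (\int[gamma]_z (mix (fun x => 2 * v x ^+ 2) x z)%:E =
    (2 * \int[gamma]_z mix (fun x => v x ^+ 2) x (z : H))%:E)%E.
  rewrite -(RintegralZl _ measurableT iA) -(EFin_Rintegral (integrableZ_real 2 iA)).
  by apply: eq_integral => z _; rewrite /pcn_mix; congr EFin; ring.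
apply: (le_trans (leeD2l _ main)).
by rewrite -EFinD lee_fin /pcn_op addrC subrK.
Qed.

Lemma linear_growth_iter (u : H -> R) n : linear_growth u -> linear_growth (iter n K u).
Proof. by move=> ug; elim: n => //= n; exact: pcn_op_growth. Qed.

Lemma iter_pcn_op_ge0 (u : H -> R) n x : (forall x, 0 <= u x) -> 0 <= iter n K u x.
Proof. by move=> u0; elim: n x => //= n IH x; exact: pcn_op_ge0. Qed.

Lemma iter_pcn_op_invariant (u : H -> R) n : linear_growth u -> (forall x, 0 <= u x) ->
  (\int[Pi]_x (iter n K u x)%:E = \int[Pi]_x (u x)%:E)%E.
Proof.
move=> ug u0; elim: n => //= n <-; apply: pcn_op_invariant.
  exact: linear_growth_iter.
by move=> x; exact: iter_pcn_op_ge0.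
Qed.

Lemma iter_pcn_op_reversible (u v : H -> R) n : linear_growth u -> linear_growth v ->
  (forall x, 0 <= u x) -> (forall x, 0 <= v x) ->
  (\int[Pi]_x (u x * iter n K v x)%:E = \int[Pi]_x (iter n K u x * v x)%:E)%E.
Proof.
elim: n u => //= n IH u ug vg u0 v0.
rewrite pcn_op_reversible//; last 2 first.
- exact: linear_growth_iter.
- by move=> x; exact: iter_pcn_op_ge0.
rewrite IH//; last 2 first.
- exact: pcn_op_growth.
- by move=> x; exact: pcn_op_ge0.
by apply: eq_integral => x _; rewrite -iterSr.
Qed.

End pcn_operator_theory.

Lemma ge0_integralD_real d (T : measurableType d) (R : realType)
    (mu : {measure set T -> \bar R}) (f h : T -> R) :
  measurable_fun setT f -> measurable_fun setT h ->
  (forall x, 0 <= f x) -> (forall x, 0 <= h x) ->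
  (\int[mu]_x (f x + h x)%:E = \int[mu]_x (f x)%:E + \int[mu]_x (h x)%:E)%E.
Proof.
move=> mf mh f0 h0; under eq_integral do rewrite EFinD.
by apply: ge0_integralD => //;
  try (by move=> x _; rewrite lee_fin); exact/measurable_EFinP.
Qed.

(** * Contraction of the variance in one step *)

Section one_step.
Context (R : realType) (H : completeNormedModType R).
Variable dot : {dot H for idfun}.
Hypotheses (hdot : norm_from_dot dot) (hsep : separable H).
Variable gamma : probability (borel H) R.
Local Notation HH := (borel H * borel H)%type.
Local Notation HHH := (HH * borel H)%type.
Local Notation gg := (product_prob gamma gamma).
Local Notation ggg := (product_prob gg gamma).
Hypothesis grot : forall (a b : R) (A : set HH), a ^+ 2 + b ^+ 2 = 1 ->
  measurable A -> gg (rotation a b @^-1` A) = gg A.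
Hypothesis moment4 : (\int[gamma]_x ((1 + `|(x : H)|) ^+ 4)%:E < +oo)%E.
Variables (rho : R) (g : H -> R).
Hypothesis rho01 : 0 <= rho < 1.
Hypothesis mg : measurable_fun setT (g : borel H -> R).
Variables (k : R) (Pi : probability (borel H) R).
Hypothesis k0 : 0 < k.
Local Notation w := (pcn_weight k g).
Hypothesis hPi : forall A : set (borel H), measurable A ->
  (Pi A = \int[gamma]_(x in A) (w x)%:E)%E.

Local Notation prop := (pcn_proposal rho).
Local Notation acc := (pcn_acc rho g).
Local Notation K := (pcn_op gamma rho g).
Local Notation mprop := (measurable_pcn_proposal hdot hsep).

Let m11 : measurable_fun setT (fun t : HHH => t.1.1).
Proof. exact: (measurableT_comp measurable_fst). Qed.
Let m12 : measurable_fun setT (fun t : HHH => t.1.2).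
Proof. exact: (measurableT_comp measurable_snd). Qed.
Let m2 : measurable_fun setT (fun t : HHH => t.2).
Proof. exact: measurable_snd. Qed.

Lemma integral_proposal (r : borel H -> \bar R) : measurable_fun setT r ->
  (forall x, 0 <= r x)%E ->
  (\int[gamma]_x \int[gamma]_z r (prop x z) = \int[gamma]_x r x)%E.
Proof.
move=> mr r0.
have e1 : rho ^+ 2 + Num.sqrt (1 - rho ^+ 2) ^+ 2 = 1 ^+ 2.
  by rewrite (rhoq rho01) expr1n.
rewrite [LHS](ge0_integral_stable hdot hsep grot e1 mr r0).
by apply: eq_integral => x _; rewrite scale1r.
Qed.

Definition accepted_energy (v : H -> R) : \bar R :=
  (\int[Pi]_x \int[gamma]_z \int[gamma]_y
     (acc x z * acc x y * (v (prop x z) - v (prop x y)) ^+ 2)%:E)%E.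

(** If the state and both proposals lie in [B], the increment of the truncated function is that of
    [v], and [hB] dominates it by the accepted energy. Otherwise one of the three points is outside
    [B], and each of the two squares is bounded by [2 h^2 <= e h^4 + 1 / e]. All three points have
    law [gamma]: two of them carry [m e h^4], and each carries [2 m / e] on the complement of [B],
    whence the constants 2 and 6. *)
Lemma fork_energy_le_accepted (v : H -> R) (B : set (borel H)) (m e : R) :
  measurable_fun setT (v : borel H -> R) -> measurable B -> 0 <= m -> 0 < e ->
  (forall x z y, B x -> B (prop x z) -> B (prop x y) ->
    m <= w x * (acc x z * acc x y)) ->
  (m%:E * fork_energy gamma (fun x => v x * \1_B x)%R rho <=
   accepted_energy v + (2 * m * e)%:E * \int[gamma]_x ((v x * \1_B x) ^+ 4)%:E
     + (6 * m / e)%:E * gamma (~` B))%E.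
Proof.
move=> mv mB m0 e0 hB.
pose h (x : borel H) := v x * \1_B x.
have mh : measurable_fun setT h by apply: measurable_funM => //; exact: measurable_indic.
pose b (x : borel H) : R := \1_(~` B) x.
have mb : measurable_fun setT b by apply: measurable_indic; exact: measurableC.
have b0 x : 0 <= b x by rewrite /b indicE.
pose q (x : borel H) := m * e * h x ^+ 4 + (2 * m / e) * b x.
have h4 x : 0 <= h x ^+ 4 by rewrite exprn_even_ge0.
have me0 : 0 <= m * e by rewrite mulr_ge0// ltW.
have me1 : 0 <= 2 * m / e by rewrite divr_ge0 ?mulr_ge0// ltW.
have q0 x : 0 <= q x.
  by rewrite /q; apply: addr_ge0; [exact: mulr_ge0 | exact: mulr_ge0].
have mq : measurable_fun setT q.
  apply: measurable_funD; apply: measurable_funM => //.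
  exact: measurable_funX.
pose P (t : HHH) := acc t.1.1 t.1.2 * acc t.1.1 t.2 *
  (v (prop t.1.1 t.1.2) - v (prop t.1.1 t.2)) ^+ 2.
have P0 t : 0 <= P t.
  by rewrite /P; apply: mulr_ge0; rewrite ?sqr_ge0// mulr_ge0// pcn_acc_ge0.
have mp1 : measurable_fun setT (fun t : HHH => prop t.1.1 t.1.2 : borel H) by exact: mprop.
have mp2 : measurable_fun setT (fun t : HHH => prop t.1.1 t.2 : borel H) by exact: mprop.
have mP : measurable_fun setT P.
  apply: measurable_funM.
    by apply: measurable_funM; exact: (measurable_pcn_acc hdot hsep).
  apply: measurable_funX; apply: measurable_funB.
    exact: (measurableT_comp mv mp1).
  exact: (measurableT_comp mv mp2).
have w0 x : 0 <= w x by exact: pcn_weight_ge0.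
have mw : measurable_fun setT (fun t : HHH => w t.1.1).
  by apply: (@measurableT_comp _ _ _ _ _ _ (w : borel H -> R)) => //; exact: measurable_pcn_weight.
have pw x z y : m * (h (prop x z) - h (prop x y)) ^+ 2 <=
    w x * P ((x, z), y) + q (prop x z) + q (prop x y) + 2 * m / e * b x.
  have sq c : 2 * c ^+ 2 <= e * c ^+ 4 + e^-1.
    rewrite -subr_ge0 (_ : _ - _ = e^-1 * (e * c ^+ 2 - 1) ^+ 2); last by field; lra.
    by rewrite mulr_ge0 ?sqr_ge0// invr_ge0 ltW.
  have [[Bx [Bp Bq]]|nB] := pselect (B x /\ B (prop x z) /\ B (prop x y)).
    rewrite -!addrA ler_wpDr//.
      by rewrite !addr_ge0// mulr_ge0.
    rewrite /P /h !indicE !mem_set//= !mulr1 mulrA; apply: ler_wpM2r; first exact: sqr_ge0.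
    exact: hB.
  have b1 : 1 <= b x + b (prop x z) + b (prop x y).
    move: nB; rewrite /b !indicE; case: (boolP (x \in ~` B)) => [_ _|].
      by rewrite -addrA ler_wpDr.
    rewrite notin_setE/= => /contrapT Bx; case: (boolP (prop x z \in ~` B)) => [_ _|].
      by rewrite add0r ler_wpDr.
    rewrite notin_setE/= => /contrapT Bp; case: (boolP (prop x y \in ~` B)) => [_ _|].
      by rewrite !add0r.
    by rewrite notin_setE/= => /contrapT Bq nB; exfalso; exact: nB.
  have hh : (h (prop x z) - h (prop x y)) ^+ 2 <= 2 * h (prop x z) ^+ 2 + 2 * h (prop x y) ^+ 2.
    set s := h _; set t := h (prop x y).
    by rewrite -subr_ge0 (_ : _ - _ = (s + t) ^+ 2) ?sqr_ge0//; ring.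
  have h1 := sq (h (prop x z)); have h2 := sq (h (prop x y)).
  have : m * (h (prop x z) - h (prop x y)) ^+ 2 <=
      m * (e * h (prop x z) ^+ 4 + e^-1 + (e * h (prop x y) ^+ 4 + e^-1)).
    by apply: ler_wpM2l => //; apply: (le_trans hh); exact: lerD.
  move=> /le_trans; apply; rewrite /q.
  have h3 : 2 * m / e * 1 <= 2 * m / e * (b x + b (prop x z) + b (prop x y)) by exact: ler_wpM2l.
  have h5 : 0 <= w x * P (x, z, y) by exact: mulr_ge0.
  rewrite -subr_ge0 (_ : _ - _ = w x * P (x, z, y) + (2 * m / e * (b x + b (prop x z) + b (prop x y)) -  2 * m / e * 1)).
    by rewrite addr_ge0// subr_ge0.
  by ring.
have bint : (\int[gamma]_x (b x)%:E = gamma (~` B))%E.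
  by rewrite integral_indic ?setIT//; exact: measurableC.
have bq : (\int[gamma]_x (q x)%:E = (m * e)%:E * \int[gamma]_x (h x ^+ 4)%:E +
    (2 * m / e)%:E * gamma (~` B))%E.
  have mh4 : measurable_fun setT (fun x => (h x ^+ 4)%:E).
    by apply/measurable_EFinP; exact: measurable_funX.
  have mbE : measurable_fun setT (fun x => (b x)%:E) by exact/measurable_EFinP.
  have h4E x : setT x -> (0 <= (h x ^+ 4)%:E)%E by rewrite lee_fin.
  have bE x : setT x -> (0 <= (b x)%:E)%E by rewrite lee_fin.
  rewrite -bint -(ge0_integralZl_EFin _ measurableT h4E mh4 me0).
  rewrite -(ge0_integralZl_EFin _ measurableT bE mbE me1).
  rewrite -ge0_integralD//.
  - by move=> x _; rewrite -EFinM lee_fin mulr_ge0.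
  - by apply/measurable_EFinP; apply: measurable_funM => //; exact: measurable_funX.
  - by move=> x _; rewrite -EFinM lee_fin mulr_ge0.
  - by apply/measurable_EFinP; apply: measurable_funM.
have mhd : measurable_fun setT (fun t : HHH => (h (prop t.1.1 t.1.2) - h (prop t.1.1 t.2)) ^+ 2).
  apply: measurable_funX; apply: measurable_funB.
    exact: (measurableT_comp mh mp1).
  exact: (measurableT_comp mh mp2).
have forkE : fork_energy gamma h rho =
    (\int[ggg]_t ((h (prop t.1.1 t.1.2) - h (prop t.1.1 t.2)) ^+ 2)%:E)%E.
  rewrite integral3E//; first exact/measurable_EFinP.
  by move=> t; rewrite lee_fin sqr_ge0.
rewrite -/h forkE -ge0_integralZl//; last 2 first.
- exact/measurable_EFinP.
- by move=> t _; rewrite lee_fin sqr_ge0.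
pose G1 (t : HHH) := w t.1.1 * P t.
pose G2 (t : HHH) := q (prop t.1.1 t.1.2).
pose G3 (t : HHH) := q (prop t.1.1 t.2).
pose G4 (t : HHH) := 2 * m / e * b t.1.1.
have mG1 : measurable_fun setT G1 by exact: measurable_funM.
have mG2 : measurable_fun setT G2 by exact: (measurableT_comp mq mp1).
have mG3 : measurable_fun setT G3 by exact: (measurableT_comp mq mp2).
have mG4 : measurable_fun setT G4.
  by apply: measurable_funM => //; exact: (measurableT_comp mb m11).
have G10 t : 0 <= G1 t by exact: mulr_ge0.
have G20 t : 0 <= G2 t by exact: q0.
have G30 t : 0 <= G3 t by exact: q0.
have G40 t : 0 <= G4 t by exact: mulr_ge0.
apply: (@le_trans _ _ (\int[ggg]_t (G1 t + G2 t + G3 t + G4 t)%:E)%E).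
  apply: ge0_le_integral => //.
  - by move=> t _; rewrite -EFinM lee_fin mulr_ge0// sqr_ge0.
  - by apply/measurable_EFinP; apply: measurable_funM.
  - apply/measurable_EFinP; apply: measurable_funD mG4; apply: measurable_funD mG3; exact: measurable_funD.
  - by move=> [[x z] y] _; rewrite -EFinM lee_fin; exact: pw.
have p0 (f : HHH -> R) : (forall t, 0 <= f t) -> forall t, setT t -> (0%R <= (f t)%:E)%E.
  by move=> f0 t _; rewrite lee_fin.
have mE (f : HHH -> R) : measurable_fun setT f -> measurable_fun setT (fun t => (f t)%:E).
  by move=> mf; exact/measurable_EFinP.
have G12 t : 0 <= G1 t + G2 t by exact: addr_ge0.
have G123 t : 0 <= G1 t + G2 t + G3 t by exact: addr_ge0.
have mG12 : measurable_fun setT (fun t => G1 t + G2 t) by exact: measurable_funD.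
have mG123 : measurable_fun setT (fun t => G1 t + G2 t + G3 t) by exact: measurable_funD.
rewrite (ge0_integralD_real _ mG123 mG4 G123 G40) (ge0_integralD_real _ mG12 mG3 G12 G30).
rewrite (ge0_integralD_real _ mG1 mG2 G10 G20).
have qE x : (0 <= (q x)%:E)%E by rewrite lee_fin.
have mqE : measurable_fun setT (fun x => (q x)%:E) by exact/measurable_EFinP.
have I2 : (\int[ggg]_t (G2 t)%:E = \int[gamma]_x (q x)%:E)%E.
  rewrite integral3E; [|exact: mE|by move=> t; rewrite lee_fin].
  rewrite -[RHS](integral_proposal mqE qE).
  by apply: eq_integral => x _; apply: eq_integral => z _; rewrite -[RHS](integral_cst_prob gamma).
have I3 : (\int[ggg]_t (G3 t)%:E = \int[gamma]_x (q x)%:E)%E.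
  rewrite integral3E; [|exact: mE|by move=> t; rewrite lee_fin].
  rewrite -[RHS](integral_proposal mqE qE).
  by apply: eq_integral => x _; rewrite -[RHS](integral_cst_prob gamma).
have I4 : (\int[ggg]_t (G4 t)%:E = (2 * m / e)%:E * gamma (~` B))%E.
  rewrite integral3E; [|exact: mE|by move=> t; rewrite lee_fin].
  have mbE : measurable_fun setT (fun x => (b x)%:E) by exact/measurable_EFinP.
  have bE x : setT x -> (0 <= (b x)%:E)%E by rewrite lee_fin.
  rewrite -bint -(ge0_integralZl_EFin _ measurableT bE mbE me1).
  apply: eq_integral => x _; rewrite -EFinM -[RHS](integral_cst_prob gamma).
    by apply: eq_integral => z _; rewrite -[RHS](integral_cst_prob gamma).
have I1 : (\int[ggg]_t (G1 t)%:E = accepted_energy v)%E.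
  have mPE : measurable_fun setT (fun t => (P t)%:E) by exact/measurable_EFinP.
  have PE t : (0 <= (P t)%:E)%E by rewrite lee_fin.
  have mP1 : measurable_fun setT (fun t : HH => \int[gamma]_y (P (t, y))%:E)%E.
    exact: (measurable_fun_fubini_tonelli_F (m2 := gamma) (fun t => (P t)%:E)).
  have P10 t : (0 <= \int[gamma]_y (P (t, y))%:E)%E by exact: integral_ge0.
  have mP2 : measurable_fun setT (fun x => \int[gamma]_z \int[gamma]_y (P ((x, z), y))%:E)%E.
    exact: (measurable_fun_fubini_tonelli_F (m2 := gamma)
      (fun t : HH => \int[gamma]_y (P (t, y))%:E)%E).
  have P20 x : (0 <= \int[gamma]_z \int[gamma]_y (P ((x, z), y))%:E)%E by exact: integral_ge0.
  rewrite integral3E; [|exact: mE|by move=> t; rewrite lee_fin].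
  rewrite /accepted_energy (ge0_integral_target mg k0 hPi mP2 P20).
  apply: eq_integral => x _; rewrite muleC -ge0_integralZl_EFin//; last first.
    exact: (measurableT_comp mP1 (measurable_pair1 x)).
  apply: eq_integral => z _; rewrite -ge0_integralZl_EFin//.
  exact: (measurableT_comp mPE (measurable_pair1 (x, z))).
rewrite I1 I2 I3 I4 bq.
set A := (\int[gamma]_x _)%E; set T := gamma _; set E := accepted_energy v.
have A0 : (0 <= A)%E by apply: integral_ge0 => x _; rewrite lee_fin.
have T0 : (0 <= T)%E by exact: measure_ge0.
have -> : (2 * m * e)%:E = ((m * e)%:E + (m * e)%:E)%E by rewrite -EFinD; congr EFin; ring.
have -> : (6 * m / e)%:E = ((2 * m / e)%:E + (2 * m / e)%:E + (2 * m / e)%:E)%E.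
  by rewrite -!EFinD; congr EFin; ring.
rewrite !ge0_muleDl ?adde_ge0 ?lee_fin//.
set a := ((m * e)%:E * A)%E; set c := ((2 * m / e)%:E * T)%E.
by move: E a c => E a c; rewrite -!addeA leeD2l// leeD2l// addeCA.
Qed.


Variable K0 : R.
Hypothesis wK : forall x, w x <= K0.

Lemma target_integral_le (u : borel H -> R) : measurable_fun setT u ->
  (forall x, 0 <= u x) ->
  (\int[Pi]_x (u x)%:E <= K0%:E * \int[gamma]_x (u x)%:E)%E.
Proof.
move=> mu u0.
have muE : measurable_fun setT (fun x => (u x)%:E) by exact/measurable_EFinP.
have uE x : (0 <= (u x)%:E)%E by rewrite lee_fin.
have K00 : 0 <= K0 by apply: le_trans (wK point); exact: pcn_weight_ge0.
rewrite (ge0_integral_target mg k0 hPi muE uE).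
rewrite -(ge0_integralZl_EFin _ measurableT (fun x _ => uE x) muE K00).
apply: ge0_le_integral => //.
- by move=> x _; rewrite mule_ge0// lee_fin; exact: pcn_weight_ge0.
- apply/emeasurable_funM => //; apply/measurable_EFinP; exact: measurable_pcn_weight.
- by apply/emeasurable_funM.
- by move=> x _; rewrite muleC; apply: lee_wpmul2r => //; rewrite lee_fin.
Qed.

Lemma target_moment4 : (\int[Pi]_x ((1 + `|(x : H)|) ^+ 4)%:E < +oo)%E.
Proof.
have K00 : 0 <= K0 by apply: le_trans (wK point); exact: pcn_weight_ge0.
apply: le_lt_trans (target_integral_le _ _) _.
- by apply: measurable_funX; exact: measurable_nrm.
- by move=> x; rewrite exprn_ge0// addr_ge0.
- by rewrite lte_mul_pinfty.
Qed.

(** Since [v] has mean 0 under [Pi], recentering it at any constant increases its second moment. The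
    constant [c] is the mean of the truncated [h] under [gamma]: after the density of [Pi] is
    bounded by [K0], this leaves the variance of [h] under [gamma], which the double integral
    dominates by Jensen's inequality. Outside [B], where [h] vanishes,
    [(v - c)^2 <= 2 v^2 + 2 c^2]. *)
Lemma variance_le_truncated (v : H -> R) (B : set (borel H)) (e : R) :
  linear_growth v -> \int[Pi]_x v x = 0 -> measurable B -> 0 < e ->
  ((\int[Pi]_x (v x ^+ 2)%R)%:E <=
   (2 * K0)%:E * \int[gamma]_x \int[gamma]_y
     sqdist (fun x => v x * \1_B x)%R x y
   + (e * \int[Pi]_x (v x ^+ 4)%R)%:E + (K0 / e)%:E * gamma (~` B))%E.
Proof.
move=> vg v0 mB e0; have [mv [C C0 vC]] := linear_growthP vg.
have K00 : 0 <= K0 by apply: le_trans (wK point); exact: pcn_weight_ge0.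
pose h (x : borel H) := v x * \1_B x.
have mh : measurable_fun setT h by apply: measurable_funM => //; exact: measurable_indic.
pose b (x : borel H) : R := \1_(~` B) x.
have mb : measurable_fun setT b by apply: measurable_indic; exact: measurableC.
have b0 x : 0 <= b x by rewrite /b indicE.
have n1 (x : borel H) : 0 <= nrm x by rewrite (le_trans _ (nrm_ge1 x)).
have hv x : `|h x| <= `|v x|.
  by rewrite /h normrM ler_piMr// indicE; case: (_ \in _); rewrite ?normr1 ?normr0.
have hC x : `|h x| <= C * nrm x by exact: le_trans (vC x).
have sqC (u : borel H -> R) : (forall x, `|u x| <= C * nrm x) ->
    forall x, `|u x ^+ 2| <= C ^+ 2 * nrm x ^+ 4.
  move=> uC x; rewrite normrX; apply: (@le_trans _ _ ((C * nrm x) ^+ 2)).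
    by rewrite lerXn2r// nnegrE ?mulr_ge0.
  by rewrite exprMn ler_wpM2l ?sqr_ge0// nrm_pow_le.
have leC (u : borel H -> R) : (forall x, `|u x| <= C * nrm x) ->
    forall x, `|u x| <= C * nrm x ^+ 4.
  move=> uC x; rewrite (le_trans (uC x))// ler_wpM2l//.
  by rewrite -[leLHS]expr1 nrm_pow_le.
have ih : gamma.-integrable setT (EFin \o h).
  exact: (integrable_le_nrm4 moment4 mh (leC _ hC)).
have ih2 : gamma.-integrable setT (EFin \o (fun x => h x ^+ 2)).
  by apply: (integrable_le_nrm4 moment4 _ (sqC _ hC)); exact: measurable_funX.
have iv : Pi.-integrable setT (EFin \o (v : borel H -> R)).
  exact: (integrable_le_nrm4 target_moment4 mv (leC _ vC)).
have iv2 : Pi.-integrable setT (EFin \o (fun x : borel H => v x ^+ 2)).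
  by apply: (integrable_le_nrm4 target_moment4 _ (sqC _ vC)); exact: measurable_funX.
have iv4 : Pi.-integrable setT (EFin \o (fun x : borel H => v x ^+ 4)).
  apply: (@integrable_le_nrm4 _ _ _ target_moment4 _ (C ^+ 4)); first exact: measurable_funX.
  by move=> x; rewrite normrX -exprMn lerXn2r// nnegrE ?mulr_ge0.
set c := \int[gamma]_x h x.
have step1 : ((\int[Pi]_x (v x ^+ 2))%:E <= \int[Pi]_x ((v x - c) ^+ 2)%:E)%E.
  have ivc := integrableZ_real (2 * c) iv.
  have i1 := integrableB_real iv2 ivc.
  have -> : (\int[Pi]_x ((v x - c) ^+ 2)%:E =
      \int[Pi]_x (v x ^+ 2 - 2 * c * v x + c ^+ 2)%:E)%E.
    by apply: eq_integral => x _; congr EFin; ring.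
  rewrite (EFin_Rintegral (integrableD_real i1 (integrable_cst_prob Pi (c ^+ 2)))).
  rewrite lee_fin RintegralD//; last exact: integrable_cst_prob.
  rewrite RintegralB// RintegralZl// v0 mulr0 subr0 Rintegral_cst_prob.
  by rewrite lerDl sqr_ge0.
apply: (le_trans step1).
have mhc : measurable_fun setT (fun x => 2 * (h x - c) ^+ 2).
  by apply: measurable_funM => //; apply: measurable_funX; exact: measurable_funB.
have mv4 : measurable_fun setT (fun x : borel H => e * v x ^+ 4).
  by apply: measurable_funM => //; exact: measurable_funX.
have mbe : measurable_fun setT (fun x => e^-1 * b x) by exact: measurable_funM.
have v40 x : 0 <= v x ^+ 4 by rewrite exprn_even_ge0.
have hc0 x : 0 <= 2 * (h x - c) ^+ 2 by rewrite mulr_ge0// sqr_ge0.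
have ev0 x : 0 <= e * v x ^+ 4 by rewrite mulr_ge0// ltW.
have be0 x : 0 <= e^-1 * b x by rewrite mulr_ge0// invr_ge0 ltW.
have step2 : (\int[Pi]_x ((v x - c) ^+ 2)%:E <=
   \int[Pi]_x (2 * (h x - c) ^+ 2 + e * v x ^+ 4 + e^-1 * b x)%:E)%E.
  apply: ge0_le_integral => //.
  - by move=> x _; rewrite lee_fin sqr_ge0.
  - by apply/measurable_EFinP; apply: measurable_funX; exact: measurable_funB.
  - apply/measurable_EFinP; apply: measurable_funD mbe; exact: measurable_funD.
  - move=> x _; rewrite lee_fin /h /b !indicE in_setC; case: (_ \in _).
      rewrite !mulr1 mulr0 addr0 ler_wpDr// mulr_natl mulr2n lerDl.
      exact: sqr_ge0.
    rewrite !mulr0 mulr1 sub0r.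
    have sq : 2 * v x ^+ 2 <= e * v x ^+ 4 + e^-1.
      rewrite -subr_ge0 (_ : _ - _ = e^-1 * (e * v x ^+ 2 - 1) ^+ 2); last by field; lra.
      by rewrite mulr_ge0 ?sqr_ge0// invr_ge0 ltW.
    rewrite -addrA; apply: le_trans (lerD (lexx _) sq).
    rewrite -subr_ge0 (_ : _ - _ = (v x + c) ^+ 2) ?sqr_ge0//.
    by ring.
apply: (le_trans step2).
rewrite (ge0_integralD_real _ _ mbe _ be0); [|exact: measurable_funD|by move=> x; rewrite addr_ge0].
rewrite (ge0_integralD_real _ mhc mv4 hc0 ev0).
rewrite -(RintegralZl _ measurableT iv4) -(EFin_Rintegral (integrableZ_real e iv4)).
have s3 : (\int[Pi]_x (e^-1 * b x)%:E <= (K0 / e)%:E * gamma (~` B))%E.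
  apply: (le_trans (target_integral_le mbe be0)).
  have mbE : measurable_fun setT (fun x => (b x)%:E) by exact/measurable_EFinP.
  have bE x : setT x -> (0 <= (b x)%:E)%E by rewrite lee_fin.
  have ei0 : 0 <= e^-1 by rewrite invr_ge0 ltW.
  rewrite (ge0_integralZl_EFin _ measurableT bE mbE ei0) integral_indic//; last exact: measurableC.
  by rewrite setIT muleA -EFinM.
have s4 : (\int[Pi]_x (2 * (h x - c) ^+ 2)%:E <= (2 * K0)%:E *
   \int[gamma]_x \int[gamma]_y sqdist h x y)%E.
  have mhcE : measurable_fun setT (fun x => ((h x - c) ^+ 2)%:E).
    by apply/measurable_EFinP; apply: measurable_funX; exact: measurable_funB.
  have hcE x : setT x -> (0 <= ((h x - c) ^+ 2)%:E)%E by rewrite lee_fin sqr_ge0.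
  have two0 : 0 <= 2 :> R by [].
  apply: (le_trans (target_integral_le mhc hc0)).
  rewrite (ge0_integralZl_EFin _ measurableT hcE mhcE two0) muleA -EFinM mulrC.
  apply: lee_wpmul2l; first by rewrite lee_fin mulr_ge0.
  have msq (x : borel H) : measurable_fun setT (fun y => (h x - h y) ^+ 2).
    by apply: measurable_funX; apply: measurable_funB.
  have mhh : measurable_fun setT (fun x => \int[gamma]_y sqdist h x y)%E.
    apply: (measurable_fun_fubini_tonelli_F (m2 := gamma) (fun t : HH => sqdist h t.1 t.2)).
      exact: (measurable_sqdist mh measurable_fst measurable_snd).
    by move=> t; exact: sqdist_ge0.
  apply: ge0_le_integral => //.
  move=> x _.
  have ihx : gamma.-integrable setT (EFin \o (fun y => h x - h y)).
    by apply: integrableB_real => //; exact: integrable_cst_prob.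
  have ihx2 : gamma.-integrable setT (EFin \o (fun y => (h x - h y) ^+ 2)).
    have i1 := integrableB_real (integrable_cst_prob gamma (h x ^+ 2)) (integrableZ_real (2 * h x) ih).
    have := integrableD_real i1 ih2.
    by apply: eq_integrable => // y _; congr EFin; rewrite /=; ring.
  rewrite /sqdist (EFin_Rintegral ihx2) lee_fin.
  have -> : h x - c = \int[gamma]_y (h x - h y).
    by rewrite RintegralB ?Rintegral_cst_prob//; exact: integrable_cst_prob.
  exact: sqr_Rintegral_le.
by apply: leeD s3; rewrite leeD2r.
Qed.

(** The spectral gap of the proposal links the two preceding estimates, and the accepted energy is
    at most twice the loss of variance in one step. The error terms involve the fourth moment under
    [Pi] and the mass outside [B]. *)
Lemma one_step (N m e T : R) (v : H -> R) (B : set (borel H)) : 0 < N ->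
  (forall h : borel H -> R, measurable_fun setT h ->
  (\int[gamma]_x \int[gamma]_z sqdist h x z <= N%:E * fork_energy gamma h rho)%E) ->
  linear_growth v -> \int[Pi]_x v x = 0 -> measurable B -> 0 <= m <= K0 -> 0 < e ->
  (forall x, B x -> m <= w x) ->
  (forall x z y, B x -> B (prop x z) -> B (prop x y) ->
    m <= w x * (acc x z * acc x y)) ->
  (gamma (~` B) <= T%:E)%E ->
  m * \int[Pi]_x (v x ^+ 2) <= (12 * K0 * N + K0) * (1 + K0) *
    (2 * (\int[Pi]_x (v x ^+ 2) - \int[Pi]_x (K v x ^+ 2))
     + e * \int[Pi]_x (v x ^+ 4) + T / e).
Proof.
move=> N0 gap vg v0 mB /andP[m0 mK] e0 hB1 hB TB.
have [mv _] := vg; have [mKv _] := pcn_op_growth hdot hsep moment4 rho01 mg vg.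
have [_ [C C0 vC]] := linear_growthP vg.
have [_ [C' C'0 KvC]] := linear_growthP (pcn_op_growth hdot hsep moment4 rho01 mg vg).
have K00 : 0 <= K0 by exact: le_trans mK.
have n1 (x : borel H) : 0 <= nrm x by rewrite (le_trans _ (nrm_ge1 x)).
have sqi (u : borel H -> R) c : measurable_fun setT u -> 0 <= c ->
    (forall x, `|u x| <= c * nrm x) -> Pi.-integrable setT (EFin \o (fun x => u x ^+ 2)).
  move=> mu c0 uC; apply: (@integrable_le_nrm4 _ _ _ target_moment4 _ (c ^+ 2)).
    exact: measurable_funX.
  move=> x; rewrite normrX; apply: (@le_trans _ _ ((c * nrm x) ^+ 2)).
    by rewrite lerXn2r// nnegrE ?mulr_ge0.
  by rewrite exprMn ler_wpM2l ?sqr_ge0// nrm_pow_le.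
have iv2 := sqi v C mv C0 vC.
have iKv2 := sqi (K v) C' mKv C'0 KvC.
have iv4 : Pi.-integrable setT (EFin \o (fun x : borel H => v x ^+ 4)).
  apply: (@integrable_le_nrm4 _ _ _ target_moment4 _ (C ^+ 4)); first exact: measurable_funX.
  by move=> x; rewrite normrX -exprMn lerXn2r// nnegrE ?mulr_ge0.
set a := \int[Pi]_x (v x ^+ 2); set a' := \int[Pi]_x (K v x ^+ 2).
set M := \int[Pi]_x (v x ^+ 4).
pose h (x : borel H) := v x * \1_B x.
have mh : measurable_fun setT h by apply: measurable_funM => //; exact: measurable_indic.
have drop : (accepted_energy v <= (2 * (a - a'))%:E)%E.
  have := pcn_op_variance hdot hsep grot moment4 rho01 mg k0 hPi vg.
  rewrite (EFin_Rintegral (integrableZ_real 2 iv2)) (EFin_Rintegral (integrableZ_real 2 iKv2)).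
  rewrite (RintegralZl _ measurableT iv2) (RintegralZl _ measurableT iKv2) -/a -/a'.
  rewrite -/(accepted_energy v) => le.
  by rewrite mulrBr EFinB leeBrDl.
have fork := fork_energy_le_accepted mv mB m0 e0 hB.
have var := variance_le_truncated vg v0 mB e0.
(* The factor [m] pays for the return from [gamma] to [Pi], whose density is at least [m] on [B]. *)
have h4 : (m%:E * \int[gamma]_x (h x ^+ 4)%:E <= M%:E)%E.
  have h40 x : (0 <= (h x ^+ 4)%:E)%E by rewrite lee_fin exprn_even_ge0.
  have v40 (x : borel H) : (0 <= (v x ^+ 4)%:E)%E by rewrite lee_fin exprn_even_ge0.
  have mh4 : measurable_fun setT (fun x => (h x ^+ 4)%:E).
    by apply/measurable_EFinP; exact: measurable_funX.
  have mv4 : measurable_fun setT (fun x : borel H => (v x ^+ 4)%:E).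
    by apply/measurable_EFinP; exact: measurable_funX.
  rewrite -(EFin_Rintegral iv4) (ge0_integral_target mg k0 hPi mv4 v40).
  rewrite -(ge0_integralZl_EFin _ measurableT (fun x _ => h40 x) mh4 m0).
  apply: ge0_le_integral => //.
  - by move=> x _; rewrite mule_ge0.
  - by apply/emeasurable_funM.
  - by apply/emeasurable_funM => //; apply/measurable_EFinP; exact: measurable_pcn_weight.
  - move=> x _; rewrite -!EFinM lee_fin /h indicE.
    have [Bx|nBx] := boolP (x \in B).
      by rewrite mulr1 mulrC ler_wpM2l ?exprn_even_ge0//; apply: hB1; rewrite inE in Bx.
    by rewrite mulr0 expr0n/= mulr0 mulr_ge0 ?exprn_even_ge0//; exact: pcn_weight_ge0.
set SD := (\int[gamma]_x \int[gamma]_y sqdist h x y)%E in var.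
have SD0 : (0 <= SD)%E.
  by apply: integral_ge0 => x _; apply: integral_ge0 => y _; exact: sqdist_ge0.
have T0 : 0 <= T by rewrite -lee_fin; apply: le_trans TB; exact: measure_ge0.
have M0 : 0 <= M by apply: Rintegral_ge0 => x _; rewrite exprn_even_ge0.
pose X := 2 * (a - a') + 2 * e * M + 6 * m / e * T.
have mF : (m%:E * fork_energy gamma h rho <= X%:E)%E.
  apply: (le_trans fork); rewrite /X !EFinD; apply: leeD; first apply: leeD.
  - exact: drop.
  - rewrite mulrAC EFinM -muleA [leRHS]EFinM; apply: lee_wpmul2l => //.
    by rewrite lee_fin mulr_ge0// ltW.
  - rewrite [leRHS]EFinM; apply: lee_wpmul2l => //.
    by rewrite lee_fin divr_ge0 ?mulr_ge0// ltW.
have mSD : (m%:E * SD <= (N * X)%:E)%E.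
  apply: (@le_trans _ _ (m%:E * (N%:E * fork_energy gamma h rho)))%E.
    by apply: lee_wpmul2l; [rewrite lee_fin | exact: gap].
  by rewrite muleCA [leRHS]EFinM; apply: lee_wpmul2l; [rewrite lee_fin ltW | exact: mF].
have main : m * a <= 2 * K0 * (N * X) + m * (e * M) + m * (K0 / e * T).
  rewrite -lee_fin; apply: (@le_trans _ _ (m%:E * (((2 * K0)%:E * SD + (e * M)%:E) + (K0 / e * T)%:E)))%E.
    rewrite EFinM; apply: lee_wpmul2l; first by rewrite lee_fin.
    apply: (le_trans var); rewrite leeD2l// [leRHS]EFinM; apply: lee_wpmul2l => //.
    by rewrite lee_fin divr_ge0// ltW.
  have KT0 : (0 <= (K0 / e * T)%:E)%E by rewrite lee_fin !mulr_ge0// invr_ge0 ltW.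
  have eM0 : (0 <= (e * M)%:E)%E by rewrite lee_fin mulr_ge0// ltW.
  have KS0 : (0 <= (2 * K0)%:E * SD)%E by rewrite mule_ge0// lee_fin mulr_ge0.
  rewrite ge0_muleDr ?adde_ge0// ge0_muleDr// !EFinD.
  rewrite -!EFinM leeD2r// leeD2r// muleCA [leRHS]EFinM; apply: lee_wpmul2l => //.
  by rewrite lee_fin mulr_ge0.
apply: (le_trans main).
have aa : 0 <= 2 * (a - a').
  rewrite -lee_fin; apply: le_trans drop; apply: integral_ge0 => x _.
  apply: integral_ge0 => z _; apply: integral_ge0 => y _; rewrite lee_fin.
  by rewrite mulr_ge0 ?sqr_ge0// mulr_ge0// pcn_acc_ge0.
rewrite /X; move: aa; set D := 2 * (a - a') => D0.
have eM0 : 0 <= e * M by rewrite mulr_ge0// ltW.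
have Te0 : 0 <= T / e by rewrite divr_ge0// ltW.
have -> : 6 * m / e * T = 6 * (m * (T / e)) by ring.
have -> : m * (K0 / e * T) = K0 * (m * (T / e)) by ring.
have -> : 2 * e * M = 2 * (e * M) by ring.
move: eM0 Te0; set E := e * M; set Te := T / e => E0 Te0.
have h1 : m * E <= K0 * E by rewrite ler_wpM2r.
have h2 : m * Te <= K0 * Te by rewrite ler_wpM2r.
have KN0 : 0 <= K0 * N by rewrite mulr_ge0// ltW.
have h3 : K0 * N * (m * Te) <= K0 * N * (K0 * Te) by rewrite ler_wpM2l.
have h4' : K0 * (m * Te) <= K0 * (K0 * Te) by rewrite ler_wpM2l.
(* A lower bound of the expanded difference that has nonnegative coefficients only; the terms
   containing [m] have been traded for [K0] through [h1] to [h4']. *)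
rewrite -subr_ge0; apply: (@le_trans _ _ ((10 * (K0 * N) + K0 + 12 * (K0 * N) * K0 + K0 * K0) * D + (8 * (K0 * N) + 12 * (K0 * N) * K0 + K0 * K0) * E
  + (12 * (K0 * N) + K0) * Te)).
  clearbody D E Te; have N0' := ltW N0.
  by rewrite !(addr_ge0, mulr_ge0).
lra.
Qed.

End one_step.

(** * Decay of the variance *)

Section rates.
Context (R : realType).
Implicit Types (a : nat -> R) (A m err s y c : R).

(** The recursion reads [a (n + 1) <= q a n + err / 2] with [q = 1 - m / (2 A)]. Its fixed point is
    [b = A err / m], and the distance above [b] contracts by [q], which [m <= 2 A] keeps
    nonnegative. *)
Lemma decay_recursion a A m err t : 0 < m -> m <= 2 * A -> 0 <= err ->
  (forall n, 0 <= a n) ->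
  (forall n, m * a n <= A * (2 * (a n - a n.+1) + err)) ->
  a t <= expR (- (m / (2 * A) * t%:R)) * a 0%N + A / m * err.
Proof.
move=> m0 mA err0 a0 rec.
have A0 : 0 < A by lra.
pose q := 1 - m / (2 * A); pose b := A / m * err.
have b0 : 0 <= b by rewrite mulr_ge0// divr_ge0// ltW.
have q0 : 0 <= q by rewrite subr_ge0 ler_pdivrMr ?mul1r//; lra.
have qe : q <= expR (- (m / (2 * A))) by exact: expR_ge1Dx.
have step n : a n.+1 - b <= q * (a n - b).
  have := rec n; rewrite -(ler_pM2l (_ : 0 < A^-1 / 2)) ?divr_gt0 ?invr_gt0//.
  rewrite -subr_ge0 => h; rewrite -subr_ge0.
  suff <- : A^-1 / 2 * (A * (2 * (a n - a n.+1) + err)) - A^-1 / 2 * (m * a n) =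
     q * (a n - b) - (a n.+1 - b) by [].
  rewrite /q /b; field; lra.
have it n : a n - b <= q ^+ n * a 0%N.
  elim: n => [|n IH]; first by rewrite expr0 mul1r lerBlDr lerDl.
  by rewrite (le_trans (step n))// exprS -mulrA ler_wpM2l.
have := it t; rewrite lerBlDr => /le_trans; apply; rewrite lerD2r ler_wpM2r//.
rewrite -mulNr expRM_natr.
by rewrite lerXn2r// nnegrE expR_ge0.
Qed.

(** Absorbs the prefactor [exp (y / 2)] of the truncation error into a fraction of [c y^s]. The 1
    covers [y <= 1]; beyond, [y^2 <= y^s] and a square is completed. *)
Lemma le_powR_quadratic s y c : 2 <= s -> 0 < y -> 0 < c ->
  y <= c * y `^ s + (1 + c^-1).
Proof.
move=> s2 y0 c0; have ci : 0 < c^-1 by rewrite invr_gt0.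
have ys0 : 0 <= c * y `^ s by rewrite mulr_ge0 ?powR_ge0// ltW.
have [y1|y1] := leP y 1; first by lra.
have : y ^+ 2 <= y `^ s by rewrite -powR_mulrn ?(ltW y0)//; apply: ler_powR => //; exact: ltW.
rewrite -(ler_pM2l c0).
suff : y <= c * y ^+ 2 + c^-1 by lra.
rewrite -subr_ge0.
have -> : c * y ^+ 2 + c^-1 - y = c^-1 * ((c * y - 2^-1) ^+ 2 + 3 / 4) by field; lra.
by rewrite mulr_ge0 ?(ltW ci)// addr_ge0 ?sqr_ge0// divr_ge0.
Qed.

Lemma powR_le_expR s : 0 <= s -> exists2 D : R, 0 < D & forall y, 0 < y ->
  y `^ s <= D * expR (y / 2).
Proof.
move=> s0; have [n sn] : exists n : nat, s <= n%:R.
  by exists (Num.truncn s).+1; exact/ltW/truncnS_gt.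
pose D : R := 1 + 2 ^+ n.+1 * n.+1`!%:R.
have F0 : 0 < n.+1`!%:R :> R by rewrite ltr0n fact_gt0.
have D0 : 0 <= 2 ^+ n.+1 * n.+1`!%:R :> R by rewrite mulr_ge0// ?exprn_ge0 ?ltW.
exists D; first by rewrite ltr_pwDl.
move=> y y0; have y20 : 0 <= y / 2 by lra.
have e1 : 1 <= expR (y / 2) by have := expR_ge1Dx (y / 2); lra.
rewrite /D mulrDl mul1r.
have [y1|y1] := leP y 1.
  apply: (@le_trans _ _ (expR (y / 2))); last first.
    by rewrite lerDl mulr_ge0// expR_ge0.
  apply: le_trans e1; rewrite -[leRHS]/((fun=> 1) s) -powR1; apply: ge0_ler_powR => //; rewrite ?nnegrE//; exact: ltW.
apply: (@le_trans _ _ (y ^+ n.+1)).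
  rewrite -powR_mulrn ?(ltW y0)//; apply: ler_powR; first exact: ltW.
  by rewrite (le_trans sn)// ler_nat.
have h := @expR_ge1Dxn R (y / 2) n y20.
rewrite (_ : y ^+ n.+1 = 2 ^+ n.+1 * n.+1`!%:R * ((y / 2) ^+ n.+1 / n.+1`!%:R)).
  apply: (@le_trans _ _ (2 ^+ n.+1 * n.+1`!%:R * expR (y / 2))); last by rewrite lerDr expR_ge0.
  by apply: ler_wpM2l => //; apply: le_trans h; rewrite lerDr.
by rewrite expr_div_n; field; rewrite gt_eqF//= expf_neq0.
Qed.

(** Here [y] stands for [log (2 t)]. The first term is the contraction over [t] steps, whose
    exponent is exponential in [y] and beats every power of [y]. The second is the truncation error;
    half of [c2 y^s] is spent on its prefactor, hence [c2 / 2] in [c]. *)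
Lemma decay_rate s c1 c2 : 2 <= s -> 0 < c1 -> 0 < c2 ->
  exists C c, [/\ 0 < C, 0 < c & forall y, 0 < y ->
    expR (- (c1 * expR (y / 2))) + expR (y / 2) * expR (- (c2 * y `^ s)) <=
    C * expR (- (c * y `^ s))].
Proof.
move=> s2 c10 c20.
have [D D0 hD] := powR_le_expR (le_trans (ler0n R 2) s2).
pose c := Num.min (c1 / D) (c2 / 2).
have c0 : 0 < c by rewrite lt_min !divr_gt0.
pose e := expR (2^-1 * (1 + c2^-1)).
exists (1 + e), c; split=> //; first by rewrite addr_gt0// expR_gt0.
move=> y y0; rewrite mulrDl mul1r lerD//.
  rewrite ler_expR lerN2; apply: (@le_trans _ _ (c1 / D * y `^ s)).
    by rewrite ler_wpM2r ?powR_ge0// ge_min lexx.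
  by rewrite -mulrA ler_wpM2l ?(ltW c10)// ler_pdivrMl// hD.
rewrite -!expRD ler_expR.
have := le_powR_quadratic s2 y0 c20.
have : c * y `^ s <= c2 / 2 * y `^ s by rewrite ler_wpM2r ?powR_ge0// ge_min lexx orbT.
lra.
Qed.

End rates.

(** * Hölder functions and exponential tails *)

Section hoelder.
Context (R : realType) (H : completeNormedModType R).
Variables (beta S : R) (f : H -> R).
Hypotheses (beta01 : 0 < beta <= 1) (S0 : 0 <= S).
Hypothesis fS : forall x y, `|f x - f y| <= S * `|x - y| `^ beta.

Lemma powR_le1D (u : R) : 0 <= u -> u `^ beta <= 1 + u.
Proof.
move=> u0; have /andP[b0 b1] := beta01; have [u1|u1] := leP u 1.
  apply: (@le_trans _ _ 1); last by rewrite lerDl.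
  rewrite -[leRHS]/((fun=> 1) beta) -powR1; apply: ge0_ler_powR => //; rewrite ?nnegrE//; exact: ltW.
apply: (@le_trans _ _ u); last by rewrite lerDr.
by rewrite -[leRHS]powRr1//; apply: ler_powR => //; exact: ltW.
Qed.

Lemma measurable_hoelder : measurable_fun setT (f : borel H -> R).
Proof.
have /andP[b0 b1] := beta01.
apply: continuous_measurable_borel => x; apply/cvgrPdist_lt => e e0.
(* [S + 1] avoids a division by zero when [f] is constant. *)
pose dlt := (e / (S + 1)) `^ beta^-1.
have S1 : 0 < S + 1 by rewrite ltr_wpDl.
have eS : 0 < e / (S + 1) by rewrite divr_gt0.
near=> y.
have xy : `|x - y| < dlt.
  by near: y; apply: cvgr_dist_lt => //; rewrite powR_gt0.
apply: (le_lt_trans (fS x y)).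
have : `|x - y| `^ beta < dlt `^ beta.
  by apply: gt0_ltr_powR => //; rewrite nnegrE// ?powR_ge0.
rewrite /dlt -powRrM mulVf ?gt_eqF// powRr1 ?ltW// => h.
apply: (@le_lt_trans _ _ ((S + 1) * `|x - y| `^ beta)).
  by rewrite ler_wpM2r ?powR_ge0// lerDl.
by rewrite mulrC -ltr_pdivlMr.
Unshelve. all: by end_near. Qed.

Lemma linear_growth_hoelder : linear_growth f.
Proof.
split; first exact: measurable_hoelder.
exists (`|f 0| + S) => x.
have /(le_trans (fS x 0)) : S * `|x - 0| `^ beta <= S * (1 + `|x|).
  by rewrite ler_wpM2l// subr0 powR_le1D.
have n0 : 0 <= `|f 0| * `|x| by rewrite mulr_ge0.
have : `|f x| <= `|f x - f 0| + `|f 0| by rewrite -[X in `|X| <= _](subrK (f 0)) ler_normD.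
lra.
Qed.

End hoelder.

Section gaussian_tail.
Context (R : realType) (H : completeNormedModType R).
Variable gamma : probability (borel H) R.
Variable kappa : R.
Hypothesis kappa0 : 0 < kappa.
Local Notation E := (\int[gamma]_x (expR (kappa * `|(x : H)| ^+ 2))%:E)%E.
Hypothesis expE : (E < +oo)%E.

Let mexp : measurable_fun setT (fun x : borel H => expR (kappa * `|(x : H)| ^+ 2)).
Proof.
apply: measurableT_comp => //; apply: measurable_funM => //; apply: measurable_funX.
exact: measurable_norm_borel.
Qed.

Let iexp : gamma.-integrable setT (EFin \o (fun x : borel H => expR (kappa * `|(x : H)| ^+ 2))).
Proof.
by apply: ge0_integrable_real (lexx _) _ => // x; exact: expR_ge0.
Qed.

Lemma expo_moment4 : (\int[gamma]_x ((1 + `|(x : H)|) ^+ 4)%:E < +oo)%E.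
Proof.
have i1 := integrableD_real (integrable_cst_prob gamma 8)
  (integrableZ_real (32 / kappa ^+ 2) iexp).
apply: (@le_lt_trans _ _ (\int[gamma]_x (8 + 32 / kappa ^+ 2 * expR (kappa * `|(x : H)| ^+ 2))%:E)%E);
    last by rewrite (EFin_Rintegral i1) ltry.
apply: ge0_le_integral => //.
- apply/measurable_EFinP; apply: measurable_funX.
  by apply: measurable_funD => //; exact: measurable_norm_borel.
- by apply/measurable_EFinP; apply: measurable_funD => //; exact: measurable_funM.
- move=> x _; rewrite lee_fin; set r := `|_|.
  have r0 : 0 <= r by exact: normr_ge0.
  have c0 : 0 <= kappa * r ^+ 2 by rewrite mulr_ge0 ?sqr_ge0// ltW.
  have h := @expR_ge1Dxn R (kappa * r ^+ 2) 1 c0.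
  have p4 : (1 + r) ^+ 4 <= 8 + 8 * r ^+ 4.
    rewrite -subr_ge0.
    have -> : 8 + 8 * r ^+ 4 - (1 + r) ^+ 4 = (1 - r) ^+ 2 * (7 * (1 - r) ^+ 2 + 24 * r) by ring.
    by apply: mulr_ge0; rewrite ?sqr_ge0//; apply: addr_ge0; apply: mulr_ge0; rewrite ?sqr_ge0.
  apply: (le_trans p4); rewrite lerD2l.
  (* The fourth power is compared with the quadratic term in the expansion of [exp (kappa r^2)]. *)
  rewrite (_ : 8 * r ^+ 4 = 32 / kappa ^+ 2 * ((kappa * r ^+ 2) ^+ 2 / 2 / 2)); last first.
    by field; rewrite gt_eqF.
  rewrite ler_wpM2l ?divr_ge0 ?sqr_ge0//; apply: le_trans h.
  rewrite (_ : (2`!)%:R = 2 :> R)//; have := sqr_ge0 (kappa * r ^+ 2); lra.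
Qed.

(** Markov's inequality for the exponential of the squared norm. *)
Lemma expo_tail r : 0 <= r -> (gamma (tail_set r) <=
  ((\int[gamma]_x expR (kappa * `|(x : H)| ^+ 2)) * expR (- (kappa * r ^+ 2)))%:E)%E.
Proof.
move=> r0; have mT := @measurable_tail_set _ H r.
have e0 : 0 <= expR (- (kappa * r ^+ 2)) by exact: expR_ge0.
have mE : measurable_fun setT (fun x : borel H => (expR (kappa * `|(x : H)| ^+ 2))%:E).
  exact/measurable_EFinP.
have E0 (x : borel H) : setT x -> (0 <= (expR (kappa * `|(x : H)| ^+ 2))%:E)%E.
  by rewrite lee_fin expR_ge0.
rewrite EFinM muleC -(EFin_Rintegral iexp) -(ge0_integralZl_EFin _ measurableT E0 mE e0).
rewrite -[X in gamma X]setIT -(integral_indic gamma measurableT mT).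
apply: ge0_le_integral => //.
- by apply/measurable_EFinP; exact: measurable_indic.
- by apply/emeasurable_funM.
- move=> x _; rewrite -EFinM lee_fin indicE; have [|_] := boolP (x \in _).
    rewrite inE /tail_set/= => rx; rewrite -expRD -expR0 ler_expR addrC subr_ge0 ler_wpM2l//.
      exact: ltW.
    by rewrite lerXn2r// ?nnegrE// ltW.
  by rewrite mulr_ge0// expR_ge0.
Qed.

End gaussian_tail.

(** * Choice of the radius and decay of the densities *)

Section pcn_decay.
Context (R : realType) (H : completeNormedModType R).
Variable dot : {dot H for idfun}.
Hypotheses (hdot : norm_from_dot dot) (hsep : separable H).
Variable gamma : probability (borel H) R.
Local Notation HH := (borel H * borel H)%type.
Local Notation gg := (product_prob gamma gamma).
Hypothesis grot : forall (a b : R) (A : set HH), a ^+ 2 + b ^+ 2 = 1 ->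
  measurable A -> gg (rotation a b @^-1` A) = gg A.
Variables (rho beta L : R) (g : H -> R).
Hypothesis rho01 : 0 <= rho < 1.
Hypotheses (beta01 : 0 < beta <= 1) (L1 : 1 <= L).
Hypothesis gL : forall x y, `|g x - g y| <= L * `|x - y| `^ beta.
Variables (k : R) (Pi : probability (borel H) R).
Hypothesis k0 : 0 < k.
Local Notation w := (pcn_weight k g).
Hypothesis hPi : forall A : set (borel H), measurable A ->
  (Pi A = \int[gamma]_(x in A) (w x)%:E)%E.
Variable K0 : R.
Hypothesis wK : forall x, w x <= K0.

Local Notation prop := (pcn_proposal rho).
Local Notation acc := (pcn_acc rho g).
Local Notation K := (pcn_op gamma rho g).

Let L0 : 0 <= L. Proof. exact: le_trans L1. Qed.
Let mg : measurable_fun setT (g : borel H -> R).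
Proof. exact: measurable_hoelder beta01 L0 gL. Qed.

(** On the ball [g] stays within [s] of [g 0]. The density loses [exp (- s)], and each acceptance
    loses [exp (- 2 s)], as it compares two values of [g]: this is the 5. *)
Lemma pcn_weight_lower r s : (forall x, `|x| <= r -> `|g x - g 0| <= s) ->
  let m := k * expR (- g 0) * expR (- (5 * s)) in
  let B := ~` (tail_set r : set (borel H)) in
  (forall x, B x -> m <= w x) /\
  (forall x z y, B x -> B (prop x z) -> B (prop x y) ->
    m <= w x * (acc x z * acc x y)).
Proof.
move=> osc m B.
have BE x : B x -> g 0 - s <= g x <= g 0 + s.
  rewrite /B /tail_set/= => /negP; rewrite -leNgt => /osc.
  by rewrite ler_distl.
have kg : 0 <= k * expR (- g 0) by rewrite mulr_ge0 ?expR_ge0// ltW.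
have wl x : B x -> k * expR (- g 0) * expR (- s) <= w x.
  move=> /BE/andP[h1 h2]; rewrite /pcn_weight -mulrA ler_wpM2l ?(ltW k0)// -expRD ler_expR; lra.
have al x z : B x -> B (prop x z) -> expR (- (2 * s)) <= acc x z.
  move=> /BE/andP[h1 h2] /BE/andP[h3 h4]; rewrite /pcn_acc le_min ler_expR.
  apply/andP; split; last by lra.
  by rewrite -[leRHS]expR0 ler_expR; lra.
split.
  move=> x Bx; apply: le_trans (wl x Bx); rewrite ler_wpM2l// ler_expR.
  by have /BE/andP[] := Bx; lra.
move=> x z y Bx Bp Bq.
rewrite (_ : m = k * expR (- g 0) * expR (- s) * (expR (- (2 * s)) * expR (- (2 * s)))).
  apply: ler_pM; [by rewrite mulr_ge0 ?expR_ge0|by rewrite mulr_ge0 ?expR_ge0|exact: wl|].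
  by apply: ler_pM; rewrite ?expR_ge0//; exact: al.
by rewrite -!mulrA -!expRD /m -!mulrA -!expRD; congr (_ * expR _); ring.
Qed.

(** As [f] has mean 1 under [Pi], [f x - 1] is the average of [f x - f y] over [y], so that neither
    [f 0] nor any other datum of [f] enters the bound besides [S]. *)
Lemma hoelder_density_deviation S (f : H -> R) :
  (\int[gamma]_x ((1 + `|(x : H)|) ^+ 4)%:E < +oo)%E -> 0 <= S ->
  (forall x y, `|f x - f y| <= S * `|x - y| `^ beta) ->
  (\int[Pi]_x (f x)%:E = 1)%E ->
  forall x, `|f x - 1| <= S * (\int[Pi]_x nrm x) * nrm x.
Proof.
move=> m4 S0 fS f1 x.
have m4P := target_moment4 m4 mg k0 hPi wK.
have n0 (y : borel H) : 0 <= nrm y by rewrite (le_trans _ (nrm_ge1 y)).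
have inr : Pi.-integrable setT (EFin \o @nrm R H).
  apply: (@integrable_le_nrm4 _ _ _ m4P _ 1); first exact: measurable_nrm.
  by move=> y; rewrite mul1r ger0_norm// -[leLHS]expr1 nrm_pow_le.
have [mf [C C0 fC]] := linear_growthP (linear_growth_hoelder beta01 S0 fS).
have fi : Pi.-integrable setT (EFin \o (f : borel H -> R)).
  apply: (le_integrable_real mf fC); exact: integrableZ_real.
have fxi : Pi.-integrable setT (EFin \o (fun y : borel H => f x - f y)).
  by apply: integrableB_real => //; exact: integrable_cst_prob.
have -> : f x - 1 = \int[Pi]_y (f x - f y).
  rewrite RintegralB//; last exact: integrable_cst_prob.
  by rewrite Rintegral_cst_prob /Rintegral f1.
apply: (le_trans (le_normr_Rintegral _ fxi)) => //.
rewrite mulrAC -(RintegralZl _ measurableT inr).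
apply: le_Rintegral => //.
- by have /integrable_norm := fxi; exact.
- exact: integrableZ_real.
- move=> y _; apply: (le_trans (fS x y)); rewrite -mulrA ler_wpM2l//.
  apply: (le_trans (powR_le1D beta01 (normr_ge0 _))).
  have := ler_normB x y; have := normr_ge0 x; have := normr_ge0 y.
  by rewrite /nrm; nra.
Qed.

Lemma pcn_density_decay : exists C c : R, [/\ 0 < C, 0 < c &
  forall t S (f : H -> R), (1 <= t)%N -> 0 < S -> (forall x, 0 <= f x) ->
    (forall x y, `|f x - f y| <= S * `|x - y| `^ beta) ->
    (\int[Pi]_x (f x)%:E = 1)%E ->
    \int[Pi]_x ((iter t K f x - 1) ^+ 2) <=
      C * expR (- (c * ln (2 * t%:R) `^ (2 / beta))) * S ^+ 2].
Proof.
have [N N0 gap] := proposal_gap hdot hsep grot rho01.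
have [kappa kappa0 expE] := fernique hdot hsep grot.
have m4 := expo_moment4 kappa0 expE.
have m4P := target_moment4 m4 mg k0 hPi wK.
have [b0 b1] := andP beta01.
have K00 : 0 < K0 by apply: lt_le_trans (wK point); exact: pcn_weight_gt0.
have n0 (y : borel H) : 0 <= nrm y by rewrite (le_trans _ (nrm_ge1 y)).
set s := 2 / beta.
have s2 : 2 <= s by rewrite ler_pdivlMr// ler_piMr.
pose E := \int[gamma]_x expR (kappa * `|(x : H)| ^+ 2).
have E0 : 0 <= E by apply: Rintegral_ge0 => x _; exact: expR_ge0.
pose A := (12 * K0 * N + K0) * (1 + K0).
have KN0 : 0 <= 12 * K0 * N by rewrite !mulr_ge0// ltW.
have A0 : K0 <= A by rewrite /A mulrDr mulr1; nra.
have A00 : 0 < A by exact: lt_le_trans A0.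
pose m0 := k * expR (- g 0).
have m00 : 0 < m0 by rewrite mulr_gt0// expR_gt0.
pose M1 := \int[Pi]_x nrm x.
pose M4 := \int[Pi]_x (nrm x ^+ 4).
have M40 : 0 <= M4 by apply: Rintegral_ge0 => x _; rewrite exprn_ge0.
have M10 : 0 <= M1 by exact: Rintegral_ge0.
(* [f - 1] is bounded by [S * M1 * nrm]; as [nrm] is at least 1, its fourth moment [M4] also serves
   for the second moment. *)
pose C2 := M1 ^+ 2 * M4.
pose C4 := M1 ^+ 4 * M4.
have C20 : 0 <= C2 by apply: mulr_ge0; rewrite ?sqr_ge0.
have C40 : 0 <= C4 by apply: mulr_ge0; rewrite ?exprn_ge0.
(* With [m = m0 exp (- y / 2)] and [t = exp y / 2], the exponent [m t / (2 A)] of [decay_recursion]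
   is [c1 exp (y / 2)]. Likewise [c2 y^s] is half of [kappa r^2]. *)
pose c1 := m0 / (4 * A).
pose c2 := kappa / 2 * (10 * L)^-1 `^ s.
have L10 : 0 < 10 * L by rewrite mulr_gt0//; exact: lt_le_trans L1.
have c10 : 0 < c1 by rewrite divr_gt0// mulr_gt0.
have c20 : 0 < c2.
  by apply: mulr_gt0; [exact: divr_gt0|apply: powR_gt0; rewrite invr_gt0].
have [C [c [C0 c0 rate]]] := decay_rate s2 c10 c20.
pose C' := C2 + A / m0 * (C4 + E) + 1.
have AC0 : 0 <= A / m0 * (C4 + E) by rewrite mulr_ge0 ?addr_ge0// divr_ge0// ltW.
exists (C' * C), c; split=> //; first by rewrite mulr_gt0// /C' ltr_wpDl// addr_ge0.
move=> t S f t1 S0 f0 fS f1.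
pose y := ln (2 * t%:R) : R.
have t2 : 1 < 2 * t%:R :> R by rewrite -natrM ltr1n (leq_trans _ (leq_mul (leqnn 2) t1)).
have ey : expR y = 2 * t%:R by rewrite lnK// posrE (lt_trans ltr01).
have y0 : 0 < y by exact: ln_gt0.
(* Solves [5 L r^beta = y / 2]. *)
pose r := (y / (10 * L)) `^ beta^-1.
have r0 : 0 <= r by exact: powR_ge0.
have yL0 : 0 <= y / (10 * L) by rewrite divr_ge0// ltW.
have rb : r `^ beta = y / (10 * L).
  by rewrite /r -powRrM mulVf ?gt_eqF// powRr1.
have r2 : kappa * r ^+ 2 = 2 * (c2 * y `^ s).
  rewrite -powR_mulrn// /r -powRrM (_ : beta^-1 * 2%:R = s); last by rewrite mulrC.
  rewrite powRM ?invr_ge0 ?(ltW y0) ?(ltW L10)// /c2.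
  set p := powR _ _; set q := powR _ _.
  have aux (a b d : R) : a * (b * d) = 2 * (a / 2 * d * b) by field.
  exact: aux.
pose m := k * expR (- g 0) * expR (- (5 * (y / 10))).
have osc x : `|x| <= r -> `|g x - g 0| <= y / 10.
  move=> xr; apply: (le_trans (gL x 0)); rewrite subr0.
  apply: (@le_trans _ _ (L * r `^ beta)).
    rewrite ler_wpM2l//; apply: ge0_ler_powR => //; rewrite ?nnegrE//; exact: ltW.
  by rewrite rb le_eqVlt; apply/orP; left; apply/eqP; field; rewrite gt_eqF//; exact: lt_le_trans L1.
have [hB1 hB] := pcn_weight_lower osc.
rewrite -/m in hB1 hB.
have mE : m = m0 * expR (- (y / 2)) by rewrite /m /m0; congr (_ * expR _); field.
have m_gt0 : 0 < m by rewrite mE mulr_gt0// expR_gt0.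
have mK : m <= K0.
  apply: le_trans (wK 0); apply: hB1; rewrite /tail_set/= normr0.
  by apply/negP; rewrite -leNgt.
pose B : set (borel H) := ~` (tail_set r : set (borel H)).
have mB : measurable B by apply: measurableC; exact: measurable_tail_set.
(* The square root of the exponential factor in the Gaussian tail at radius [r]. *)
pose dlt := expR (- (c2 * y `^ s)).
have dlt0 : 0 < dlt by exact: expR_gt0.
have TB : (gamma (~` B) <= (E * dlt ^+ 2)%:E)%E.
  rewrite /B setCK; apply: (le_trans (expo_tail kappa0 expE r0)).
  by rewrite lee_fin -/E ler_wpM2l// r2 /dlt -expRM_natl mulrN.
(* Balances the two errors of [one_step]: with a fourth moment of order [S^4] and a tail of order
   [dlt^2], both are of order [dlt S^2]. This is also the homogeneity in [S] that the claim
   requires. *)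
pose e := dlt / S ^+ 2.
have e0 : 0 < e by rewrite divr_gt0// exprn_gt0.
have fg := linear_growth_hoelder beta01 (ltW S0) fS.
pose v n (x : H) := iter n K f x - 1.
have itg n := linear_growth_iter hdot hsep m4 rho01 mg n fg.
have vg n : linear_growth (v n) by exact: linear_growthB.
have vS n : K (v n) = v n.+1 by rewrite /v (pcn_opB hdot hsep m4 rho01 mg 1 (itg n)).
have inr4 : Pi.-integrable setT (EFin \o (fun x => nrm x ^+ 4)).
  apply: ge0_integrable_real (lexx _) m4P => //.
    by apply: measurable_funX; exact: measurable_nrm.
have ig (u : H -> R) : linear_growth u -> Pi.-integrable setT (EFin \o (u : borel H -> R)).
  move=> /linear_growthP[mu [D D0 uD]]; apply: (integrable_le_nrm4 m4P mu (c := D)) => x.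
  by rewrite (le_trans (uD x))// ler_wpM2l// -[leLHS]expr1 nrm_pow_le.
have v0 n : \int[Pi]_x v n x = 0.
  rewrite /v RintegralB//; [|exact: ig|exact: integrable_cst_prob].
  rewrite Rintegral_cst_prob /Rintegral.
  rewrite (iter_pcn_op_invariant hdot hsep grot m4 rho01 mg k0 hPi n fg f0).
  by rewrite f1 subrr.
have dev := hoelder_density_deviation m4 (ltW S0) fS f1.
have i4 (u : H -> R) : linear_growth u ->
    Pi.-integrable setT (EFin \o (fun x : borel H => u x ^+ 4)).
  move=> /linear_growthP[mu [D D0 uD]].
  apply: (@integrable_le_nrm4 _ _ _ m4P _ (D ^+ 4)); first exact: measurable_funX.
  by move=> x; rewrite normrX -exprMn lerXn2r// nnegrE ?mulr_ge0.
have v4le n : \int[Pi]_x (v n.+1 x ^+ 4) <= \int[Pi]_x (v n x ^+ 4).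
  rewrite -lee_fin -!EFin_Rintegral; [|exact: i4|exact: i4].
  rewrite -vS; exact: (pcn_op_pow4 hdot hsep grot m4 rho01 mg k0 hPi (vg n)).
have v40 : \int[Pi]_x (v 0%N x ^+ 4) <= C4 * S ^+ 4.
  rewrite mulrC /C4 mulrA -exprMn -(RintegralZl _ measurableT inr4).
  apply: le_Rintegral => //; [exact: i4|exact: integrableZ_real|].
  move=> x _; rewrite -exprMn -[leLHS]ger0_norm ?exprn_even_ge0// normrX.
  apply: lerXn2r; rewrite ?nnegrE ?normr_ge0//; last exact: dev.
  by rewrite !mulr_ge0// ltW.
have v4 n : \int[Pi]_x (v n x ^+ 4) <= C4 * S ^+ 4.
  by elim: n => // n; exact: le_trans.
have v20 : \int[Pi]_x (v 0%N x ^+ 2) <= C2 * S ^+ 2.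
  have iv2 : Pi.-integrable setT (EFin \o (fun x => v 0%N x ^+ 2)).
    apply: (@integrable_le_nrm4 _ _ _ m4P _ ((S * M1) ^+ 2)).
      by apply: measurable_funX; case: (vg 0%N).
    move=> x; rewrite normrX; apply: (@le_trans _ _ ((S * M1 * nrm x) ^+ 2)).
      apply: lerXn2r; rewrite ?nnegrE ?normr_ge0//; last exact: dev.
      by rewrite !mulr_ge0// ltW.
    by rewrite [leLHS]exprMn ler_wpM2l ?sqr_ge0// nrm_pow_le.
  rewrite mulrC /C2 mulrA -exprMn -(RintegralZl _ measurableT inr4).
  apply: le_Rintegral => //; first exact: integrableZ_real.
  move=> x _; apply: (@le_trans _ _ ((S * M1 * nrm x) ^+ 2)); last first.
    by rewrite [leLHS]exprMn ler_wpM2l ?sqr_ge0// nrm_pow_le.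
  rewrite -[leLHS]ger0_norm ?sqr_ge0// normrX.
  apply: lerXn2r; rewrite ?nnegrE ?normr_ge0//; last exact: dev.
  by rewrite !mulr_ge0// ltW.
have err0 : 0 <= dlt * (C4 + E) * S ^+ 2.
  by rewrite mulr_ge0 ?sqr_ge0// mulr_ge0 ?addr_ge0// ltW.
have rec n : m * \int[Pi]_x (v n x ^+ 2) <= A *
    (2 * (\int[Pi]_x (v n x ^+ 2) - \int[Pi]_x (v n.+1 x ^+ 2)) + dlt * (C4 + E) * S ^+ 2).
  have mK' : 0 <= m <= K0 by rewrite (ltW m_gt0).
  have := one_step hdot hsep grot m4 rho01 mg k0 hPi wK N0 gap (vg n) (v0 n) mB mK' e0 hB1 hB TB.
  rewrite -/A vS => /le_trans; apply; rewrite ler_wpM2l ?(ltW A00)// -addrA lerD2l.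
  have Te : E * dlt ^+ 2 / e = dlt * E * S ^+ 2 by rewrite /e; field; rewrite !gt_eqF.
  have eM : e * \int[Pi]_x (v n x ^+ 4) <= dlt * C4 * S ^+ 2.
    rewrite (_ : dlt * C4 * S ^+ 2 = e * (C4 * S ^+ 4)); last first.
      by rewrite /e; field; rewrite gt_eqF.
    by rewrite ler_wpM2l// ltW.
  rewrite Te mulrDr mulrDl lerD2r; exact: eM.
have m2A : m <= 2 * A.
  by rewrite (le_trans mK)// (le_trans A0)// ler_peMl ?ler1n// ltW.
have a0 n : 0 <= \int[Pi]_x (v n x ^+ 2).
  by apply: Rintegral_ge0 => x _; exact: sqr_ge0.
have final := @decay_recursion R (fun n => \int[Pi]_x (v n x ^+ 2)) A m _ t m_gt0 m2A err0 a0 rec.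
apply: (le_trans final).
move: (rate y y0); rewrite -/dlt => rate_y.
have ey2 : expR (y / 2) != 0 by rewrite gt_eqF// expR_gt0.
have tE : m / (2 * A) * t%:R = c1 * expR (y / 2).
  have tey : t%:R = expR (y / 2) ^+ 2 / 2.
    rewrite -expRM_natl (_ : 2%:R * (y / 2) = y); last by rewrite mulrC divfK.
    by rewrite ey mulrC mulKf.
  rewrite mE expRN /c1 tey; move: ey2 A00; set w1 := expR _; clearbody A w1 m0.
  move=> w10 A00; field; rewrite w10 gt_eqF//.
have AmE : A / m = A / m0 * expR (y / 2).
  by rewrite mE expRN invfM invrK mulrA.
rewrite tE AmE.
set e1 := expR (- (c1 * _)) in rate_y *; set e2 := expR (y / 2) in rate_y *.
set e3 := expR (- (c * y `^ s)) in rate_y *.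
have e10 : 0 <= e1 by exact: expR_ge0.
have e20 : 0 <= e2 by exact: expR_ge0.
have h1 : e1 * \int[Pi]_x v 0%N x ^+ 2 <= C' * e1 * S ^+ 2.
  rewrite [leRHS]mulrAC [leRHS]mulrC ler_wpM2l//; apply: (le_trans v20).
  by rewrite ler_wpM2r ?sqr_ge0// /C' -addrA lerDl addr_ge0.
have h2 : A / m0 * e2 * (dlt * (C4 + E) * S ^+ 2) <= C' * (e2 * dlt) * S ^+ 2.
  rewrite (_ : _ * _ * (_ * _ * _) = A / m0 * (C4 + E) * (e2 * dlt) * S ^+ 2).
    rewrite ler_wpM2r ?sqr_ge0// ler_wpM2r ?mulr_ge0 ?(ltW dlt0)//.
    by rewrite /C' -addrA addrCA lerDl addr_ge0.
  move: (A / m0) => a1; set s2' := S ^+ 2; clearbody e2 dlt C4 E s2'; ring.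
apply: (le_trans (lerD h1 h2)).
rewrite -!mulrDl -mulrDr ler_wpM2r ?sqr_ge0// -mulrA ler_wpM2l//.
by rewrite /C' !addr_ge0.
Qed.

End pcn_decay.

(** * The law of the pCN process *)

Section laws.
Context d d1 d2 (Omega : measurableType d) (T1 : measurableType d1)
  (T2 : measurableType d2) (R : realType) (P : probability Omega R).

Definition law (X : Omega -> T1) (mX : measurable_fun setT X) : probability T1 R :=
  let X' : {mfun Omega >-> T1} := HB.pack X (isMeasurableFun.Build _ _ _ _ X mX) in
  distribution P X'.

Lemma ge0_integral_law (X : Omega -> T1) (mX : measurable_fun setT X)
    (u : T1 -> \bar R) : measurable_fun setT u -> (forall x, 0 <= u x)%E ->
  (\int[law mX]_x u x = \int[P]_w u (X w))%E.
Proof.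
by move=> mu u0; rewrite (ge0_integral_pushforward (phi := X)).
Qed.

(** Both sides are finite measures in [E] that agree on rectangles. Keeping the event [W] expresses
    at once the law of the pair and its independence from [W], which is the form that an induction
    on time can carry. *)
Lemma joint_law (m1 : probability T1 R) (m2 : probability T2 R)
    (X : Omega -> T1) (Y : Omega -> T2) (W : set Omega) (c : {nonneg R}) :
  measurable_fun setT X -> measurable_fun setT Y -> measurable W ->
  (forall B C, measurable B -> measurable C ->
    P (X @^-1` B `&` Y @^-1` C `&` W) = (c%:num%:E * (m1 B * m2 C))%E) ->
  forall E, measurable E ->
  P ((fun w => (X w, Y w)) @^-1` E `&` W) = (c%:num%:E * product_prob m1 m2 E)%E.
Proof.
move=> mX mY mW rect E mE.
have mXY : measurable_fun setT (fun w => (X w, Y w)) by exact: measurable_fun_pair.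
pose C : set (set (T1 * T2)) :=
  [set C | exists A, measurable A /\ exists B, measurable B /\ C = A `*` B].
have CI : setI_closed C.
  move=> /= _ _ [X1 [mX1 [X2 [mX2 ->]]]] [Y1 [mY1 [Y2 [mY2 ->]]]].
  rewrite -setXI; exists (X1 `&` Y1); split; first exact: measurableI.
  by exists (X2 `&` Y2); split => //; exact: measurableI.
pose nu1 := image_measure (mrestr P mW : {measure set Omega -> \bar R}) mXY.
pose nu2 : {measure set (T1 * T2) -> \bar R} := mscale c (product_prob m1 m2).
have C12 A : C A -> nu1 A = nu2 A.
  move=> [A1 [mA1 [A2 [mA2 ->]]]]; 
  change (P (X @^-1` A1 `&` Y @^-1` A2 `&` W) =
    c%:num%:E * product_prob m1 m2 (A1 `*` A2))%E.
  by rewrite (product_probE _ _ mA1 mA2) rect.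
change (nu1 E = nu2 E).
apply: (measure_unique C (fun=> setT)) => //.
- rewrite measurable_prod_measurableType //; congr (<<s _ >>).
  rewrite predeqE; split => [[A mA [B mB <-]]|[A [mA [B [mB ->]]]]].
    by exists A; split => //; exists B.
  by exists A => //; exists B.
- by move=> n; exists setT; split=> //; exists setT; split=> //; rewrite setXTT.
- exact: bigcup_const.
- move=> n; change (P (setT `&` W) < +oo)%E.
  by rewrite setTI; apply: (le_lt_trans (probability_le1 P mW)); rewrite ltry.
Qed.

End laws.

Lemma uniform_prob_le (R : realType) (c : R) : 0 <= c ->
  uniform_prob (@ltr01 R) [set u | u <= c] = (Num.min 1 c)%:E.
Proof.
move=> c0; rewrite /uniform_prob integral_uniform_pdf.
have -> : [set u | u <= c] `&` `[0, 1]%classic = `[0, Num.min 1 c]%classic :> set R.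
  apply/seteqP; split=> x /=; rewrite !in_itv/= le_min.
    by move=> [-> /andP[-> ->]].
  by move=> /andP[-> /andP[-> ->]].
rewrite (eq_integral (fun=> 1%:E)); last first.
  move=> x; rewrite inE/= in_itv/= le_min => /andP[x0 /andP[x1 _]].
  by rewrite /uniform_pdf x0 x1 subr0 invr1.
rewrite integral_cst//= mul1e lebesgue_measure_itv/= lte_fin.
have [m0|] := ltP 0 (Num.min 1 c); first by rewrite sube0.
move=> h; congr EFin; apply/eqP; rewrite eq_le h andbT le_min ler01//.
Qed.

Lemma measurable_id_measurableTypeR (R : realType) :
  measurable_fun setT (id : measurableTypeR R -> R).
Proof. by move=> _ B mB; rewrite setTI. Qed.

(* The uniform probability, on [R] with its default display. *)
Definition uniform01 (R : realType) : probability R R :=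
  law (uniform_prob (@ltr01 R)) (@measurable_id_measurableTypeR R).

(** Averaging the accept-reject choice over the uniform variable; with [c] the exponential of the
    difference of [g], this produces [pcn_mix]. *)
Lemma ge0_integral_uniform_if (R : realType) (c a b : R) : 0 <= c -> 0 <= a -> 0 <= b ->
  (\int[uniform01 R]_u (if u <= c then a else b)%:E =
   (Num.min 1 c * a + (1 - Num.min 1 c) * b)%:E)%E.
Proof.
move=> c0 a0 b0.
set D : set R := [set u | u <= c].
have mD : measurable D.
  by rewrite (_ : D = `]-oo, c]%classic)//; apply/seteqP; split=> x /=; rewrite in_itv.
have mc0 : 0 <= Num.min 1 c by rewrite le_min ler01.
transitivity (\int[uniform01 R]_u (a * \1_D u + b * \1_(~` D) u)%:E)%E.
  apply: eq_integral => u _; rewrite !indicE in_setC; case: ifPn => h.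
    by rewrite mem_set// mulr1 mulr0 addr0.
  by rewrite memNset ?mulr0 ?add0r ?mulr1//; exact/negP.
under eq_integral do rewrite EFinD !EFinM.
rewrite ge0_integralD//; last 4 first.
- by move=> u _; rewrite mule_ge0// lee_fin.
- by apply/measurable_EFinP; apply: measurable_funM => //; exact: measurable_indic.
- by move=> u _; rewrite mule_ge0// lee_fin.
- by apply/measurable_EFinP; apply: measurable_funM => //; apply: measurable_indic; exact: measurableC.
rewrite !ge0_integralZl_EFin//; last 2 first.
- by apply/measurable_EFinP; apply: measurable_indic; exact: measurableC.
- by apply/measurable_EFinP; exact: measurable_indic.
rewrite !integral_indic ?setIT//; last exact: measurableC.
have DC : (uniform01 R (~` D) = 1 - uniform01 R D)%E.
  exact: (probability_setC (uniform01 R)).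
have D1 : uniform01 R D = (Num.min 1 c)%:E by exact: uniform_prob_le.
rewrite [X in (_ + _ * X)%E]DC D1 [X in (_ * X + _)%E]D1 -EFinB -!EFinM -EFinD.
by congr EFin; ring.
Qed.

Section pcn_process.
Context (R : realType) (H : completeNormedModType R).
Variable dot : {dot H for idfun}.
Hypotheses (hdot : norm_from_dot dot) (hsep : separable H).
Context (d : measure_display) (Omega : measurableType d) (P : probability Omega R).
Variables (U : nat -> {RV P >-> R}) (Z : nat -> {RV P >-> borel H}).
Variable gamma : probability (borel H) R.
Hypothesis hnoise : pcn_noise U Z gamma.
Variables (rho : R) (g : H -> R).
Hypothesis mg : measurable_fun setT (g : borel H -> R).
Local Notation HH := (borel H * borel H)%type.
Local Notation unif := (uniform01 R).
Local Notation X := (pcn U Z rho g).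
Local Notation mprop := (measurable_pcn_proposal hdot hsep).
Local Notation mix := (pcn_mix rho g).
Local Notation K := (pcn_op gamma rho g).

Let step (t : HH * R) : borel H := pcn_step rho g t.1.1 t.1.2 t.2.

Let mstep : measurable_fun setT step.
Proof.
have m11 : measurable_fun setT (fun t : HH * R => t.1.1).
  exact: (measurableT_comp measurable_fst).
have m12 : measurable_fun setT (fun t : HH * R => t.1.2).
  exact: (measurableT_comp measurable_snd).
have mp : measurable_fun setT (fun t : HH * R => pcn_proposal rho t.1.1 t.1.2 : borel H).
  exact: mprop.
rewrite /step /pcn_step; apply: measurable_fun_ifT => //.
apply: measurable_fun_ler; first exact: measurable_snd.
apply: measurableT_comp => //; apply: measurable_funB; first exact: (measurableT_comp mg).
exact: (measurableT_comp mg).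
Qed.

Lemma measurable_pcn x t : measurable_fun setT (X x t : Omega -> borel H).
Proof.
elim: t => [|t IH] /=; first exact: measurable_cst.
have m3 : measurable_fun setT (fun w => ((X x t w : borel H, Z t w : borel H), U t w)).
  by apply: measurable_fun_pair => //; apply: measurable_fun_pair.
exact: (measurableT_comp mstep m3).
Qed.


Let noise (i : nat + nat) : set (set Omega) :=
  match i with
  | inl t => g_sigma_algebra_preimage (U t)
  | inr t => g_sigma_algebra_preimage (Z t)
  end.

Let time (i : nat + nat) : nat := match i with inl t | inr t => t end.

Let measurable_noise i A : noise i A -> measurable A.
Proof.
by case: i => t [B mB <-]; rewrite setTI -[X in measurable X]setTI; exact: measurable_funP.
Qed.

Let noiseE (J : {fset nat + nat}) A : (forall i, i \in J -> noise i (A i)) ->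
  P (\bigcap_(i in [set` J]) A i) = (\prod_(i <- J) P (A i))%E.
Proof. by have [_ _ indep] := hnoise; exact: indep. Qed.

Let measurable_bigcap_noise (J : {fset nat + nat}) A :
  (forall i, i \in J -> noise i (A i)) -> measurable (\bigcap_(i in [set` J]) A i).
Proof.
move=> JA; rewrite bigcap_fset big_seq; elim/big_ind: _ => //.
  exact: measurableI.
by move=> i iJ; apply: (@measurable_noise i); exact: JA.
Qed.

Let nonneg_prob W : measurable W -> exists c : {nonneg R}, P W = c%:num%:E.
Proof.
move=> mW; exists (NngNum (fine_ge0 (measure_ge0 P W))).
by rewrite /= fineK// fin_num_measure.
Qed.

(** The first premise is the induction hypothesis of [pcn_independent] at time [t]. State, Gaussian
    and uniform variable at time [t] are then distributed as a product and independent of any event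
    of the noise after [t]. *)
Lemma pcn_step_law x t (J : {fset nat + nat}) A :
  (forall (J : {fset nat + nat}) A (B : set (borel H)), (forall i, i \in J -> noise i (A i)) ->
    (forall i, i \in J -> t <= time i)%N -> measurable B ->
    P ((X x t : Omega -> borel H) @^-1` B `&` \bigcap_(i in [set` J]) A i) =
    (P ((X x t : Omega -> borel H) @^-1` B) * P (\bigcap_(i in [set` J]) A i))%E) ->
  (forall i, i \in J -> noise i (A i)) -> (forall i, i \in J -> t < time i)%N ->
  forall E, measurable E ->
  P ((fun w => ((X x t w : borel H, Z t w : borel H), U t w)) @^-1` E `&`
     \bigcap_(i in [set` J]) A i) =
  (P (\bigcap_(i in [set` J]) A i) *
   product_prob (product_prob (law P (measurable_pcn x t)) gamma) unif E)%E.
Proof.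
move=> indep JA Jt; set W := \bigcap_(i in _) _.
have mW : measurable W by exact: measurable_bigcap_noise.
have [hU hZ _] := hnoise.
have rect (B C : set (borel H)) (D : set R) : measurable B -> measurable C -> measurable D ->
    P ((X x t : Omega -> borel H) @^-1` B `&` Z t @^-1` C `&` (U t @^-1` D `&` W)) =
    (P ((X x t : Omega -> borel H) @^-1` B) * (gamma C * (unif D * P W)))%E.
  move=> mB mC mD.
  (* The two noise variables of time [t] join the later ones, so that the premise and the
     independence of the noise factor all the events. *)
  pose J' := (inl t |` (inr t |` J))%fset.
  pose A' i := if i == inl t then U t @^-1` D else if i == inr t then Z t @^-1` C else A i.
  have tJ i : i \in J -> A' i = A i.
    move=> /Jt; rewrite /A'; case: eqVneq => [->|_]; first by rewrite ltnn.
    by case: eqVneq => [->|_]//; rewrite ltnn.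
  have nl : inl t \notin (inr t |` J)%fset.
    by rewrite !inE; apply/negP => /Jt; rewrite ltnn.
  have nr : inr t \notin J by apply/negP => /Jt; rewrite ltnn.
  have A'l : A' (inl t) = U t @^-1` D by rewrite /A' eqxx.
  have A'r : A' (inr t) = Z t @^-1` C by rewrite /A' eqxx.
  have J'A i : i \in J' -> noise i (A' i).
    rewrite /J' !inE => /or3P[/eqP->|/eqP->|iJ].
    - by rewrite A'l; exists D => //; rewrite setTI.
    - by rewrite A'r; exists C => //; rewrite setTI.
    - by rewrite tJ//; exact: JA.
  have J't i : i \in J' -> (t <= time i)%N.
    rewrite /J' !inE => /or3P[/eqP->//|/eqP->//|/Jt]; exact: ltnW.
  have W' : \bigcap_(i in [set` J']) A' i = U t @^-1` D `&` (Z t @^-1` C `&` W).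
    rewrite /J' !bigcap_fsetU1 A'l A'r; congr (_ `&` (_ `&` _)).
    by apply: eq_bigcapr => i; exact: tJ.
  have := indep J' A' B J'A J't mB.
  rewrite noiseE// W' /J' !big_fsetU1//= A'l A'r (eq_big_seq (fun i => P (A i))); last first.
    by move=> i iJ; rewrite tJ.
  rewrite -noiseE// -/W => h.
  have PU : P (U t @^-1` D) = unif D by exact: hU.
  have PZ : P (Z t @^-1` C) = gamma C by exact: hZ.
  rewrite -setIA (setICA (Z t @^-1` C)) h PU PZ.
  by rewrite muleCA.
have mX := measurable_pcn x t.
have mUt D : measurable D -> measurable (U t @^-1` D).
  by move=> mD; rewrite -[X in measurable X]setTI; exact: measurable_funP.
have [c cE] := nonneg_prob mW.
have pairs E D : measurable E -> measurable D ->
    P ((fun w => (X x t w : borel H, Z t w : borel H)) @^-1` E `&` U t @^-1` D `&` W) =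
    (c%:num%:E * (product_prob (law P mX) gamma E * unif D))%E.
  move=> mE mD.
  have [c' c'E] : exists c' : {nonneg R}, (c%:num%:E * unif D)%E = c'%:num%:E.
    have fD : unif D \is a fin_num by exact: fin_num_measure.
    have f0 : 0 <= fine (unif D) by exact: fine_ge0.
    exists (NngNum (mulr_ge0 (ge0 c) f0)).
    by rewrite /= EFinM fineK.
  rewrite -setIA.
  have := joint_law (m1 := law P mX) (m2 := gamma) (c := c') mX (measurable_funPT (Z t))
    (measurableI _ _ (mUt _ mD) mW) _ mE.
  move=> ->.
    by rewrite -c'E -muleA; congr (_ * _)%E; exact: muleC.
  move=> B C mB mC; rewrite rect// cE -c'E.
  by rewrite [RHS]muleC -[RHS]muleA [(unif D * _)%E]muleC.
have mXZ : measurable_fun setT (fun w => (X x t w : borel H, Z t w : borel H)).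
  by apply: measurable_fun_pair.
move=> E mE; rewrite cE.
exact: (joint_law (m2 := unif) mXZ (measurable_funPT (U t)) mW pairs mE).
Qed.

(** The state at time [t] is built from the noise strictly before [t]. In the induction step the
    event at [t + 1] becomes an event of the triple at time [t], and the empty family identifies its
    probability. *)
Lemma pcn_independent x t (J : {fset nat + nat}) A (B : set (borel H)) :
  (forall i, i \in J -> noise i (A i)) -> (forall i, i \in J -> t <= time i)%N ->
  measurable B ->
  P ((X x t : Omega -> borel H) @^-1` B `&` \bigcap_(i in [set` J]) A i) =
  (P ((X x t : Omega -> borel H) @^-1` B) * P (\bigcap_(i in [set` J]) A i))%E.
Proof.
elim: t J A B => [|t IH] J A B JA Jt mB.
  have [Bx|Bx] := pselect (B x).
    rewrite (_ : _ @^-1` B = setT); last by apply/seteqP; split=> // w _.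
    by rewrite setTI probability_setT mul1e.
  rewrite (_ : _ @^-1` B = set0); last by apply/seteqP; split=> // w.
  by rewrite set0I measure0 mul0e.
have mS : measurable (step @^-1` B).
  by rewrite -[X in measurable X]setTI; exact: mstep.
have st (J' : {fset nat + nat}) A' : (forall i, i \in J' -> noise i (A' i)) -> (forall i, i \in J' -> t < time i)%N ->
    P ((X x t.+1 : Omega -> borel H) @^-1` B `&` \bigcap_(i in [set` J']) A' i) =
    (P (\bigcap_(i in [set` J']) A' i) *
     product_prob (product_prob (law P (measurable_pcn x t)) gamma) unif (step @^-1` B))%E.
  by move=> J'A J't; rewrite -(pcn_step_law IH J'A J't mS).
have := st fset0 (fun=> set0); rewrite set_fset0 bigcap_set0 setIT probability_setT mul1e => -> //.
by rewrite st// muleC.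
Qed.

(** The triple at time [t] has a product law; the uniform variable is integrated out first, which
    leaves [pcn_mix]. *)
Lemma ge0_integral_pcn_step x t (u : H -> R) : measurable_fun setT (u : borel H -> R) ->
  (forall x, 0 <= u x) ->
  (\int[P]_w (u (X x t.+1 w))%:E = \int[P]_w \int[gamma]_z (mix u (X x t w) z)%:E)%E.
Proof.
move=> mu u0; have mX := measurable_pcn x t.
have mXZU : measurable_fun setT (fun w => ((X x t w : borel H, Z t w : borel H), U t w)).
  by apply: measurable_fun_pair => //; apply: measurable_fun_pair.
pose F (t : HH * R) := (u (step t))%:E.
have mF : measurable_fun setT F by apply/measurable_EFinP; exact: (measurableT_comp mu mstep).
have F0 t' : (0 <= F t')%E by rewrite lee_fin.
rewrite -[LHS](ge0_integral_law P mXZU mF F0).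
transitivity (\int[product_prob (product_prob (law P mX) gamma) unif]_t' F t')%E.
  apply: eq_measure_integral.
  move=> E mE _.
  have := @pcn_step_law x t fset0 (fun=> set0) (@pcn_independent x t).
  rewrite set_fset0 bigcap_set0 => /(_ _ _ E mE); rewrite setIT probability_setT mul1e => h.
  by apply: h => i; rewrite inE.
rewrite (fubini_tonelli1 (m1 := product_prob (law P mX) gamma) (m2 := unif) F mF F0).
pose G (t : HH) := (mix u t.1 t.2)%:E.
have mG : measurable_fun setT G.
  apply/measurable_EFinP; exact: (measurable_pcn_mix hdot hsep rho mg mu measurable_fst measurable_snd).
have G0 t' : (0 <= G t')%E by rewrite lee_fin; exact: pcn_mix_ge0.
have mG1 : measurable_fun setT (fun x => \int[gamma]_z G (x, z))%E.
  exact: (measurable_fun_fubini_tonelli_F (m2 := gamma) G mG G0).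
transitivity (\int[product_prob (law P mX) gamma]_t' G t')%E.
  apply: eq_integral => -[y z] _; rewrite /G/= /pcn_mix -ge0_integral_uniform_if//.
    apply: eq_integral => v _; rewrite /F /step /pcn_step/=; case: ifP => //.
rewrite (fubini_tonelli1 (m1 := law P mX) (m2 := gamma) G mG G0).
rewrite -[RHS](ge0_integral_law P mX mG1)// => y.
by apply: integral_ge0 => z _.
Qed.

End pcn_process.

(** * Densities of the laws of the chain *)

Section positive_part.
Context d (T : measurableType d) (R : realType).
Variables (mu nu : probability T R) (f : T -> R).
Hypothesis fE : is_density nu mu f.

(** [is_density] allows negative values on a null set, whereas reversibility and invariance are
    stated for nonnegative functions. The positive part is a density as well and keeps the Hölder
    constant. *)
Lemma is_density_pos : is_density nu mu (fun x => Num.max (f x) 0).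
Proof.
have [mf nuE] := fE; split; first exact: measurable_maxr.
pose N := [set x | f x < 0].
have mN : measurable N.
  by rewrite -[X in measurable X]setTI; exact: (measurable_fun_ltr mf (measurable_cst _)).
have mNC : measurable (~` N) by exact: measurableC.
have nuN : nu N = 0%E.
  apply/eqP; rewrite eq_le measure_ge0 andbT nuE//.
  have N0 x : N x -> (0 <= (- f x)%:E)%E by move=> Nx; rewrite lee_fin oppr_ge0 ltW.
  rewrite (eq_integral (fun x => - (- f x)%:E)%E); last first.
    by move=> x _; rewrite EFinN oppeK.
  by rewrite integral_ge0N// oppe_le0; exact: integral_ge0.
move=> A mA.
have -> : nu A = nu (A `&` ~` N).
  apply/eqP; rewrite eq_le; apply/andP; split; last first.
    by apply: le_measure; rewrite ?inE//; exact: measurableI.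
  rewrite -[leRHS]adde0 -nuN; apply: le_trans (measureU2 _ _ _) => //; last exact: measurableI.
  apply: le_measure; rewrite ?inE//; first by apply: measurableU => //; exact: measurableI.
  by move=> x Ax; have [?|?] := pselect (N x); [right|left].
rewrite nuE; last exact: measurableI.
rewrite integral_mkcond [RHS]integral_mkcond; apply: eq_integral => x _.
rewrite !patchE in_setI in_setC; case: (x \in A) => //=.
have [fx|fx] := ltP (f x) 0; first by rewrite mem_set.
by rewrite memNset//= => /(le_lt_trans fx); rewrite ltxx.
Qed.

End positive_part.

Section pcn_law_density.
Context (R : realType) (H : completeNormedModType R).
Variable dot : {dot H for idfun}.
Hypotheses (hdot : norm_from_dot dot) (hsep : separable H).
Variable gamma : probability (borel H) R.
Local Notation HH := (borel H * borel H)%type.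
Local Notation gg := (product_prob gamma gamma).
Hypothesis grot : forall (a b : R) (A : set HH), a ^+ 2 + b ^+ 2 = 1 ->
  measurable A -> gg (rotation a b @^-1` A) = gg A.
Hypothesis moment4 : (\int[gamma]_x ((1 + `|(x : H)|) ^+ 4)%:E < +oo)%E.
Context (d : measure_display) (Omega : measurableType d) (P : probability Omega R).
Variables (U : nat -> {RV P >-> R}) (Z : nat -> {RV P >-> borel H}).
Hypothesis hnoise : pcn_noise U Z gamma.
Variables (rho : R) (g : H -> R).
Hypothesis rho01 : 0 <= rho < 1.
Hypothesis mg : measurable_fun setT (g : borel H -> R).
Variables (k : R) (Pi : probability (borel H) R).
Hypothesis k0 : 0 < k.
Local Notation w := (pcn_weight k g).
Hypothesis hPi : forall A : set (borel H), measurable A ->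
  (Pi A = \int[gamma]_(x in A) (w x)%:E)%E.
Local Notation K := (pcn_op gamma rho g).

(** Peeling off the last step replaces [u] by [K u], so that the induction runs over functions while
    the starting point stays fixed. *)
Lemma pcn_expectation x t (u : H -> R) : linear_growth u -> (forall x, 0 <= u x) ->
  (\int[P]_w (u (pcn U Z rho g x t w))%:E = (iter t K u x)%:E)%E.
Proof.
elim: t u => [|t IH] u ug u0; first by rewrite /= integral_cst//= probability_setT mule1.
have [mu _] := ug.
rewrite (ge0_integral_pcn_step hdot hsep hnoise rho mg x t mu u0) iterSr -IH; last 2 first.
- exact: (pcn_op_growth hdot hsep moment4 rho01 mg ug).
- by move=> y; exact: pcn_op_ge0.
by apply: eq_integral => v _; rewrite -(EFin_pcn_op hdot hsep moment4 rho01 mg _ ug).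
Qed.

Lemma linear_growth_indic (A : set (borel H)) : measurable A -> linear_growth (\1_A : H -> R).
Proof.
move=> mA; split; first exact: measurable_indic.
exists 1 => x; rewrite mul1r; apply: (@le_trans _ _ 1); last by rewrite lerDl.
by rewrite indicE; case: (_ \in _); rewrite ?normr1 ?normr0.
Qed.

Lemma pcn_kernelE x t (A : set (borel H)) : measurable A ->
  pcn_kernel U Z rho g t x A = (iter t K \1_A x)%:E.
Proof.
move=> mA; rewrite -pcn_expectation; last 2 first.
- exact: linear_growth_indic.
- by move=> y; rewrite indicE.
have mXA : measurable ((pcn U Z rho g x t : Omega -> borel H) @^-1` A).
  by rewrite -[X in measurable X]setTI; exact: (measurable_pcn hdot hsep U Z rho mg x t).
rewrite /pcn_kernel /pushforward -[X in P X]setIT -(integral_indic P measurableT mXA).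
by apply: eq_integral => v _.
Qed.

(** Integrating the kernel against [nu] pairs [f] with the iterates of [K] on an indicator;
    reversibility moves them onto [f]. *)
Lemma pcn_law_density (nu : probability (borel H) R) (f : H -> R) t :
  linear_growth f -> (forall x, 0 <= f x) -> is_density nu Pi f ->
  is_density (pcn_law U Z rho g nu t) Pi (iter t K f).
Proof.
move=> fg f0 [mf nuE]; split.
  by have [] := linear_growth_iter hdot hsep moment4 rho01 mg t fg.
move=> A mA; rewrite /pcn_law.
have Ag := linear_growth_indic mA.
have A0 (x : H) : 0 <= \1_A x :> R by rewrite indicE.
under eq_integral do rewrite pcn_kernelE//.
have mKA : measurable_fun setT (fun x : borel H => (iter t K \1_A x)%:E).
  by apply/measurable_EFinP; have [] := linear_growth_iter hdot hsep moment4 rho01 mg t Ag.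
have KA0 x : (0 <= (iter t K \1_A x)%:E)%E by rewrite lee_fin; exact: iter_pcn_op_ge0.
rewrite (ge0_integral_density mf f0 nuE mKA KA0).
under eq_integral do rewrite -EFinM mulrC.
rewrite (iter_pcn_op_reversible hdot hsep grot moment4 rho01 mg k0 hPi t fg Ag f0 A0) [RHS]integral_mkcond.
apply: eq_integral => x _; rewrite patchE indicE; case: (x \in A).
  by rewrite mulr1.
by rewrite mulr0.
Qed.

End pcn_law_density.

Lemma hoelder_continuous_seminorm (R : realType) (H : completeNormedModType R)
    (beta : R) (f : H -> R) : beta != 0 -> hoelder_continuous beta f ->
  exists S : R, [/\ hoelder_seminorm beta f = S%:E, 0 <= S &
    forall x y, `|f x - f y| <= S * `|x - y| `^ beta].
Proof.
move=> b0 [L fL]; set s := hoelder_seminorm beta f.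
have s0 : (0 <= s)%E by rewrite le_max lexx.
have sy : (s < +oo)%E.
  rewrite gt_max ltry/=; apply: (@le_lt_trans _ _ (`|L|)%:E); last exact: ltry.
  apply: ub_ereal_sup => _ [[x y] /= xy <-]; rewrite lee_fin.
  rewrite ler_pdivrMr ?powR_gt0 ?normr_gt0 ?subr_eq0//.
  by apply: (le_trans (fL x y)); rewrite ler_wpM2r ?powR_ge0// ler_norm.
have sf : s \is a fin_num by rewrite ge0_fin_numE.
exists (fine s); split; [by rewrite fineK|exact: fine_ge0|] => x y.
have [<-|xy] := eqVneq x y; first by rewrite subrr normr0 mulr_ge0 ?fine_ge0 ?powR_ge0.
rewrite -ler_pdivrMr ?powR_gt0 ?normr_gt0 ?subr_eq0// -lee_fin fineK//.
rewrite /s /hoelder_seminorm le_max; apply/orP; right.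
by apply: ereal_sup_ubound; exists (x, y).
Qed.

Lemma ler_norm_max0B (R : realDomainType) (a b : R) :
  `|Num.max a 0 - Num.max b 0| <= `|a - b|.
Proof.
have := ler_norm (a - b); have := ler_norm (b - a); rewrite (distrC b a) ler_norml.
by case: (leP a 0) => ?; case: (leP b 0) => ? ? ?; apply/andP; split; lra.
Qed.

(** The decay estimate divides by the Hölder constant and needs it positive. A constant density is
    covered by letting larger constants [S'] tend to 0; a positive [a] would be refuted by the [S']
    with [c S'^2 = a / 2]. *)
Lemma le_scaled_sqr (R : realType) (a c S : R) : 0 < c -> 0 <= S ->
  (forall S', 0 < S' -> S <= S' -> a <= c * S' ^+ 2) -> a <= c * S ^+ 2.
Proof.
move=> c0 S0 h; have [S1|] := ltP 0 S; first exact: h.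
move=> S1; have SE : S = 0 by apply/eqP; rewrite eq_le S0 S1.
rewrite SE expr0n/= mulr0 leNgt; apply/negP => a0.
pose S' := Num.sqrt (a / (2 * c)).
have q0 : 0 < a / (2 * c) by rewrite divr_gt0// mulr_gt0.
have S'0 : 0 < S' by rewrite sqrtr_gt0.
have := h S' S'0; rewrite SE => /(_ (ltW S'0)); rewrite sqr_sqrtr ?(ltW q0)//.
rewrite (_ : c * (a / (2 * c)) = a / 2); last by field; rewrite gt_eqF.
lra.
Qed.

Theorem proposition8 (R : realType) (H : completeNormedModType R)
    (dot : {dot H for idfun}) (hdot : norm_from_dot dot)
    (hsep : separable H)
    (gamma : probability (borel H) R) (Cgamma : {linear H -> H})
    (hgauss : gaussian_measure dot gamma)
    (hmean : centered dot gamma)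
    (hcov : covariance_operator dot gamma Cgamma)
    (htr : finite_trace dot Cgamma)
    (d : measure_display) (Omega : measurableType d)
    (P : probability Omega R)
    (U : nat -> {RV P >-> R}) (Z : nat -> {RV P >-> borel H})
    (hnoise : pcn_noise U Z gamma)
    (rho : R) (hrho : 0 <= rho < 1)
    (beta : R) (hbeta : 0 < beta <= 1)
    (g : H -> R) (hg : hoelder_continuous beta g)
    (hinf : (-oo < ereal_inf [set (g x)%:E | x in [set: H]])%E)
    (Pi : probability (borel H) R)
    (hPi : exists2 k : R, 0 < k &
       is_density Pi gamma (fun x => k * expR (- g x)))
    (p : R) (hp : 1 < p) :
  exists C c : R, [/\ 0 < C, 0 < c &
    forall (t : nat) (nu : probability (borel H) R) (f : H -> R),
      (1 <= t)%N ->
      is_density nu Pi f -> hoelder_continuous beta f ->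
      (chi2 (pcn_law U Z rho g nu t) Pi <=
       (C * expR (- c * (ln (2 * t%:R) `^ (2 / beta))))%:E
         * hoelder_seminorm beta f ^+ 2)%E].
Proof.
have [b0 b1] := andP hbeta.
have bN : beta != 0 by rewrite gt_eqF.
have [k k0 [_ PiE]] := hPi.
have [L0 gL0] := hg.
(* The radius of the ball is defined through a division by [L], so the Hölder constant of [g] is
   raised to at least 1. *)
pose L := Num.max 1 L0.
have L1 : 1 <= L by rewrite le_max lexx.
have gL x y : `|g x - g y| <= L * `|x - y| `^ beta.
  by rewrite (le_trans (gL0 x y))// ler_wpM2r ?powR_ge0// le_max lexx orbT.
have mg := measurable_hoelder hbeta (le_trans ler01 L1) gL.
have grot (a b : R) (A : set (borel H * borel H)) : a ^+ 2 + b ^+ 2 = 1 -> measurable A ->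
    product_prob gamma gamma (rotation a b @^-1` A) = product_prob gamma gamma A.
  by move=> ab mA; apply: (rotation_invariant hdot hsep hgauss hmean hcov ab).
have [kappa kappa0 expE] := fernique hdot hsep grot.
have m4 := expo_moment4 kappa0 expE.
have [ginf gi] : exists b : R, forall x, b <= g x.
  exists (fine (ereal_inf [set (g x)%:E | x in [set: H]])) => x.
  have le : (ereal_inf [set (g x)%:E | x in [set: H]] <= (g x)%:E)%E.
    by apply: ereal_inf_lbound; exists x.
  rewrite -lee_fin fineK// fin_numElt hinf; exact: le_lt_trans le (ltry _).
pose K0 := k * expR (- ginf).
have wK x : pcn_weight k g x <= K0.
  by rewrite ler_wpM2l ?(ltW k0)// ler_expR lerN2.
have m4P := target_moment4 m4 mg k0 PiE wK.
have [C [c [C0 c0 decay]]] := pcn_density_decay hdot hsep grot hrho hbeta L1 gL k0 PiE wK.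
exists C, c; split=> // t nu f t1 fd fh.
have [S [-> S0 fS]] := hoelder_continuous_seminorm bN fh.
pose f' (x : H) := Num.max (f x) 0.
have f'0 x : 0 <= f' x by rewrite le_max lexx orbT.
have f'S x y : `|f' x - f' y| <= S * `|x - y| `^ beta.
  exact: le_trans (ler_norm_max0B _ _) (fS x y).
have f'd := is_density_pos fd.
have f'1 : (\int[Pi]_x (f' x)%:E = 1)%E.
  by have [_ <-] := f'd; rewrite // probability_setT.
have f'g := linear_growth_hoelder hbeta S0 f'S.
have ig := linear_growth_iter hdot hsep m4 hrho mg t f'g.
have ld := pcn_law_density hdot hsep grot m4 hnoise hrho mg k0 PiE t f'g f'0 f'd.
(* [chi2] is an infimum over densities, so that exhibiting one bounds it from above. *)
apply: (@le_trans _ _ (\int[Pi]_x ((iter t (pcn_op gamma rho g) f' x - 1) ^+ 2)%:E)%E).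
  by apply: ereal_inf_lbound; exists (iter t (pcn_op gamma rho g) f').
have [mv [D D0 vD]] := linear_growthP (linear_growthB 1 ig).
have iv2 : Pi.-integrable setT (EFin \o (fun x : borel H => (iter t (pcn_op gamma rho g) f' x - 1) ^+ 2)).
  apply: (@integrable_le_nrm4 _ _ _ m4P _ (D ^+ 2)); first exact: measurable_funX.
  move=> x; rewrite normrX; apply: (@le_trans _ _ ((D * nrm x) ^+ 2)).
    apply: lerXn2r; rewrite ?nnegrE ?normr_ge0//.
    by rewrite mulr_ge0// (le_trans _ (nrm_ge1 x)).
  by rewrite exprMn ler_wpM2l ?sqr_ge0// nrm_pow_le.
rewrite (EFin_Rintegral iv2) -EFin_expe -EFinM lee_fin mulNr.
apply: le_scaled_sqr => //; first by rewrite mulr_gt0// expR_gt0.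
move=> S' S'0 SS'; apply: decay => // x y.
by rewrite (le_trans (f'S x y))// ler_wpM2r ?powR_ge0.
Qed.
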